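(* Let $E$ be a finite directed graph, let $\gamma:\mathbb{T}\to\operatorname{Aut}\mathcal{T}C^*(E)$ be the gauge action and define $\alpha:\mathbb{R}\to\operatorname{Aut}\mathcal{T}C^*(E)$ by $\alpha_t=\gamma_{e^{it}}$. Suppose that $\epsilon$ is a probability measure on $E^0$. Then there is a KMS$_\infty$ state $\phi_\epsilon$ of $(\mathcal{T}C^*(E),\alpha)$ satisfying, for $\mu,\nu\in E^*$, $$\phi_\epsilon(s_\mu s_\nu^* )=\begin{cases}0&\text{unless }|\mu|=|\nu|=0\text{ and }\mu=\nu,\\ \epsilon_v&\text{if }\mu=\nu=v\in E^0.\end{cases}$$ Every ground state of $(\mathcal{T}C^*(E),\alpha)$ is a KMS$_\infty$ state, and the map $\epsilon\mapsto\phi_\epsilon$ is an affine isomorphism of the simplex of probability measures on $E^0$ onto the set of ground states of $(\mathcal{T}C^*(E),\alpha)$.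
   Context: Graphs. A directed graph $E=(E^0,E^1,r,s)$ has a (nonempty) vertex set $E^0$, edge set $E^1$, and range and source maps $r,s:E^1\to E^0$; it is finite if $E^0$ and $E^1$ are finite. A path of length $n\ge 1$ is $\mu=\mu_1\cdots\mu_n$ with $\mu_i\in E^1$ and $s(\mu_i)=r(\mu_{i+1})$; $r(\mu)=r(\mu_1)$, $s(\mu)=s(\mu_n)$, $|\mu|=n$. Vertices are paths of length $0$ with $r(v)=s(v)=v$. $E^*$ is the set of all finite paths; $vE^1=\{e\in E^1:r(e)=v\}$. Toeplitz algebra. A Toeplitz-Cuntz-Krieger $E$-family consists of mutually orthogonal projections $\{P_v:v\in E^0\}$ and partial isometries $\{S_e:e\in E^1\}$ with $S_e^*S_e=P_{s(e)}$ and $P_v\ge\sum_{e\in F}S_eS_e^*$ for every $v\in E^0$ and every finite $F\subset vE^1$. $\mathcal{T}C^*(E)$ is the $C^*$-algebra generated by a universal such family $(p,s)$. For $\mu=\mu_1\cdots\mu_n$, $s_\mu=s_{\mu_1}\cdots s_{\mu_n}$, and $s_v=p_v$ for $v\in E^0$; $\mathcal{T}C^*(E)$ is the closed span of the elements $s_\mu s_\nu^*$. The gauge action satisfies $\gamma_z(s_\mu s_\nu^* )=z^{|\mu|-|\nu|}s_\mu s_\nu^*$ $(z\in\mathbb{T})$; so $\alpha_z(s_\mu s_\nu^* )=e^{iz(|\mu|-|\nu|)}s_\mu s_\nu^*$ is defined for all $z\in\mathbb{C}$. KMS, KMS$_\infty$ and ground states. For $\beta\in\mathbb{R}\setminus\{0\}$,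 a state $\phi$ is a KMS$_\beta$ state if $\phi(ab)=\phi(b\,\alpha_{i\beta}(a))$ for all $\alpha$-analytic $a,b$ (equivalently for all $a,b\in\{s_\mu s_\nu^*:\mu,\nu\in E^*\}$). A KMS$_\infty$ state is a weak* limit of a sequence of KMS$_{\beta_n}$ states with $\beta_n\to\infty$. A state $\phi$ is a ground state if for all $a,b\in\{s_\mu s_\nu^*:\mu,\nu\in E^*\}$ the function $z\mapsto\phi(a\,\alpha_z(b))$ is bounded on the upper half-plane. A probability measure on $E^0$ is identified with a vector in $[0,\infty)^{E^0}$ whose entries sum to $1$. An affine isomorphism is an affine bijection between convex sets. *)

(* Defs.v *)
From HB Require Import structures.
From mathcomp Require Import all_boot all_order all_algebra.
From mathcomp Require Import complex.
From mathcomp Require Import all_classical all_reals all_analysis.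

Set Implicit Arguments.
Unset Strict Implicit.
Unset Printing Implicit Defensive.

Import Order.TTheory GRing.Theory Num.Theory.
Import numFieldNormedType.Exports.

Local Open Scope classical_set_scope.
Local Open Scope ring_scope.
Local Open Scope complex_scope.

(* C*-algebras are not assumed unital, hence the multiplication cannot be the
   one of [algType]. *)
HB.mixin Record isCstarAlgebra (R : realType) (A : Type)
    of CompleteNormedModule R[i] A := {
  cmul : A -> A -> A;
  cadj : A -> A;
  cmulA : associative cmul;
  cmulDl : left_distributive cmul +%R;
  cmulDr : right_distributive cmul +%R;
  cmulZl : forall (c : R[i]) (a b : A), cmul (c *: a) b = c *: cmul a b;
  cmulZr : forall (c : R[i]) (a b : A), cmul a (c *: b) = c *: cmul a b;
  cadjK : involutive cadj;
  cadjD : {morph cadj : a b / a + b};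
  cadjZ : forall (c : R[i]) (a : A), cadj (c *: a) = c^* *: cadj a;
  cadjM : forall a b : A, cadj (cmul a b) = cmul (cadj b) (cadj a);
  cnormM : forall a b : A, `|cmul a b| <= `|a| * `|b|;
  cnormE : forall a : A, `|cmul (cadj a) a| = `|a| ^+ 2
}.

#[short(type="cstarAlgType")]
HB.structure Definition CstarAlgebra (R : realType) :=
  {A of isCstarAlgebra R A & CompleteNormedModule R[i] A}.

Declare Scope cstar_scope.
Delimit Scope cstar_scope with cs.
Notation "a ⋅ b" := (cmul a b) (at level 40, left associativity) : cstar_scope.
Local Open Scope cstar_scope.

Definition star_hom (R : realType) (A B : cstarAlgType R) (f : A -> B) : Prop :=
  [/\ linear f,
      forall a b, f (a ⋅ b) = f a ⋅ f b
    & forall a, f (cadj a) = cadj (f a)].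

Definition projection (R : realType) (A : cstarAlgType R) (a : A) : Prop :=
  cadj a = a /\ a ⋅ a = a.

Definition partial_isometry (R : realType) (A : cstarAlgType R) (a : A) : Prop :=
  a ⋅ cadj a ⋅ a = a.

Definition cstar_le (R : realType) (A : cstarAlgType R) (a b : A) : Prop :=
  exists c : A, b - a = cadj c ⋅ c.

(* The closed *-subalgebra generated by [G] is everything. *)
Definition cstar_generated_by (R : realType) (A : cstarAlgType R) (G : set A) :
    Prop :=
  forall X : set A,
    G `<=` X -> closed X ->
    (forall (c : R[i]) (a b : A), X a -> X b -> X (c *: a + b)) ->
    (forall a b, X a -> X b -> X (a ⋅ b)) ->
    (forall a, X a -> X (cadj a)) ->
    X = setT.

(* Positive linear functionals of norm exactly 1. *)
Definition is_state (R : realType) (A : cstarAlgType R) (phi : A -> R[i]) :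
    Prop :=
  [/\ scalar phi,
      forall a, 0 <= phi (cadj a ⋅ a),
      forall a, `|phi a| <= `|a|
    & forall M : R, (forall a, `|phi a| <= M%:C * `|a|) -> 1 <= M].

Definition entire (R : realType) (A : cstarAlgType R) (f : R[i] -> A) : Prop :=
  exists c : nat -> A, forall z : R[i],
    series (fun n => z ^+ n *: c n) @ \oo --> f z.

(* [f z] is alpha_z(a), since an entire extension is unique. *)
Definition analytic_extension (R : realType) (A : cstarAlgType R)
    (alpha : R -> A -> A) (a : A) (f : R[i] -> A) : Prop :=
  entire f /\ forall t : R, f t%:C = alpha t a.

Definition analytic (R : realType) (A : cstarAlgType R)
    (alpha : R -> A -> A) (a : A) : Prop :=
  exists f, analytic_extension alpha a f.

Definition is_KMS (R : realType) (A : cstarAlgType R)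
    (alpha : R -> A -> A) (beta : R) (phi : A -> R[i]) : Prop :=
  [/\ is_state phi,
      beta != 0
    & forall (a b : A) (f : R[i] -> A),
        analytic_extension alpha a f -> analytic alpha b ->
        phi (a ⋅ b) = phi (b ⋅ f (0 +i* beta))].

Definition is_KMS_infty (R : realType) (A : cstarAlgType R)
    (alpha : R -> A -> A) (phi : A -> R[i]) : Prop :=
  is_state phi /\
  exists (beta : nat -> R) (psi : nat -> A -> R[i]),
    [/\ forall n, is_KMS alpha (beta n) (psi n),
        beta @ \oo --> +oo
      & forall a : A, (fun n => psi n a : R[i]^o) @ \oo --> (phi a : R[i]^o)].

(* [D] is the set of analytic elements on which boundedness is tested. For the
   gauge dynamics and b = s_mu s_nu^*, [f z] is e^(iz(|mu| - |nu|)) b. *)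
Definition is_ground (R : realType) (A : cstarAlgType R)
    (alpha : R -> A -> A) (D : set A) (phi : A -> R[i]) : Prop :=
  is_state phi /\
  forall a b : A, D a -> D b ->
    exists2 f : R[i] -> A, analytic_extension alpha b f &
      exists M : R, forall z : R[i], 0 <= complex.Im z ->
        `|phi (a ⋅ f z)| <= M%:C.

Record digraph := Digraph {
  vertex : finType;
  edge : finType;
  rng : edge -> vertex;
  src : edge -> vertex;
  vertex_nonempty : (0 < #|vertex|)%N
}.

(* [PEdges e l _] is the path e l_1 ... l_k of length k + 1. *)
Inductive gpath (E : digraph) : Type :=
| PVertex of vertex E
| PEdges (e : edge E) (l : seq (edge E))
    of path (fun e1 e2 => src e1 == rng e2) e l.

Definition plength (E : digraph) (mu : gpath E) : nat :=
  match mu with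
  | PVertex _ => 0
  | PEdges _ l _ => (size l).+1
  end.

Definition TCK_family (R : realType) (E : digraph) (A : cstarAlgType R)
    (P : vertex E -> A) (S : edge E -> A) : Prop :=
  [/\ forall v, projection (P v),
      forall v w, v != w -> P v ⋅ P w = 0,
      forall e, partial_isometry (S e),
      forall e, cadj (S e) ⋅ S e = P (src e)
    & forall (v : vertex E) (F : {set edge E}),
        (forall e, e \in F -> rng e = v) ->
        cstar_le (\sum_(e in F) S e ⋅ cadj (S e)) (P v)].

Definition is_toeplitz_algebra (R : realType) (E : digraph) (A : cstarAlgType R)
    (p : vertex E -> A) (s : edge E -> A) : Prop :=
  [/\ TCK_family p s,
      cstar_generated_by (range p `|` range s)
    & forall (B : cstarAlgType R) (P : vertex E -> B) (S : edge E -> B),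
        TCK_family P S ->
        exists pi : A -> B,
          [/\ star_hom pi, forall v, pi (p v) = P v
            & forall e, pi (s e) = S e]].

Definition spath (R : realType) (E : digraph) (A : cstarAlgType R)
    (p : vertex E -> A) (s : edge E -> A) (mu : gpath E) : A :=
  match mu with
  | PVertex v => p v
  | PEdges e l _ => foldl (fun a e' => a ⋅ s e') (s e) l
  end.

Definition spanning_set (R : realType) (E : digraph) (A : cstarAlgType R)
    (p : vertex E -> A) (s : edge E -> A) : set A :=
  [set a | exists mu nu : gpath E, a = spath p s mu ⋅ cadj (spath p s nu)].

(* The circle is the set of complex numbers of norm 1; the values of [gamma]
   elsewhere are irrelevant. The group law makes each gamma_z invertible. *)
Definition is_gauge_action (R : realType) (E : digraph) (A : cstarAlgType R)
    (p : vertex E -> A) (s : edge E -> A) (gamma : R[i] -> A -> A) : Prop :=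
  [/\ forall z, `|z| = 1 -> star_hom (gamma z),
      forall a, gamma 1 a = a,
      forall z w a, `|z| = 1 -> `|w| = 1 ->
        gamma (z * w) a = gamma z (gamma w a),
      forall z v, `|z| = 1 -> gamma z (p v) = p v
    & forall z e, `|z| = 1 -> gamma z (s e) = z *: s e].

Definition gauge_dynamics (R : realType) (A : Type)
    (gamma : R[i] -> A -> A) (t : R) : A -> A :=
  gamma (cos t +i* sin t).

Definition prob_simplex (R : realType) (V : finType) : set {ffun V -> R} :=
  [set eps | (forall v, 0 <= eps v) /\ \sum_v eps v = 1].

Definition affine_iso (R : realType) (V : finType) (A : Type)
    (K : set {ffun V -> R}) (L : set (A -> R[i]))
    (Phi : {ffun V -> R} -> A -> R[i]) : Prop :=
  set_bij K L Phi /\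
  forall (t : R) (x y : {ffun V -> R}),
    0 <= t <= 1 -> K x -> K y ->
    Phi [ffun v => t * x v + (1 - t) * y v] =
      (fun a => t%:C * Phi x a + (1 - t)%:C * Phi y a).

(* Main.v *)
Require Import Defs.
From HB Require Import structures.
From mathcomp Require Import all_boot all_order all_algebra.
From mathcomp Require Import complex.
From mathcomp Require Import all_classical all_reals all_analysis.
From mathcomp Require Import ring lra.

Set Implicit Arguments.
Unset Strict Implicit.
Unset Printing Implicit Defensive.

Import Order.TTheory GRing.Theory Num.Theory.
Import numFieldNormedType.Exports.

Local Open Scope classical_set_scope.
Local Open Scope ring_scope.
Local Open Scope complex_scope.
Local Open Scope cstar_scope.

(* The relations are represented on l2 of pairs of paths by shifts of the first
   path. The vector with entry q^|l| sqrt(eps_v) at each diagonal pair of a path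
   l with source v intertwines this action with the commuting shifts of the
   second path up to a factor q, so its vector functional phi satisfies
   q^2 phi(a s_e) = phi(s_e a). When q^2 = e^-beta this gives the KMS condition
   for words b and analytic a, by uniqueness of power series, and then for all b
   by density. As beta tends to infinity the normalized vectors converge in norm
   to the vector of phi_eps.
   Conversely, the ground condition at b = s_e^* makes psi vanish at s_e s_e^*, so
   every s_e^* kills the GNS vector of psi and psi is determined by its values
   on the p_v. The order relations of the family are used only modulo null
   vectors of psi, which avoids the order theory of abstract C*-algebras; the
   only such input is that a *-homomorphism into operators is contractive, which
   follows from 1 - h having a square root when h is self-adjoint of norm < 1. *)

(** * Square-summable families *)

(** Why pairs of paths: a Gibbs state at finite temperature is given on l2 of paths by a density,
    diagonal with weights [q^(2|l|) eps_v], and not by a vector. On pairs, that is on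
    Hilbert-Schmidt operators, the square root of the density becomes a vector and the shifts of the
    second path lie in the commutant, so the KMS condition turns into moving operators across an
    inner product. The weight [eps] sits at the sources of paths; the approximating KMS states take
    the values [eps_v] at the [p v] only in the limit, so a single scalar normalization is enough
    and no vertex matrix has to be inverted. The universal property yields homomorphisms into
    C*-algebras only, so the operators must be made into one, completeness included. The
    homomorphism comes with no continuity, while a state must satisfy [|phi a| <= |a|]; hence the
    contractivity argument. [A] comes without a unit, and the sum of the [p v] stands in for it. *)

Section UnorderedSums.
Variables (R : realType) (I : choiceType).
Implicit Types (f g : I -> R) (s : seq I).

(** Convergence along the net of finite subsets: pairs of paths have no preferred order, and the
    partial injections acting on them would not respect one. *)
Definition has_sum f (l : R) : Prop := forall e, 0 < e ->
  exists s0, forall s, uniq s -> {subset s0 <= s} ->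
    `|\sum_(i <- s) f i - l| < e.

Lemma has_sum_unique f l l' : has_sum f l -> has_sum f l' -> l = l'.
Proof.
move=> h h'; apply/eqP; rewrite -subr_eq0 -normr_le0 leNgt; apply/negP => e0.
have e2 : 0 < `|l - l'| / 2 by lra.
have [s0 hs] := h _ e2; have [s1 hs'] := h' _ e2.
have {}hs := hs (undup (s0 ++ s1)) (undup_uniq _).
have {}hs' := hs' (undup (s0 ++ s1)) (undup_uniq _).
have /hs : {subset s0 <= undup (s0 ++ s1)}.
  by move=> x xs; rewrite mem_undup mem_cat xs.
have /hs' : {subset s1 <= undup (s0 ++ s1)}.
  by move=> x xs; rewrite mem_undup mem_cat xs orbT.
set S := \sum_(i <- _) _ => h1 h2.
have := ler_normB (S - l') (S - l).
rewrite (_ : S - l' - (S - l) = l - l'); last by ring.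
lra.
Qed.

Lemma has_sumD f g l l' : has_sum f l -> has_sum g l' ->
  has_sum (fun i => f i + g i) (l + l').
Proof.
move=> h h' e e0; have e2 : 0 < e / 2 by lra.
have [s0 hs] := h _ e2; have [s1 hs'] := h' _ e2.
exists (s0 ++ s1) => s us sub.
have {}hs : `|\sum_(i <- s) f i - l| < e / 2.
  by apply: hs => // x xs; apply: sub; rewrite mem_cat xs.
have {}hs' : `|\sum_(i <- s) g i - l'| < e / 2.
  by apply: hs' => // x xs; apply: sub; rewrite mem_cat xs orbT.
rewrite big_split /= opprD addrACA; apply: (le_lt_trans (ler_normD _ _)); lra.
Qed.

Lemma has_sumZ f l c : has_sum f l -> has_sum (fun i => c * f i) (c * l).
Proof.
move=> h e e0; have [c0|cn0] := eqVneq c 0.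
  exists [::] => s _ _; rewrite c0 mul0r subr0 big1 ?normr0 // => i _.
  by rewrite mul0r.
have cp : 0 < `|c| by rewrite normr_gt0.
have [s0 hs] := h _ (divr_gt0 e0 cp).
exists s0 => s us sub; rewrite -mulr_sumr -mulrBr normrM mulrC -ltr_pdivlMr //.
exact: hs.
Qed.

Lemma has_sumN f l : has_sum f l -> has_sum (fun i => - f i) (- l).
Proof.
move=> /(has_sumZ (-1)); rewrite mulN1r => h e /h [s0 hs].
exists s0 => s us /(hs s us); rewrite (eq_bigr (fun i => - f i)) // => i _.
by rewrite mulN1r.
Qed.

Lemma ler_sum_uniq f s s' : (forall i, 0 <= f i) -> uniq s ->
  {subset s <= s'} -> \sum_(i <- s) f i <= \sum_(i <- s') f i.
Proof.
move=> f0 us sub.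
have p : perm_eq (undup s') (s ++ [seq x <- undup s' | x \notin s]).
  apply: uniq_perm => [||x]; rewrite ?undup_uniq //.
    rewrite cat_uniq us filter_uniq ?undup_uniq // andbT /=.
    by apply/hasPn => x; rewrite mem_filter => /andP[].
  rewrite mem_cat mem_filter mem_undup; case: (boolP (x \in s)) => //= xs.
  by rewrite sub.
have le1 : \sum_(i <- undup s') f i <= \sum_(i <- s') f i.
  elim: {p sub} s' => [|x s' ih] //=; rewrite big_cons.
  case: ifP => _; first by rewrite (le_trans ih) // lerDr.
  by rewrite big_cons lerD2l.
apply: le_trans le1; rewrite (perm_big _ p) //.
  by rewrite big_cat /= lerDl sumr_ge0.
Qed.

Lemma has_sum_ge f l s : (forall i, 0 <= f i) -> has_sum f l -> uniq s ->
  \sum_(i <- s) f i <= l.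
Proof.
move=> f0 h us; rewrite leNgt; apply/negP => ll.
have e0 : 0 < \sum_(i <- s) f i - l by lra.
have [s0 hs] := h _ e0.
have := hs (undup (s ++ s0)) (undup_uniq _) (fun x => _) => H.
have {H} : `|\sum_(i <- undup (s ++ s0)) f i - l| < \sum_(i <- s) f i - l.
  by apply: H => x; rewrite mem_undup mem_cat orbC => ->.
have : \sum_(i <- s) f i <= \sum_(i <- undup (s ++ s0)) f i.
  by apply: ler_sum_uniq => // x xs; rewrite mem_undup mem_cat xs.
rewrite ltr_norml; lra.
Qed.

Lemma has_sum_bound f l M : has_sum f l ->
  (forall s, uniq s -> \sum_(i <- s) f i <= M) -> l <= M.
Proof.
move=> h hM; rewrite leNgt; apply/negP => ll.
have e0 : 0 < l - M by lra.
have [s0 hs] := h _ e0.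
have := hM (undup s0) (undup_uniq _).
have : `|\sum_(i <- undup s0) f i - l| < l - M.
  by apply: hs; rewrite ?undup_uniq // => x; rewrite mem_undup.
rewrite ltr_norml; lra.
Qed.

Lemma has_sum_ex_ge0 f M : (forall i, 0 <= f i) ->
  (forall s, uniq s -> \sum_(i <- s) f i <= M) -> exists l, has_sum f l.
Proof.
move=> f0 hM.
pose A := [set x | exists2 s, uniq s & x = \sum_(i <- s) f i].
have hA : has_sup A.
  split; first by exists 0, [::]; rewrite // big_nil.
  by exists M => _ [s us ->]; exact: hM.
exists (sup A) => e e0; have [_ [s0 us0 ->] hs0] := sup_adherent e0 hA.
exists s0 => s us sub.
have h1 := ler_sum_uniq f0 us0 sub.
have h2 : \sum_(i <- s) f i <= sup A by apply: sup_upper_bound => //; exists s.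
rewrite ltr_norml; lra.
Qed.

(** [f] is the difference of the nonnegative families [|f| + f] and [|f|], whose finite sums are
    bounded by [2M] and [M]. *)
Lemma has_sum_ex f M :
  (forall s, uniq s -> \sum_(i <- s) `|f i| <= M) -> exists l, has_sum f l.
Proof.
move=> hM.
have [l1 h1] := has_sum_ex_ge0 (fun i => normr_ge0 (f i)) hM.
have [l2 h2] : exists l, has_sum (fun i => `|f i| + f i) l.
  apply: (@has_sum_ex_ge0 _ (M + M)) => [i|s us].
    by rewrite -lerBlDr sub0r ler_normr lexx orbT.
  rewrite big_split /= lerD ?hM //; apply: le_trans (hM s us).
  by apply: ler_sum => i _; exact: ler_norm.
exists (l2 - l1); have := has_sumD h2 (has_sumN h1).
by rewrite (_ : (fun _ => _) = f) //; apply/funext => i; ring.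
Qed.

Lemma has_sum_fin f s : uniq s -> (forall i, i \notin s -> f i = 0) ->
  has_sum f (\sum_(i <- s) f i).
Proof.
move=> us f0 e e0; exists s => s' us' sub.
have p : perm_eq s' (s ++ [seq x <- s' | x \notin s]).
  apply: uniq_perm => // [|x].
    rewrite cat_uniq us filter_uniq // andbT /=.
    by apply/hasPn => x; rewrite mem_filter => /andP[].
  rewrite mem_cat mem_filter; case: (boolP (x \in s)) => //= xs.
  by rewrite sub.
rewrite (perm_big _ p) // big_cat /= [X in _ + X - _]big1_seq.
  by rewrite addr0 subrr normr0.
by move=> i /andP[_]; rewrite mem_filter => /andP[/f0].
Qed.

End UnorderedSums.

(** * Squared moduli and the scalar form of Cauchy-Schwarz *)

Section ComplexScalars.
Variable R : realType.
Implicit Types (c u w : R[i]).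

Definition sqabs c : R := complex.Re c ^+ 2 + complex.Im c ^+ 2.

Lemma sqabs_ge0 c : 0 <= sqabs c.
Proof. by rewrite addr_ge0 ?sqr_ge0. Qed.

Lemma sqabsM c w : sqabs (c * w) = sqabs c * sqabs w.
Proof. by case: c => a b; case: w => a' b'; rewrite /sqabs /=; ring. Qed.

Lemma sqabsD c w : sqabs (c + w) <= 2 * sqabs c + 2 * sqabs w.
Proof.
case: c => a b; case: w => a' b'; rewrite /sqabs /= -subr_ge0.
rewrite (_ : _ - _ = (a - a') ^+ 2 + (b - b') ^+ 2); last by ring.
by rewrite addr_ge0 ?sqr_ge0.
Qed.

Lemma normc_sqabs c : `|c| = (Num.sqrt (sqabs c))%:C.
Proof. by rewrite normc_def. Qed.

Lemma ReD c w : complex.Re (c + w) = complex.Re c + complex.Re w.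
Proof. by case: c; case: w. Qed.

Lemma ImD c w : complex.Im (c + w) = complex.Im c + complex.Im w.
Proof. by case: c; case: w. Qed.

Lemma ge0_complex c : (0 <= c) = (0 <= complex.Re c) && (complex.Im c == 0).
Proof. by case: c => a b; rewrite lecE /= andbC. Qed.

Lemma complex_ext c w :
  complex.Re c = complex.Re w -> complex.Im c = complex.Im w -> c = w.
Proof. by case: c => a b; case: w => a' b' /= -> ->. Qed.

(* The hypothesis is positivity of a sesquilinear form at [x + c y]. *)
Lemma cauchy_schwarz_scalar (al ga : R) u w : 0 <= ga ->
  (forall c, 0 <= al%:C + c^*%C * u + c * w + c * c^*%C * ga%:C) ->
  w = u^*%C /\ sqabs u <= al * ga.
Proof.
case: u => ur ui; case: w => wr wi ga0 H.
have {}H a b : (0 <= al + a * (ur + wr) + b * (ui - wi)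
          + (a ^+ 2 + b ^+ 2) * ga) /\
          a * (ui + wi) + b * (wr - ur) = 0.
  have := H (a +i* b); rewrite ge0_complex => /andP[h /eqP h'].
  split; [apply: le_trans h _|rewrite -[RHS]h']; simpc => /=; last by ring.
  by rewrite le_eqVlt; apply/orP; left; apply/eqP; ring.
(* The form is real at [c = 1] and at [c = i], which forces [w] to be the conjugate of [u]. *)
have [_ h1] := H 1 0; have [_ h2] := H 0 1.
have ? : wi = - ui by lra.
have ? : wr = ur by lra.
subst wi wr; split=> //; rewrite /sqabs /=.
(* Take [c = - t u], which leaves a real quadratic in [t]. Its minimum is at [t = 1 / ga]; for
   [ga = 0] it is affine and becomes negative unless [u = 0]. *)
have {}H t : 0 <= al - t * (2 * (ur ^+ 2 + ui ^+ 2))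
    + t ^+ 2 * ((ur ^+ 2 + ui ^+ 2) * ga).
  have [h _] := H (- t * ur) (- t * ui).
  by move: h; rewrite (_ : _ + _ = al - t * (2 * (ur ^+ 2 + ui ^+ 2))
    + t ^+ 2 * ((ur ^+ 2 + ui ^+ 2) * ga)); last by ring.
set U := ur ^+ 2 + ui ^+ 2 in H *.
have U0 : 0 <= U by rewrite addr_ge0 ?sqr_ge0.
have [->|Un0] := eqVneq U 0.
  by rewrite mulr_ge0 //; have := H 0; rewrite mul0r expr0n mul0r addr0 subr0.
have Up : 0 < U by rewrite lt_def Un0.
have [ga_eq0|gan0] := eqVneq ga 0.
  have := H ((al + 1) / (2 * U)); rewrite ga_eq0 mulr0 mulr0 addr0 divfK; lra.
have gap : 0 < ga by rewrite lt_def gan0.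
have := H ga^-1.
rewrite (_ : _ + _ = al - U / ga); last by field.
by rewrite subr_ge0 ler_pdivrMr.
Qed.

End ComplexScalars.

Section Hilbert.
Variables (R : realType) (I : choiceType).
Implicit Types (x y z : I -> R[i]).

Definition sq_summable : {pred I -> R[i]} := fun x =>
  `[< exists M, forall s, uniq s -> \sum_(i <- s) sqabs (x i) <= M >].

Lemma sq_summable_submod : submod_closed sq_summable.
Proof.
split.
  apply/asboolP; exists 0 => s _; rewrite big1 // => i _.
  by rewrite /sqabs /= expr0n addr0.
move=> c x y /asboolP[M hM] /asboolP[N hN]; apply/asboolP.
exists (2 * (sqabs c * M) + 2 * N) => s us.
apply: (@le_trans _ _ (\sum_(i <- s) (2 * (sqabs c * sqabs (x i)) + 2 * sqabs (y i)))).
  by apply: ler_sum => i _; rewrite -sqabsM; exact: sqabsD.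
rewrite big_split /= -!mulr_sumr lerD // ler_pM2l //; last exact: hN.
by apply: ler_wpM2l; rewrite ?sqabs_ge0 ?hM.
Qed.

HB.instance Definition _ := GRing.isSubmodClosed.Build R[i] (I -> R[i])
  sq_summable sq_summable_submod.

Record hilb := Hilb { hfun :> I -> R[i] ; hfunP : hfun \in sq_summable }.

HB.instance Definition _ := [isSub for hfun].
HB.instance Definition _ := [Choice of hilb by <:].
HB.instance Definition _ := [SubChoice_isSubLmodule of hilb by <:].

Implicit Types (u v w : hilb).

Lemma hilb_ext u v : (forall i, u i = v i) -> u = v.
Proof. by move=> h; apply: val_inj; apply/funext. Qed.

Lemma hfunD u v i : (u + v) i = u i + v i.
Proof. by []. Qed.

Lemma hfunZ c u i : (c *: u) i = c * u i.
Proof. by []. Qed.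

Lemma hfunN u i : (- u) i = - u i.
Proof. by []. Qed.

Lemma hfun0 i : (0 : hilb) i = 0.
Proof. by []. Qed.

End Hilbert.

Section InnerProduct.
Variables (R : realType) (I : choiceType).
Local Notation H := (hilb R I).
Implicit Types (u v w : H).

Definition has_csum (f : I -> R[i]) (l : R[i]) : Prop :=
  has_sum (fun i => complex.Re (f i)) (complex.Re l) /\
  has_sum (fun i => complex.Im (f i)) (complex.Im l).

Lemma has_csum_unique f l l' : has_csum f l -> has_csum f l' -> l = l'.
Proof.
move=> [h1 h2] [h1' h2']; apply: complex_ext.
  exact: has_sum_unique h1 h1'.
exact: has_sum_unique h2 h2'.
Qed.

Lemma has_csumD f g l l' : has_csum f l -> has_csum g l' ->
  has_csum (fun i => f i + g i) (l + l').
Proof.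
move=> [h1 h2] [h1' h2']; split; [have := has_sumD h1 h1'|have := has_sumD h2 h2'].
  by rewrite -ReD; congr has_sum; apply/funext => i; rewrite ReD.
by rewrite -ImD; congr has_sum; apply/funext => i; rewrite ImD.
Qed.

Lemma has_csumZ f l c : has_csum f l -> has_csum (fun i => c * f i) (c * l).
Proof.
case: c => a b; move=> [h1 h2]; split.
  have := has_sumD (has_sumZ a h1) (has_sumN (has_sumZ b h2)).
  case: l {h1 h2} => lr li; congr has_sum; apply/funext => i.
  by case: (f i).
have := has_sumD (has_sumZ a h2) (has_sumZ b h1).
case: l {h1 h2} => lr li; congr has_sum; apply/funext => i.
by case: (f i).
Qed.

Lemma has_csum_conj f l : has_csum f l -> has_csum (fun i => (f i)^*%C) l^*%C.
Proof.
move=> [h1 h2]; split.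
  case: l h1 {h2} => lr li /=; congr has_sum; apply/funext => i.
  by case: (f i).
have := has_sumN h2.
case: l {h1 h2} => lr li /=; congr has_sum; apply/funext => i.
by case: (f i).
Qed.

Lemma has_csum_fin f s : uniq s -> (forall i, i \notin s -> f i = 0) ->
  has_csum f (\sum_(i <- s) f i).
Proof.
move=> us f0.
have h1 := @has_sum_fin R I (fun i => complex.Re (f i)) s us.
have h2 := @has_sum_fin R I (fun i => complex.Im (f i)) s us.
split.
  by rewrite raddf_sum; apply: h1 => i /f0 ->.
by rewrite raddf_sum; apply: h2 => i /f0 ->.
Qed.

(** The real and imaginary parts of each term are dominated by [|u_i|^2 + |v_i|^2]; the squares
    collected in [sq] are what [nra] needs for this. *)
Lemma has_csum_mul_conj u v : exists l, has_csum (fun i => u i * (v i)^*%C) l.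
Proof.
have /asboolP[M hM] := hfunP u; have /asboolP[N hN] := hfunP v.
have dom (f : I -> R) : (forall i, `|f i| <= sqabs (u i) + sqabs (v i)) ->
    exists l, has_sum f l.
  move=> hf; apply: (@has_sum_ex _ _ _ (M + N)) => s us.
  apply: le_trans (lerD (hM s us) (hN s us)); rewrite -big_split /=.
  by apply: ler_sum => i _; exact: hf.
have sq (a b : R) : 0 <= a ^+ 2 /\ 0 <= (a - b) ^+ 2 /\ 0 <= (a + b) ^+ 2.
  by split; [|split]; exact: sqr_ge0.
have [a ha] : exists l, has_sum (fun i => complex.Re (u i * (v i)^*%C)) l.
  apply: dom => i; case: (u i) => p q; case: (v i) => p' q'; rewrite /sqabs /=.
  have := sq p p'; have := sq q q'.
  rewrite ler_norml; move=> ? ?; apply/andP; split; nra.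
have [b hb] : exists l, has_sum (fun i => complex.Im (u i * (v i)^*%C)) l.
  apply: dom => i; case: (u i) => p q; case: (v i) => p' q'; rewrite /sqabs /=.
  have := sq p q'; have := sq q p'.
  rewrite ler_norml; move=> ? ?; apply/andP; split; nra.
by exists (a +i* b).
Qed.

(** Linear in the first argument. By [has_csum_mul_conj] the default [0] is never taken. *)
Definition dot u v : R[i] := xget 0 [set l | has_csum (fun i => u i * (v i)^*%C) l].

Lemma dotP u v : has_csum (fun i => u i * (v i)^*%C) (dot u v).
Proof. by rewrite /dot; case: xgetP => // h; have [l /h] := has_csum_mul_conj u v. Qed.

Lemma dot_eq u v l : has_csum (fun i => u i * (v i)^*%C) l -> dot u v = l.
Proof. exact/has_csum_unique/dotP. Qed.

Lemma dotDl u v w : dot (u + v) w = dot u w + dot v w.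
Proof.
apply: dot_eq; have := has_csumD (dotP u w) (dotP v w).
by congr has_csum; apply/funext => i; rewrite hfunD mulrDl.
Qed.

Lemma dotZl c u v : dot (c *: u) v = c * dot u v.
Proof.
apply: dot_eq; have := has_csumZ c (dotP u v).
by congr has_csum; apply/funext => i; rewrite hfunZ mulrA.
Qed.

Lemma dotC u v : dot u v = (dot v u)^*%C.
Proof.
apply: dot_eq; have := has_csum_conj (dotP v u).
by congr has_csum; apply/funext => i; rewrite rmorphM /= conjcK mulrC.
Qed.

Lemma dotDr u v w : dot u (v + w) = dot u v + dot u w.
Proof. by rewrite dotC dotDl rmorphD /= -!dotC. Qed.

Lemma dotZr c u v : dot u (c *: v) = c^*%C * dot u v.
Proof. by rewrite dotC dotZl rmorphM /= -dotC. Qed.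

Lemma dot0l v : dot 0 v = 0.
Proof. by rewrite -(scale0r (0 : H)) dotZl mul0r. Qed.

Lemma dot0r v : dot v 0 = 0.
Proof. by rewrite dotC dot0l conjc0. Qed.

Lemma dotNl u v : dot (- u) v = - dot u v.
Proof. by rewrite -scaleN1r dotZl mulN1r. Qed.

Lemma dotNr u v : dot v (- u) = - dot v u.
Proof. by rewrite dotC dotNl rmorphN /= -dotC. Qed.

Definition sqnorm u : R := complex.Re (dot u u).

Lemma has_sum_sqnorm u : has_sum (fun i => sqabs (u i)) (sqnorm u).
Proof.
have [h _] := dotP u u; move: h; congr has_sum; apply/funext => i.
by case: (u i) => a b; rewrite /sqabs /=; ring.
Qed.

Lemma dotvv u : dot u u = (sqnorm u)%:C.
Proof.
have [_ h2] := dotP u u.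
apply: complex_ext => //=; apply: (has_sum_unique h2).
have := has_sumZ 0 (has_sum_sqnorm u); rewrite mul0r.
congr has_sum; apply/funext => i; rewrite mul0r.
by case: (u i) => a b /=; ring.
Qed.

Lemma sqnorm_ge0 u : 0 <= sqnorm u.
Proof.
have := @has_sum_ge R I (fun i => sqabs (u i)) _ [::] _ (has_sum_sqnorm u).
by rewrite big_nil; apply => // i; exact: sqabs_ge0.
Qed.

Lemma sum_le_sqnorm u s : uniq s -> \sum_(i <- s) sqabs (u i) <= sqnorm u.
Proof.
by apply: has_sum_ge (has_sum_sqnorm u) => i; exact: sqabs_ge0.
Qed.

Lemma sqnorm_le u M : (forall s, uniq s -> \sum_(i <- s) sqabs (u i) <= M) ->
  sqnorm u <= M.
Proof. exact: has_sum_bound (has_sum_sqnorm u). Qed.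

Lemma sqnorm_eq0 u : sqnorm u = 0 -> u = 0.
Proof.
move=> h; apply: hilb_ext => i; rewrite hfun0.
have := @sum_le_sqnorm u [:: i] isT; rewrite big_seq1 h.
case: (u i) => a b; rewrite /sqabs /= => hle.
have a0 : 0 <= a ^+ 2 := sqr_ge0 a.
have b0 : 0 <= b ^+ 2 := sqr_ge0 b.
 have /eqP : a ^+ 2 = 0 by lra.
have /eqP : b ^+ 2 = 0 by lra.
by rewrite !sqrf_eq0 => /eqP -> /eqP ->.
Qed.

Lemma hilb_eq_dot u v : (forall w, dot u w = dot v w) -> u = v.
Proof.
move=> h; apply/eqP; rewrite -subr_eq0; apply/eqP/sqnorm_eq0.
by rewrite /sqnorm dotDl dotNl !h subrr.
Qed.

Lemma dot_cauchy_schwarz u v : sqabs (dot u v) <= sqnorm u * sqnorm v.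
Proof.
have H c : 0 <= (sqnorm u)%:C + c^*%C * dot u v + c * dot v u
    + c * c^*%C * (sqnorm v)%:C.
  have := sqnorm_ge0 (u + c *: v); rewrite -lecR -(dotvv (u + c *: v)).
  rewrite dotDl !dotDr !dotZl !dotZr -!dotvv => h; apply: le_trans h _.
  by rewrite le_eqVlt; apply/orP; left; apply/eqP; ring.
by have [] := cauchy_schwarz_scalar (sqnorm_ge0 v) H.
Qed.

Definition hnorm u : R := Num.sqrt (sqnorm u).

Lemma hnorm_ge0 u : 0 <= hnorm u. Proof. exact: sqrtr_ge0. Qed.

Lemma hnorm_sq u : hnorm u ^+ 2 = sqnorm u.
Proof. by rewrite sqr_sqrtr ?sqnorm_ge0. Qed.

Lemma hnorm0 : hnorm 0 = 0.
Proof. by rewrite /hnorm /sqnorm dot0l sqrtr0. Qed.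

Definition cabs (c : R[i]) : R := Num.sqrt (sqabs c).

Lemma dot_le u v : cabs (dot u v) <= hnorm u * hnorm v.
Proof.
by rewrite -sqrtrM ?sqnorm_ge0 // ler_wsqrtr // dot_cauchy_schwarz.
Qed.

Lemma hnormZ c u : hnorm (c *: u) = cabs c * hnorm u.
Proof.
rewrite /hnorm /cabs -sqrtrM ?sqabs_ge0 // /sqnorm dotZl dotZr dotvv mulrA.
congr Num.sqrt; case: c => a b; rewrite /sqabs; simpc => /=; ring.
Qed.

Lemma hnormN u : hnorm (- u) = hnorm u.
Proof. by rewrite /hnorm /sqnorm dotNl dotNr opprK. Qed.

Lemma Re_le_cabs (c : R[i]) : `|complex.Re c| <= cabs c.
Proof. by rewrite -sqrtr_sqr ler_wsqrtr // lerDl sqr_ge0. Qed.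

Lemma Im_le_cabs (c : R[i]) : `|complex.Im c| <= cabs c.
Proof. by rewrite -sqrtr_sqr ler_wsqrtr // lerDr sqr_ge0. Qed.

Lemma hnormD u v : hnorm (u + v) <= hnorm u + hnorm v.
Proof.
rewrite -(@ler_pXn2r _ 2) ?nnegrE ?addr_ge0 ?hnorm_ge0 //.
rewrite hnorm_sq sqrrD !hnorm_sq /sqnorm dotDl !dotDr !ReD.
have := dot_le u v; have := Re_le_cabs (dot u v).
rewrite (dotC v u); case: (dot u v) => a b /=; rewrite ler_norml.
move=> /andP[_ h1] h2; lra.
Qed.

Lemma sqabs_coord u i : sqabs (u i) <= sqnorm u.
Proof. by have := @sum_le_sqnorm u [:: i] isT; rewrite big_seq1. Qed.

(* Limits are taken coordinatewise and estimated on finite sets of coordinates. *)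
Lemma hilb_complete (u : nat -> H) :
  (forall e, 0 < e -> exists N, forall m n, (N <= m)%N -> (N <= n)%N ->
     hnorm (u m - u n) < e) ->
  exists v, forall e, 0 < e -> exists N, forall n, (N <= n)%N ->
     hnorm (u n - v) <= e.
Proof.
move=> hu.
have lim (g : R[i] -> R) : (forall c, `|g c| <= cabs c) ->
    (forall c z : R[i], g (c - z) = g c - g z) ->
    exists l : I -> R, forall i, (fun n => g (u n i)) @ \oo --> l i.
  move=> hg gB; suff h i : exists l : R, (fun n => g (u n i)) @ \oo --> l.
    by have [l hl] := choice h; exists l.
  suff : cvgn (fun n => g (u n i)) by move=> h; exists (limn (fun n => g (u n i))).
  apply/cauchy_cvgP/cauchy_exP => e e0.
  have [N hN] := hu e e0; exists (g (u N i)); exists N => // n /= Nn.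
  rewrite -ball_normE /= -gB; apply: le_lt_trans (hg _) _.
  apply: le_lt_trans (hN N n (leqnn _) Nn).
  exact: ler_wsqrtr (sqabs_coord (u N - u n) i).
have [lr hr] := lim _ Re_le_cabs (fun c z => raddfB _ c z).
have [li hi] := lim _ Im_le_cabs (fun c z => raddfB _ c z).
pose l i := lr i +i* li i.
(* Letting [m] tend to infinity in the Cauchy estimate is legitimate on a finite set of coordinates;
   the resulting bound does not depend on that set. *)
have est e N : (forall m n, (N <= m)%N -> (N <= n)%N -> hnorm (u m - u n) < e) ->
    forall n, (N <= n)%N -> forall s, uniq s ->
      \sum_(i <- s) sqabs (u n i - l i) <= e ^+ 2.
  move=> hN n Nn s us.
  have cv : (fun m => \sum_(i <- s) sqabs (u n i - u m i)) @ \oo -->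
      \sum_(i <- s) sqabs (u n i - l i).
    apply: cvg_big => [|i _]; first exact: add_continuous.
    rewrite /sqabs; under eq_fun do rewrite !raddfB /=.
    rewrite !raddfB /=; apply: cvgD; rewrite expr2; under eq_fun do rewrite expr2.
      by apply: cvgM; (apply: cvgB; [exact: cvg_cst|exact: hr]).
    by apply: cvgM; (apply: cvgB; [exact: cvg_cst|exact: hi]).
  rewrite -(cvg_lim _ cv) //; apply: limr_le; first by apply/cvg_ex; eexists; exact: cv.
  exists N => // m /= Nm; apply: le_trans (sum_le_sqnorm (u n - u m) us) _.
  rewrite -hnorm_sq ler_pXn2r ?nnegrE ?hnorm_ge0 //.
    by apply/ltW/hN.
  by apply: le_trans (hnorm_ge0 _) (ltW (hN _ _ Nn Nm)).
have [N1 hN1] := hu 1 ltr01.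
(* The estimate makes [u N1 - l] square-summable, not [l] directly; the limit is recovered as
   [u N1 - (u N1 - l)]. *)
have dl : (fun i => u N1 i - l i) \in @sq_summable R I.
  by apply/asboolP; exists (1 ^+ 2); exact: est hN1 _ _.
exists (u N1 - Hilb dl) => e e0; have [N hN] := hu e e0; exists N => n Nn.
rewrite -(@ler_pXn2r _ 2) ?nnegrE ?hnorm_ge0 ?(ltW e0) // hnorm_sq.
apply: sqnorm_le => s us; apply: le_trans (est e N hN n Nn s us).
apply: ler_sum => i _; rewrite le_eqVlt; apply/orP; left; apply/eqP.
by congr sqabs; rewrite !(hfunD, hfunN) /=; ring.
Qed.

End InnerProduct.

(** * Adjointable operators *)

Section NormedModules.
Variables (R : realType) (V : normedModType R[i]).
Implicit Types (x y : V) (u : nat -> V).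

(** Norms over [R[i]] take values in [R[i]]; the real copy gives access to total order and [lra]. *)
Definition nrm x : R := complex.Re `|x|.

Lemma nrmE x : `|x| = (nrm x)%:C.
Proof.
have := normr_ge0 x; rewrite ge0_complex /nrm => /andP[_ /eqP h].
exact: complex_ext.
Qed.

Lemma nrm_ge0 x : 0 <= nrm x.
Proof. by rewrite -lecR -nrmE; exact: normr_ge0. Qed.

Lemma nrmD x y : nrm (x + y) <= nrm x + nrm y.
Proof. by rewrite -lecR rmorphD /= -!nrmE ler_normD. Qed.

Lemma nrmN x : nrm (- x) = nrm x.
Proof. by rewrite /nrm normrN. Qed.

Lemma nrmB x y : nrm (x - y) = nrm (y - x).
Proof. by rewrite -nrmN opprB. Qed.

Lemma nrm_eq0 x : nrm x = 0 -> x = 0.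
Proof. by move=> h; apply/eqP; rewrite -normr_eq0 nrmE h. Qed.

Lemma nrm0 : nrm 0 = 0.
Proof. by rewrite /nrm normr0. Qed.

Lemma nrmZ c x : nrm (c *: x) = cabs c * nrm x.
Proof.
apply/(@complexI R); rewrite rmorphM /= -nrmE normrZ (nrmE x); congr (_ * _).
exact: normc_sqabs.
Qed.

(** A positive element of [R[i]] is a positive real, so complex radii may be replaced by real
    ones. *)
Lemma cvg_seqP u x : u @ \oo --> x <->
  forall e, 0 < e -> exists N, forall n, (N <= n)%N -> nrm (u n - x) < e.
Proof.
split=> [/cvgrPdist_lt h e e0|h].
  have e0' : 0 < e%:C by rewrite ltcR.
  have [N _ hN] := h _ e0'; exists N => n /hN.
  by rewrite /= nrmE ltcR nrmB.
apply/cvgrPdist_lt => e; rewrite ltcE /= => /andP[/eqP Ime /h [N hN]].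
exists N => // n /hN; rewrite nrmB -ltcR -nrmE /= => h'; apply: lt_le_trans h' _.
by rewrite lecE /= -Ime eqxx lexx.
Qed.

Lemma closedP (X : set V) : closed X <->
  forall x, (forall e, 0 < e -> exists2 y, X y & nrm (x - y) < e) -> X x.
Proof.
split=> [cX x hx|h x hx].
  apply: cX => B /nbhs_ballP[e /=]; rewrite ltcE /= => /andP[/eqP Ime e0 eB].
  have [y Xy xy] := hx _ e0; exists y; split=> //; apply: eB.
  rewrite -ball_normE /= nrmE; apply: (@lt_le_trans _ _ (complex.Re e)%:C).
    by rewrite ltcR.
  by rewrite lecE /= -Ime eqxx lexx.
apply: h => e e0; have e0' : 0 < e%:C :> R[i] by rewrite ltcR.
have [y [Xy]] := hx _ (nbhsx_ballx x _ e0').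
by rewrite -ball_normE /= nrmE ltcR; exists y.
Qed.

(** A Cauchy filter contains balls of radius [1 / (n + 1)]. Any two sets of a proper filter meet, so
    their centres form a Cauchy sequence, and its limit is the limit of the filter. *)
Lemma complete_of_seq :
  (forall u, (forall e, 0 < e -> exists N, forall m n, (N <= m)%N ->
     (N <= n)%N -> nrm (u m - u n) < e) ->
   exists x, forall e, 0 < e -> exists N, forall n, (N <= n)%N ->
     nrm (u n - x) <= e) ->
  forall F : set_system V, ProperFilter F -> cauchy F -> cvg F.
Proof.
move=> hu F PF /cauchyP cF.
have step (n : nat) : exists x, F [set y | nrm (x - y) < n.+1%:R^-1].
  have e0 : 0 < (n.+1%:R^-1)%:C :> R[i] by rewrite ltcR invr_gt0.
  have [x hx] := cF _ e0; exists x; apply: filterS hx => y.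
  by rewrite -ball_normE /= nrmE ltcR.
have [u hu'] := choice step.
have inv_small (e : R) : 0 < e -> exists N, forall n, (N <= n)%N ->
    n.+1%:R^-1 < e.
  move=> e0; exists (Num.truncn e^-1) => n Nn.
  rewrite invf_plt ?posrE //; apply: lt_le_trans (truncnS_gt _) _.
  by rewrite ler_nat ltnS.
have close m n : nrm (u m - u n) < m.+1%:R^-1 + n.+1%:R^-1.
  have [y [h1 h2]] := filter_ex (filterI (hu' m) (hu' n)).
  rewrite -(subrK y (u m)) -addrA; apply: le_lt_trans (nrmD _ _) _.
  by rewrite ltrD // nrmB.
have [e e0|x hx] := hu u.
  have e2 : 0 < e / 2 by lra.
  have [N hN] := inv_small _ e2; exists N => m n Nm Nn.
  by apply: lt_trans (close m n) _; rewrite [e]splitr ltrD ?hN.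
apply/cvg_ex; exists x; apply/cvgrPdist_lt => e; rewrite ltcE /=.
move=> /andP[/eqP Ime e0]; have e2 : 0 < complex.Re e / 2 by lra.
have [N hN] := hx _ e2; have [N' hN'] := inv_small _ e2.
set n := maxn N N'.
have hn := hN n (leq_maxl _ _); have hn' := hN' n (leq_maxr _ _).
apply: filterS (hu' n) => y hy /=; apply: (@lt_le_trans _ _ (complex.Re e)%:C).
  rewrite nrmE ltcR -(subrK (u n) x) -addrA; apply: le_lt_trans (nrmD _ _) _.
  rewrite nrmB in hn; rewrite [complex.Re e]splitr ler_ltD //.
  by apply: lt_trans hn'.
by rewrite lecE /= -Ime eqxx lexx.
Qed.

End NormedModules.

Section OperatorAlgebra.
Variables (R : realType) (I : choiceType).
Local Notation H := (hilb R I).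
Implicit Types (u v w : H).

Definition adjoint (T T' : H -> H) : Prop :=
  forall u v, dot (T u) v = dot u (T' v).

Definition op_bound (T : H -> H) (M : R) : Prop :=
  forall u, hnorm (T u) <= M * hnorm u.

(** Having an adjoint already gives linearity ([bopD], [bopZ]), and storing the adjoint's existence
    dispenses with the Riesz theorem. *)
Definition adjointable : {pred H -> H} := fun T =>
  `[< exists T' M, adjoint T T' /\ op_bound T M >].

Lemma adjoint_sym T T' : adjoint T T' -> adjoint T' T.
Proof. by move=> h u v; rewrite dotC -h -dotC. Qed.

Lemma adjoint_unique T T' T'' : adjoint T T' -> adjoint T T'' -> T' = T''.
Proof.
move=> h h'; apply/funext => u; apply: hilb_eq_dot => w.
by rewrite dotC -h h' -dotC.
Qed.

(** [|T' u|^2 = <T T' u, u> <= M |T' u| |u|]; divide by [|T' u|]. *)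
Lemma adjoint_bound T T' M : 0 <= M -> adjoint T T' -> op_bound T M ->
  op_bound T' M.
Proof.
move=> M0 h hM u.
have := dot_le (T (T' u)) u; rewrite h dotvv.
rewrite /cabs /sqabs /= expr0n addr0 sqrtr_sqr ger0_norm ?sqnorm_ge0 //.
rewrite -hnorm_sq => h1; have h2 := hM (T' u).
have [->|n0] := eqVneq (hnorm (T' u)) 0; first by rewrite mulr_ge0 ?hnorm_ge0.
have np : 0 < hnorm (T' u) by rewrite lt_def n0 hnorm_ge0.
rewrite -(ler_pM2r np) -expr2; apply: le_trans h1 _.
by rewrite mulrAC ler_wpM2r ?hnorm_ge0.
Qed.

Lemma adjointable_submod : submod_closed adjointable.
Proof.
split.
  apply/asboolP; exists 0, 0; split=> u; first by move=> v; rewrite dot0l dot0r.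
  by rewrite mul0r hnorm0.
move=> c S T /asboolP[S' [M [aS bS]]] /asboolP[T' [N [aT bT]]]; apply/asboolP.
exists (c^*%C \*: S' + T'), (cabs c * M + N); split=> [u v|u].
  rewrite /= dotDl dotZl aS aT dotDr dotZr; congr (_ * _ + _).
  by rewrite conjcK.
rewrite /= mulrDl; apply: le_trans (hnormD _ _) _; rewrite lerD // hnormZ -mulrA.
by rewrite ler_wpM2l ?sqrtr_ge0.
Qed.

HB.instance Definition _ := GRing.isSubmodClosed.Build R[i] (H -> H)
  adjointable adjointable_submod.

Record bop := Bop { bfun :> H -> H ; bfunP : bfun \in adjointable }.

HB.instance Definition _ := [isSub for bfun].
HB.instance Definition _ := [Choice of bop by <:].
HB.instance Definition _ := [SubChoice_isSubLmodule of bop by <:].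
End OperatorAlgebra.

(** * The C*-algebra of adjointable operators *)

Section OperatorNorm.
Variables (R : realType) (I : choiceType).
Local Notation H := (hilb R I).
Local Notation B := (bop R I).
Implicit Types (u v w : H) (S T : B).

Lemma bop_ext S T : (forall u, S u = T u) -> S = T.
Proof. by move=> h; apply: val_inj; apply/funext. Qed.

Lemma bopDE S T u : (S + T) u = S u + T u. Proof. by []. Qed.
Lemma bopNE T u : (- T) u = - T u. Proof. by []. Qed.
Lemma bopZE c T u : (c *: T) u = c *: T u. Proof. by []. Qed.
Lemma bop_adjoint_ex T : exists T' : H -> H, adjoint T T'.
Proof. by have /asboolP[T' [M [h _]]] := bfunP T; exists T'. Qed.

Lemma bop_bound_ex T : exists M, 0 <= M /\ op_bound T M.
Proof.
have /asboolP[T' [M [_ h]]] := bfunP T; exists `|M|; split=> // u.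
by apply: le_trans (h u) _; rewrite ler_wpM2r ?hnorm_ge0 ?ler_norm.
Qed.

Definition opnorm T : R := inf [set M | 0 <= M /\ op_bound T M].

Lemma opnorm_ge0 T : 0 <= opnorm T.
Proof.
apply: lb_le_inf; first by have [M hM] := bop_bound_ex T; exists M.
by move=> M [].
Qed.

Lemma opnorm_bound T : op_bound T (opnorm T).
Proof.
move=> u; have [u0|un0] := eqVneq (hnorm u) 0.
  have [M [_ /(_ u)]] := bop_bound_ex T.
  by rewrite u0 !mulr0.
have up : 0 < hnorm u by rewrite lt_def un0 hnorm_ge0.
rewrite -ler_pdivrMr //; apply: lb_le_inf.
  by have [M hM] := bop_bound_ex T; exists M.
by move=> M [_ hM]; rewrite ler_pdivrMr.
Qed.

Lemma opnorm_le T M : 0 <= M -> op_bound T M -> opnorm T <= M.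
Proof. by move=> M0 hM; apply: ge_inf => //; exists 0 => N []. Qed.

Lemma opnormD S T : opnorm (S + T) <= opnorm S + opnorm T.
Proof.
apply: opnorm_le => [|u]; first by rewrite addr_ge0 ?opnorm_ge0.
rewrite bopDE mulrDl; apply: le_trans (hnormD _ _) _.
by rewrite lerD ?opnorm_bound.
Qed.

Lemma cabs_ge0 (c : R[i]) : 0 <= cabs c. Proof. exact: sqrtr_ge0. Qed.

Lemma cabsM (c d : R[i]) : cabs (c * d) = cabs c * cabs d.
Proof. by rewrite /cabs sqabsM sqrtrM ?sqabs_ge0. Qed.

Lemma opnormZ_le c T : opnorm (c *: T) <= cabs c * opnorm T.
Proof.
apply: opnorm_le => [|u]; first by rewrite mulr_ge0 ?opnorm_ge0 ?cabs_ge0.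
by rewrite bopZE hnormZ -mulrA ler_wpM2l ?cabs_ge0 ?opnorm_bound.
Qed.

Lemma cabsB (c d : R[i]) : cabs (c - d) <= cabs c + cabs d.
Proof.
by have := ler_normB c d; rewrite !normc_sqabs -rmorphD lecR.
Qed.

Lemma cabs_eq0 (c : R[i]) : cabs c = 0 -> c = 0.
Proof.
by move=> h; apply/eqP; rewrite -normr_eq0 normc_sqabs; apply/eqP; congr _%:C.
Qed.

Lemma cabs1 : cabs (1 : R[i]) = 1.
Proof. by rewrite /cabs /sqabs /= expr0n expr1n addr0 sqrtr1. Qed.

Lemma opnormZ c T : opnorm (c *: T) = cabs c * opnorm T.
Proof.
apply/eqP; rewrite eq_le opnormZ_le /=.
have [->|c0] := eqVneq c 0.
  by rewrite /cabs /sqabs /= expr0n addr0 sqrtr0 mul0r opnorm_ge0.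
have cK : cabs c * cabs c^-1 = 1 by rewrite -cabsM mulfV // cabs1.
rewrite -{1}(scale1r T) -(mulVf c0) -scalerA.
apply: le_trans (ler_wpM2l (cabs_ge0 c) (opnormZ_le _ _)) _.
by rewrite mulrA cK mul1r.
Qed.

Lemma opnorm_eq0 T : opnorm T = 0 -> T = 0.
Proof.
move=> h; apply: bop_ext => u; apply: sqnorm_eq0; rewrite -hnorm_sq.
have := opnorm_bound T u; rewrite h mul0r => h1.
have /eqP -> : hnorm (T u) == 0 by rewrite eq_le h1 hnorm_ge0.
by rewrite expr0n.
Qed.

Let norm (T : B) : R[i] := (opnorm T)%:C.

Let norm_triangle S T : norm (S + T) <= norm S + norm T.
Proof. by rewrite /norm -rmorphD /= lecR opnormD. Qed.

Let norm_scale (c : R[i]) T : norm (c *: T) = `|c| * norm T.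
Proof. by rewrite normc_sqabs /norm opnormZ rmorphM. Qed.

Let norm_eq0 T : norm T = 0 -> T = 0.
Proof. by move=> h; apply: opnorm_eq0; apply/(@complexI R). Qed.

HB.instance Definition _ := Lmodule_isNormed.Build R[i] B
  norm_triangle norm_scale norm_eq0.

Lemma nrm_bop T : nrm T = opnorm T. Proof. by []. Qed.

Definition bop_adj_fun T : H -> H := sval (cid (bop_adjoint_ex T)).

Lemma bop_adj_funP T : adjoint T (bop_adj_fun T).
Proof. exact: svalP (cid _). Qed.

Lemma bop_adj_subproof T : bop_adj_fun T \in @adjointable R I.
Proof.
apply/asboolP; exists T, (opnorm T); split.
  exact/adjoint_sym/bop_adj_funP.
by apply: adjoint_bound (bop_adj_funP T) (@opnorm_bound T); exact: opnorm_ge0.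
Qed.

Definition bop_adj T : B := Bop (bop_adj_subproof T).

Lemma bop_adjP T u v : dot (T u) v = dot u (bop_adj T v).
Proof. exact: bop_adj_funP. Qed.

Lemma bop_adjP' T u v : dot (bop_adj T u) v = dot u (T v).
Proof. by have := adjoint_sym (bop_adj_funP T); apply. Qed.

Lemma bop_adj_eq S T : adjoint S T -> bop_adj S = T.
Proof.
move=> h; apply: val_inj; exact: adjoint_unique (bop_adj_funP S) h.
Qed.

Lemma bop_comp_subproof S T : S \o T \in @adjointable R I.
Proof.
apply/asboolP; exists (bop_adj T \o bop_adj S), (opnorm S * opnorm T); split.
  by move=> u v /=; rewrite !bop_adjP.
move=> u /=; apply: le_trans (opnorm_bound S _) _; rewrite -mulrA.
by rewrite ler_wpM2l ?opnorm_ge0 ?opnorm_bound.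
Qed.

Definition bop_comp S T : B := Bop (bop_comp_subproof S T).

Lemma bopD T u v : T (u + v) = T u + T v.
Proof.
by apply: hilb_eq_dot => w; rewrite dotDl !bop_adjP dotDl.
Qed.

Lemma bopZ T c u : T (c *: u) = c *: T u.
Proof.
by apply: hilb_eq_dot => w; rewrite dotZl !bop_adjP dotZl.
Qed.

Lemma bopN T u : T (- u) = - T u.
Proof. by rewrite -scaleN1r bopZ scaleN1r. Qed.

Lemma bop_adjK : involutive bop_adj.
Proof. by move=> T; apply: bop_adj_eq => u v; rewrite bop_adjP'. Qed.

Lemma bop_adjD : {morph bop_adj : S T / S + T}.
Proof.
move=> S T; apply: bop_adj_eq => u v.
by rewrite !bopDE dotDl dotDr !bop_adjP.
Qed.

Lemma bop_adjZ (c : R[i]) T : bop_adj (c *: T) = c^* *: bop_adj T.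
Proof.
apply: bop_adj_eq => u v; rewrite !bopZE dotZl dotZr bop_adjP.
by congr (_ * _); rewrite conjcK.
Qed.

Lemma bop_adjM S T : bop_adj (bop_comp S T) = bop_comp (bop_adj T) (bop_adj S).
Proof. by apply: bop_adj_eq => u v /=; rewrite !bop_adjP. Qed.

Lemma opnorm_comp S T : opnorm (bop_comp S T) <= opnorm S * opnorm T.
Proof.
apply: opnorm_le => [|u]; first by rewrite mulr_ge0 ?opnorm_ge0.
apply: le_trans (opnorm_bound S _) _; rewrite -mulrA.
by rewrite ler_wpM2l ?opnorm_ge0 ?opnorm_bound.
Qed.

Lemma opnorm_adj_le T : opnorm (bop_adj T) <= opnorm T.
Proof.
apply: opnorm_le; first exact: opnorm_ge0.
exact: adjoint_bound (opnorm_ge0 _) (bop_adj_funP T) (@opnorm_bound T).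
Qed.

(** For the lower bound on the left side, [|T u|^2 = <u, T^* T u> <= |T^* T| |u|^2], so the square
    root of [|T^* T|] is a bound for [T]. *)
Lemma opnorm_adj_comp T : opnorm (bop_comp (bop_adj T) T) = opnorm T ^+ 2.
Proof.
apply/eqP; rewrite eq_le; apply/andP; split.
  apply: le_trans (opnorm_comp _ _) _.
  by rewrite expr2 ler_wpM2r ?opnorm_ge0 ?opnorm_adj_le.
set N := opnorm (bop_comp _ _).
have N0 : 0 <= N by exact: opnorm_ge0.
rewrite -(sqr_sqrtr N0) ler_pXn2r ?nnegrE ?opnorm_ge0 ?sqrtr_ge0 //.
apply: opnorm_le => [|u]; first exact: sqrtr_ge0.
rewrite -(@ler_pXn2r _ 2) ?nnegrE ?mulr_ge0 ?hnorm_ge0 ?sqrtr_ge0 //.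
rewrite exprMn (sqr_sqrtr N0) (hnorm_sq (T u)).
apply: le_trans (_ : cabs (dot (T u) (T u)) <= _).
  by apply: le_trans (Re_le_cabs _); exact: ler_norm.
rewrite bop_adjP; apply: le_trans (dot_le _ _) _.
rewrite expr2 [X in _ <= X]mulrA mulrC ler_wpM2r ?hnorm_ge0 //.
exact: (@opnorm_bound (bop_comp (bop_adj T) T)).
Qed.

Lemma bop_complete (F : set_system B) : ProperFilter F -> cauchy F -> cvg F.
Proof.
apply: complete_of_seq => {F} T hT.
(* Applied to the identity and to the adjoint, both 1-Lipschitz: the limits of [T n] and of its
   adjoints are needed together, since the limit operator must have an adjoint. *)
have lim (g : B -> B) : (forall S S', opnorm (g S - g S') <= opnorm (S - S')) ->
    exists L : H -> H, forall e, 0 < e -> exists N, forall n, (N <= n)%N ->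
      forall u, hnorm (g (T n) u - L u) <= e * hnorm u.
  move=> hg.
  have cau u : exists v, forall e, 0 < e -> exists N, forall n, (N <= n)%N ->
      hnorm (g (T n) u - v) <= e.
    apply: hilb_complete => e e0; have u1 : 0 < hnorm u + 1.
      by rewrite ltr_wpDl ?hnorm_ge0.
    have [N hN] := hT (e / (hnorm u + 1)) (divr_gt0 e0 u1); exists N => m n Nm Nn.
    rewrite -bopNE -bopDE; apply: le_lt_trans (opnorm_bound _ _) _.
    apply: (@le_lt_trans _ _ (opnorm (T m - T n) * (hnorm u + 1))).
      by rewrite ler_pM ?opnorm_ge0 ?hnorm_ge0 ?hg // lerDl.
    by rewrite -ltr_pdivlMr //; exact: hN.
  have [L hL] := choice cau; exists L => e e0.
  have [N hN] := hT e e0.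
  (* The auxiliary index [m] depends on [u] and [d], but the bound [e * hnorm u] does not, so the
     convergence is in operator norm. *)
  exists N => n Nn u; apply/ler_addgt0Pr => d d0.
  have [N' hN'] := hL u d d0; set m := maxn N N'.
  rewrite -(subrK (g (T m) u) (g (T n) u)) -addrA; apply: le_trans (hnormD _ _) _.
  apply: lerD; last by apply: hN'; exact: leq_maxr.
  rewrite -bopNE -bopDE; apply: le_trans (opnorm_bound _ _) _.
  rewrite ler_wpM2r ?hnorm_ge0 //; apply: le_trans (hg _ _) _.
  by apply/ltW/hN => //; exact: leq_maxl.
have [L hL] := lim id (fun S S' => lexx _).
have [L' hL'] : exists L' : H -> H, forall e, 0 < e -> exists N, forall n,
    (N <= n)%N -> forall u, hnorm (bop_adj (T n) u - L' u) <= e * hnorm u.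
  apply: lim => S S'; have -> : - bop_adj S' = bop_adj (- S').
    by apply/esym/bop_adj_eq => u v; rewrite bopNE dotNl bop_adjP -dotNr.
  by rewrite -bop_adjD opnorm_adj_le.
have adjL : adjoint L L'.
  move=> u v; apply/eqP; rewrite -subr_eq0; apply/eqP/cabs_eq0/eqP.
  rewrite eq_le cabs_ge0 andbT; apply/ler_addgt0Pr => e e0; rewrite add0r.
  (* Two errors of size at most [(e / K) |u| |v|] occur below; the [+ 1] keeps [K] positive. *)
  set K := 2 * (hnorm u * hnorm v) + 1.
  have K0 : 0 < K by rewrite ltr_wpDl // mulr_ge0 // mulr_ge0 ?hnorm_ge0.
  have [N hN] := hL _ (divr_gt0 e0 K0); have [N' hN'] := hL' _ (divr_gt0 e0 K0).
  set n := maxn N N'.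
  have h1 := hN n (leq_maxl _ _) u; have h2 := hN' n (leq_maxr _ _) v.
  rewrite (_ : _ - _ = dot u (bop_adj (T n) v - L' v) - dot (T n u - L u) v); last first.
    by rewrite dotDl dotNl dotDr dotNr bop_adjP; ring.
  apply: le_trans (cabsB _ _) _; apply: le_trans (lerD (dot_le _ _) (dot_le _ _)) _.
  apply: (@le_trans _ _ (e / K * K)); last by rewrite divfK ?gt_eqF.
  have {}h1 := ler_wpM2r (hnorm_ge0 v) h1.
  have {}h2 := ler_wpM2l (hnorm_ge0 u) h2.
  apply: le_trans (lerD h2 h1) _; rewrite /K mulrDr mulr1 -subr_ge0.
  rewrite (_ : _ - _ = e / K); first exact/ltW/divr_gt0.
  by ring.
have [N1 hN1] := hL 1 ltr01.
have LP : L \in @adjointable R I.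
  apply/asboolP; exists L', (1 + opnorm (T N1)); split=> // u.
  rewrite -[L u](subrK (T N1 u)) mulrDl; apply: le_trans (hnormD _ _) _.
  apply: lerD; last exact: opnorm_bound.
  by rewrite -hnormN opprB; apply: hN1.
exists (Bop LP) => e e0; have [N hN] := hL e e0; exists N => n Nn.
by rewrite nrm_bop; apply: opnorm_le => [|u]; [exact: ltW|exact: hN].
Qed.

HB.instance Definition _ := Uniform_isComplete.Build B bop_complete.

Let comp_normM S T : `|bop_comp S T| <= `|S| * `|T|.
Proof. by rewrite !nrmE -rmorphM lecR opnorm_comp. Qed.

Let comp_normE T : `|bop_comp (bop_adj T) T| = `|T| ^+ 2.
Proof. by rewrite !nrmE -rmorphXn /= -opnorm_adj_comp. Qed.

Let comp_assoc : associative bop_comp.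
Proof. by move=> S T U; apply: bop_ext. Qed.

Let comp_Dl : left_distributive bop_comp +%R.
Proof. by move=> S T U; apply: bop_ext. Qed.

Let comp_Dr : right_distributive bop_comp +%R.
Proof. by move=> S T U; apply: bop_ext => u; exact: (bopD S (T u) (U u)). Qed.

Let comp_Zl (c : R[i]) S T : bop_comp (c *: S) T = c *: bop_comp S T.
Proof. exact: bop_ext. Qed.

Let comp_Zr (c : R[i]) S T : bop_comp S (c *: T) = c *: bop_comp S T.
Proof. by apply: bop_ext => u; exact: (bopZ S c (T u)). Qed.

HB.instance Definition _ := isCstarAlgebra.Build R B
  comp_assoc comp_Dl comp_Dr comp_Zl comp_Zr bop_adjK bop_adjD bop_adjZ
  bop_adjM comp_normM comp_normE.

End OperatorNorm.

(** * Power series *)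

Section ComplexExponential.
Variable R : realType.
Implicit Types (x y t : R) (c d u v : R[i]).

Lemma nrm_complex c : nrm (c : R[i]^o) = cabs c.
Proof. by apply/(@complexI R); rewrite -nrmE; exact: normc_sqabs. Qed.

Lemma cvg_complexP (u : nat -> R[i]) l :
  (u : nat -> R[i]^o) @ \oo --> (l : R[i]^o) <->
  forall e, 0 < e -> exists N, forall n, (N <= n)%N -> cabs (u n - l) < e.
Proof.
split=> [/cvg_seqP h e /h[N hN]|h].
  by exists N => n /hN; rewrite -nrm_complex.
by apply/cvg_seqP => e /h[N hN]; exists N => n /hN; rewrite -nrm_complex.
Qed.

Lemma cabsD c d : cabs (c + d) <= cabs c + cabs d.
Proof. by have := ler_normD c d; rewrite !normc_sqabs -rmorphD lecR. Qed.

Lemma cabs_real x : cabs x%:C = `|x|.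
Proof. by rewrite /cabs /sqabs /= expr0n addr0 sqrtr_sqr. Qed.

Lemma cabs_i : cabs ('i%C : R[i]) = 1.
Proof. by rewrite /cabs /sqabs /= expr0n expr1n add0r sqrtr1. Qed.

Lemma cabs_le c : cabs c <= `|complex.Re c| + `|complex.Im c|.
Proof.
case: c => a b /=; rewrite [a +i* b]complexE /=.
by apply: le_trans (cabsD _ _) _; rewrite cabsM cabs_i mul1r !cabs_real.
Qed.

Lemma cabsX c n : cabs (c ^+ n) = cabs c ^+ n.
Proof. by elim: n => [|n ih]; rewrite ?cabs1 // !exprS cabsM ih. Qed.

Lemma cabs_sum (J : Type) (r : seq J) (P : pred J) (F : J -> R[i]) :
  cabs (\sum_(j <- r | P j) F j) <= \sum_(j <- r | P j) cabs (F j).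
Proof.
elim/big_ind2: _ => //; first by rewrite cabs_real normr0.
by move=> a b c d h1 h2; apply: le_trans (cabsD _ _) (lerD h1 h2).
Qed.

Lemma cvg_complex_ReIm (a b : nat -> R) x y :
  a @ \oo --> x -> b @ \oo --> y ->
  (fun n => a n +i* b n : R[i]^o) @ \oo --> (x +i* y : R[i]^o).
Proof.
move=> /cvgrPdist_lt ha /cvgrPdist_lt hb; apply/cvg_complexP => e e0.
have e2 : 0 < e / 2 by lra.
have [N _ hN] := ha _ e2; have [N' _ hN'] := hb _ e2.
exists (maxn N N') => n; rewrite geq_max => /andP[/hN /= h1 /hN' /= h2].
apply: le_lt_trans (cabs_le _) _; rewrite /= [e]splitr ltrD //.
  by rewrite distrC.
by rewrite distrC.
Qed.

Definition exp_term c n : R[i] := (n`!%:R)^-1 * c ^+ n.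

Lemma exp_term_real x n : exp_term x%:C n = (exp_coeff x n)%:C.
Proof.
by rewrite /exp_term /exp_coeff /= mulrC rmorphM rmorphXn fmorphV rmorph_nat.
Qed.

Lemma cvg_exp_real x :
  (series (exp_term x%:C) : nat -> R[i]^o) @ \oo --> ((expR x)%:C : R[i]^o).
Proof.
rewrite (_ : series _ = fun n => (series (exp_coeff x) n)%:C); last first.
  apply/funext => n; rewrite /series /= rmorph_sum /=.
  by apply: eq_bigr => i _; rewrite exp_term_real.
have := @cvg_complex_ReIm (series (exp_coeff x)) (fun=> 0) (expR x) 0.
by apply; [exact: is_cvg_series_exp_coeff|exact: cvg_cst].
Qed.

(** Phrased with [odd], [./2] and [.-1./2] to match the shape of [cos_coeff] and [sin_coeff]. *)
Lemma expr_i n : ('i%C : R[i]) ^+ n =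
  ((~~ odd n)%:R * (-1) ^+ n./2) +i* ((odd n)%:R * (-1) ^+ n.-1./2).
Proof.
have sq : ('i%C : R[i]) ^+ 2 = -1 by rewrite sqr_i.
rewrite -{1}(odd_double_half n) exprD -mul2n exprM sq.
have -> : (-1 : R[i]) ^+ n./2 = ((-1 : R) ^+ n./2)%:C.
  by rewrite rmorphXn rmorphN1.
case: (boolP (odd n)) => on /=; rewrite ?expr0 ?expr1.
  have -> : n.-1./2 = n./2.
    by rewrite -{1}(odd_double_half n) on /= doubleK.
  by apply: complex_ext => /=; rewrite !(mulr0n, mulr1n); ring.
by apply: complex_ext => /=; rewrite !(mulr0n, mulr1n); ring.
Qed.

Lemma natC n : (n%:R : R[i]) = (n%:R : R)%:C.
Proof. by rewrite rmorph_nat. Qed.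

Lemma cvg_exp_imag t :
  (series (exp_term ('i%C * t%:C)) : nat -> R[i]^o) @ \oo -->
  (cos t +i* sin t : R[i]^o).
Proof.
rewrite (_ : series _ = fun n =>
    series (cos_coeff t) n +i* series (sin_coeff t) n); last first.
  apply/funext => n; apply: complex_ext; rewrite /series /= raddf_sum /=;
  apply: eq_bigr => k _; rewrite /exp_term exprMn expr_i -rmorphXn /=;
  rewrite natC -fmorphV /= ?/cos_coeff ?/sin_coeff /= -?exprnP; ring.
apply: cvg_complex_ReIm.
  by rewrite cos.unlock; exact: is_cvg_series_cos_coeff.
by rewrite sin.unlock; exact: is_cvg_series_sin_coeff.
Qed.

(** The triangle [j + k < n] is summed by antidiagonals on one side and by rows on the other. *)
Lemma sum_triangle (V : nmodType) (G : nat -> nat -> V) n :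
  \sum_(0 <= m < n) \sum_(0 <= j < m.+1) G j (m - j)%N =
  \sum_(0 <= j < n) \sum_(0 <= k < n | (j + k < n)%N) G j k.
Proof.
transitivity (\sum_(0 <= m < n) \sum_(0 <= j < n | (j < m.+1)%N) G j (m - j)%N).
  apply: eq_big_nat => m /andP[_ mn]; exact: big_nat_widen.
rewrite (exchange_big_dep_nat predT) //=.
apply: eq_big_nat => j /andP[_ jn].
transitivity (\sum_(j <= m < n) G j (m - j)%N).
  by rewrite (@big_nat_widenl _ _ _ j 0).
rewrite -{1}[j]add0n big_addn; transitivity (\sum_(0 <= k < n - j) G j k).
  by apply: eq_bigr => k _; rewrite addnK.
rewrite (big_nat_widen _ (n - j) n) ?leq_subr //; apply: eq_bigl => k.
by rewrite /= ltn_subRL.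
Qed.

Lemma exp_termD c d m :
  exp_term (c + d) m = \sum_(j < m.+1) exp_term c j * exp_term d (m - j).
Proof.
rewrite /exp_term (addrC c) exprDn mulr_sumr; apply: eq_bigr => -[j /= jm] _.
have f0 k : (k`!%:R : R[i]) != 0 by rewrite pnatr_eq0 -lt0n fact_gt0.
rewrite -[d ^+ _ * _ *+ _]mulr_natl; set b := 'C(m, j)%:R.
have -> : b = m`!%:R / (j`!%:R * (m - j)`!%:R).
  by rewrite /b -(@bin_fact m j) // !natrM mulfK // mulf_neq0.
by field; rewrite !f0.
Qed.

(* The difference on the left consists of the terms [exp_term c j *
   exp_term d k] with [j, k < n <= j + k]. *)
Lemma cauchy_product_exp c d n :
  cabs (series (exp_term c) n * series (exp_term d) n
        - series (exp_term (c + d)) n) <=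
  series (exp_coeff (cabs c)) n * series (exp_coeff (cabs d)) n
        - series (exp_coeff (cabs c + cabs d)) n.
Proof.
have key u v : series (exp_term u) n * series (exp_term v) n
        - series (exp_term (u + v)) n =
    \sum_(j < n) \sum_(k < n | (n <= j + k)%N) exp_term u j * exp_term v k.
  apply/eqP; rewrite subr_eq; apply/eqP.
  rewrite /series /= -[X in _ = _ + X]/(\sum_(0 <= m < n) _).
  under [X in _ = _ + X]eq_bigr => m _ do
    rewrite exp_termD -(big_mkord predT (fun j => exp_term u j * exp_term v (m - j))).
  rewrite (sum_triangle (fun j k => exp_term u j * exp_term v k)).
  rewrite !big_mkord big_distrlr /= -big_split /=; apply: eq_bigr => j _.
  rewrite (bigID (fun k : 'I_n => (n <= j + k)%N)) /= big_mkord; congr (_ + _).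
  by apply: eq_bigl => k; rewrite -ltnNge.
have cabs_term u k : cabs (exp_term u k) = exp_coeff (cabs u) k.
  rewrite /exp_term /exp_coeff /= cabsM cabsX natC -fmorphV /= cabs_real mulrC.
  by rewrite ger0_norm // invr_ge0.
have real n' x : (series (exp_coeff x) n')%:C = series (exp_term x%:C) n'.
  rewrite /series /= rmorph_sum /=.
  by apply: eq_bigr => i _; rewrite exp_term_real.
rewrite key; apply: le_trans (cabs_sum _ _ _) _.
(* By [key] at the real points [cabs c] and [cabs d], the right side is the same remainder with
   every term replaced by its modulus. *)
rewrite -lecR rmorphB rmorphM /= !real rmorphD /= key rmorph_sum /=.
apply: ler_sum => j _; apply: le_trans (_ : (\sum_(k < n | (n <= j + k)%N)
   cabs (exp_term c j * exp_term d k))%:C <= _); first by rewrite lecR cabs_sum.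
rewrite rmorph_sum /=; apply: ler_sum => k _.
by rewrite cabsM !cabs_term !exp_term_real rmorphM.
Qed.

(** In this closed form the modulus and the addition formula come from the real functions; the power
    series is then the theorem [cvg_cexp]. *)
Definition cexp c : R[i] :=
  (expR (complex.Re c))%:C * (cos (complex.Im c) +i* sin (complex.Im c)).

(** The series at [x] and at [iy] multiply to the limit. Passing from their product to the series at
    [x + iy] costs at most the same defect for the real exponential, which tends to 0 by [expRD]. *)
Lemma cvg_cexp c :
  (series (exp_term c) : nat -> R[i]^o) @ \oo --> (cexp c : R[i]^o).
Proof.
rewrite /cexp; case: c => x y /=; rewrite [x +i* y]complexE /=.
set u := x%:C; set v := 'i%C * y%:C.
have hu := @cvg_exp_real x; have hv := @cvg_exp_imag y.
have cuv : (fun n => series (exp_term u) n * series (exp_term v) n : R[i]^o) @ \oo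
    --> ((expR x)%:C * (cos y +i* sin y) : R[i]^o) by exact: cvgM hu hv.
have /cvgrPdist_lt hd : (fun n => series (exp_coeff (cabs u)) n *
    series (exp_coeff (cabs v)) n - series (exp_coeff (cabs u + cabs v)) n)
    @ \oo --> 0.
  rewrite -(subrr (expR (cabs u) * expR (cabs v))) -{2}expRD.
  apply: cvgB; last exact: is_cvg_series_exp_coeff.
  by apply: cvgM; exact: is_cvg_series_exp_coeff.
apply/cvg_complexP => e e0; have e2 : 0 < e / 2 by lra.
have [N _ hN] := hd _ e2; have [N' hN'] := (cvg_complexP _ _).1 cuv _ e2.
exists (maxn N N') => n; rewrite geq_max => /andP[/hN /= h1 /hN' /= h2].
set S := series (exp_term (u + v)) n.
set P := series (exp_term u) n * series (exp_term v) n in h2.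
set L := _ * (cos y +i* sin y) in h2 *.
have -> : S - L = (P - L) - (P - S) by ring.
apply: le_lt_trans (cabsB _ _) _; rewrite [e]splitr ltrD //.
apply: le_lt_trans (cauchy_product_exp _ _ _) _.
by move: h1; rewrite sub0r normrN; apply: le_lt_trans; exact: ler_norm.
Qed.

Lemma cabs_cexp c : cabs (cexp c) = expR (complex.Re c).
Proof.
rewrite cabsM cabs_real ger0_norm ?expR_ge0 //.
by rewrite /cabs /sqabs /= cos2Dsin2 sqrtr1 mulr1.
Qed.

End ComplexExponential.

(** * Uniqueness of power series on the real line *)

Section PowerSeries.
Variable R : realType.
Implicit Types (t : R) (d : nat -> R[i]).

Lemma geometric_sum_le t n : 0 <= t -> t <= 1 / 2 ->
  \sum_(0 <= k < n) t ^+ k <= 2.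
Proof.
move=> t0 t2; have : \sum_(0 <= k < n) t ^+ k <= 2 * (1 - t ^+ n).
  elim: n => [|n ih]; first by rewrite big_geq // expr0 subrr mulr0.
  rewrite big_nat_recr //= exprS.
  have tn : 0 <= t ^+ n by rewrite exprn_ge0.
  have : t * t ^+ n <= 1 / 2 * t ^+ n by rewrite ler_wpM2r.
  lra.
have tn : 0 <= t ^+ n by rewrite exprn_ge0.
lra.
Qed.

(** Convergence at [t = 1] bounds the coefficients by some [M]. If those below [m] vanish, dividing
    by [t^m] leaves [d m] plus a tail of size at most [2 M t], which is small with [t]. *)
Lemma power_series_eq0 d :
  (forall t, (series (fun n => t%:C ^+ n * d n) : nat -> R[i]^o) @ \oo
     --> (0 : R[i]^o)) -> forall m, d m = 0.
Proof.
move=> h.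
have [M M0 hM] : exists2 M, 0 <= M & forall n, cabs (d n) <= M.
  have [N hN] := (cvg_complexP _ _).1 (h 1) _ ltr01.
  (* Beyond [N] a coefficient is the difference of two partial sums of modulus less than 1, whence
     the [2]. *)
  exists (\sum_(0 <= k < N) cabs (d k) + 2) => [|n].
    by rewrite addr_ge0 // sumr_ge0 // => k _; exact: cabs_ge0.
  have [nN|Nn] := ltnP n N.
    rewrite big_mkord (bigD1 (Ordinal nN)) //= -addrA lerDl addr_ge0 //.
    by rewrite sumr_ge0 // => k _; exact: cabs_ge0.
  have := hN n Nn; have := hN n.+1 (leqW Nn); rewrite !subr0.
  set a := series _ n.+1; set b := series _ n => ha hb.
  have -> : d n = a - b.
    rewrite /a /b /series /= big_nat_recr //= [_ + 1%:C ^+ n * _]addrC addrK.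
    by rewrite rmorph1 expr1n mul1r.
  apply: le_trans (cabsB _ _) _.
  have : 0 <= \sum_(0 <= k < N) cabs (d k).
    by rewrite sumr_ge0 // => k _; exact: cabs_ge0.
  lra.
move=> m; elim/ltn_ind: m => m ih; apply/cabs_eq0/eqP.
rewrite eq_le cabs_ge0 andbT; apply/ler_addgt0Pr => e e0; rewrite add0r.
have K0 : 0 < 2 * M + 1 by lra.
(* [1 / 2] keeps the geometric sum below 2; the other entry makes the tail at most [e / 2], the
   [+ 1] covering the case [M = 0]. *)
pose t := Num.min (1 / 2) (e / 2 / (2 * M + 1)).
have t0 : 0 < t by rewrite lt_min divr_gt0 // divr_gt0 //; lra.
have t2 : t <= 1 / 2 by rewrite ge_min lexx.
have te : t * (2 * M + 1) <= e / 2.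
  by rewrite -ler_pdivlMr // ge_min lexx orbT.
have tm : 0 < t ^+ m by rewrite exprn_gt0.
have [N hN] := (cvg_complexP _ _).1 (h t) _ (mulr_gt0 tm (divr_gt0 e0 (ltr0Sn R 1))).
set n := (m.+1 + N)%N.
have {hN} := hN n (leq_addl _ _); rewrite subr0.
have -> : series (fun n => t%:C ^+ n * d n) n = (t ^+ m)%:C * (d m +
    \sum_(0 <= k < N) t%:C ^+ k.+1 * d (k + m.+1)%N).
  rewrite /series /= (@big_cat_nat _ _ _ m.+1) ?leq_addr //= big_nat_recr //=.
  rewrite big_nat_cond big1 ?add0r; last first.
    by move=> i /andP[/andP[_ im] _]; rewrite ih // mulr0.
  rewrite -[X in \big[_/_]_(X <= _ < _) _]add0n big_addn /n addKn mulrDr rmorphXn; congr (_ + _).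
  rewrite mulr_sumr; apply: eq_bigr => k _; rewrite mulrA -exprD.
  by congr (_ ^+ _ * _); rewrite !addnS addnC.
rewrite cabsM cabs_real (ger0_norm (ltW tm)) ltr_pM2l //.
set s := \sum_(0 <= k < N) _ => hs.
have : cabs s <= t * (2 * M).
  apply: le_trans (cabs_sum _ _ _) _.
  apply: (@le_trans _ _ (\sum_(0 <= k < N) t * (t ^+ k * M))).
    apply: ler_sum => k _; rewrite cabsM cabsX cabs_real (ger0_norm (ltW t0)).
    by rewrite exprS -mulrA !ler_wpM2l // ?exprn_ge0 // ltW.
  rewrite -mulr_sumr -mulr_suml ler_wpM2l ?(ltW t0) // ler_wpM2r //.
  exact: geometric_sum_le (ltW t0) t2.
have : cabs (d m) <= cabs (d m + s) + cabs s.
  by rewrite -{1}(addrK s (d m)); exact: cabsB.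
lra.
Qed.

Lemma power_series_unique d d' (g : R -> R[i]) :
  (forall t, (series (fun n => t%:C ^+ n * d n) : nat -> R[i]^o) @ \oo
     --> (g t : R[i]^o)) ->
  (forall t, (series (fun n => t%:C ^+ n * d' n) : nat -> R[i]^o) @ \oo
     --> (g t : R[i]^o)) -> d = d'.
Proof.
move=> h h'; apply/funext => n; apply/eqP; rewrite -subr_eq0; apply/eqP.
apply: (@power_series_eq0 (fun n => d n - d' n)) => t.
rewrite (_ : series _ = series (fun n => t%:C ^+ n * d n)
    - series (fun n => t%:C ^+ n * d' n)).
  by rewrite -(subrr (g t : R[i]^o)); exact: cvgB (h t) (h' t).
apply/funext => k; rewrite fctE /series /= -sumrB.
by apply: eq_bigr => i _; rewrite mulrBr.
Qed.

End PowerSeries.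

(** * Positive functionals *)

Section CstarBasics.
Variables (R : realType) (A : cstarAlgType R).
Implicit Types (a b h k : A) (c : R[i]).

Lemma cmulNl a b : (- a) ⋅ b = - (a ⋅ b).
Proof. by rewrite -scaleN1r cmulZl scaleN1r. Qed.

Lemma cmulNr a b : a ⋅ (- b) = - (a ⋅ b).
Proof. by rewrite -scaleN1r cmulZr scaleN1r. Qed.

Lemma cmulBl a b k : (a - b) ⋅ k = a ⋅ k - b ⋅ k.
Proof. by rewrite cmulDl cmulNl. Qed.

Lemma cmulBr a b k : k ⋅ (a - b) = k ⋅ a - k ⋅ b.
Proof. by rewrite cmulDr cmulNr. Qed.

Lemma cmul0l a : 0 ⋅ a = 0.
Proof. by apply: (addrI (0 ⋅ a)); rewrite -cmulDl !addr0. Qed.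

Lemma cmul0r a : a ⋅ 0 = 0.
Proof. by apply: (addrI (a ⋅ 0)); rewrite -cmulDr !addr0. Qed.

Lemma cadj0 : cadj (0 : A) = 0.
Proof. by apply: (addrI (cadj 0)); rewrite -cadjD !addr0. Qed.

Lemma cadjN a : cadj (- a) = - cadj a.
Proof. by apply: (addrI (cadj a)); rewrite -cadjD !subrr cadj0. Qed.

Lemma cadjB a b : cadj (a - b) = cadj a - cadj b.
Proof. by rewrite cadjD cadjN. Qed.

Lemma nrm_cmul a b : nrm (a ⋅ b) <= nrm a * nrm b.
Proof. by have := cnormM a b; rewrite !nrmE -rmorphM lecR. Qed.

Lemma nrm_cstar a : nrm (cadj a ⋅ a) = nrm a ^+ 2.
Proof.
by apply/(@complexI R); rewrite -nrmE cnormE nrmE rmorphXn.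
Qed.

Lemma nrm_cadj a : nrm (cadj a) = nrm a.
Proof.
have le b : nrm b <= nrm (cadj b).
  have [->|bn0] := eqVneq (nrm b) 0; first exact: nrm_ge0.
  have bp : 0 < nrm b by rewrite lt_def bn0 nrm_ge0.
  by rewrite -(ler_pM2r bp) -expr2 -nrm_cstar nrm_cmul.
by apply/eqP; rewrite eq_le le -{2}(cadjK a) le.
Qed.

Lemma projection_nrm a : projection a -> nrm a <= 1.
Proof.
move=> [aa a2]; have [->|an0] := eqVneq (nrm a) 0; first exact: ler01.
have ap : 0 < nrm a by rewrite lt_def an0 nrm_ge0.
by rewrite -(ler_pM2r ap) -expr2 -nrm_cstar aa a2 mul1r.
Qed.

Lemma nrm_le0_eq0 a : (forall e, 0 < e -> nrm a <= e) -> a = 0.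
Proof.
move=> H; apply: nrm_eq0; apply/eqP; rewrite eq_le nrm_ge0 andbT.
by apply/ler_addgt0Pr => e /H; rewrite add0r.
Qed.

(* [k = 1 - (1 - h)^(1/2)], found without a unit as the fixed point of the
   contraction [k |-> (h + k^2) / 2] of the ball of radius [|h|]. *)
Lemma cstar_sqrt h : cadj h = h -> nrm h < 1 ->
  exists2 k, cadj k = k & k + k - k ⋅ k = h.
Proof.
move=> hh; set r := nrm h => r1; have r0 : 0 <= r by exact: nrm_ge0.
pose half : R[i] := (2^-1)%:C.
have halfE x : half *: x + half *: x = x :> A.
  rewrite -scalerDl /half -rmorphD /= (_ : 2^-1 + 2^-1 = 1 :> R) ?scale1r //.
  by field.
have nrm_half x : nrm (half *: x : A) = nrm x / 2.
  by rewrite nrmZ cabs_real ger0_norm ?invr_ge0 // mulrC.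
pose T x := half *: (h + x ⋅ x); pose k n := iter n T 0.
have kS n : k n.+1 = T (k n) by [].
have k_le n : nrm (k n) <= r.
  elim: n => [|n ih]; first by rewrite nrm0.
  rewrite kS nrm_half ler_pdivrMr //; apply: le_trans (nrmD _ _) _.
  have := nrm_cmul (k n) (k n).
  have : nrm (k n) * nrm (k n) <= r * r by rewrite ler_pM ?nrm_ge0.
  have : r * r <= r * 1 by rewrite ler_wpM2l // ltW.
  rewrite -/r; lra.
have k_adj n : cadj (k n) = k n.
  elim: n => [|n ih]; first by rewrite cadj0.
  rewrite kS /T cadjZ cadjD cadjM hh ih; congr (_ *: _).
  by rewrite /half; apply: complex_ext => //=; rewrite oppr0.
have sq_diff x y : x ⋅ x - y ⋅ y = x ⋅ (x - y) + (x - y) ⋅ y :> A.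
  by rewrite cmulBl cmulBr addrA subrK.
(* [k^2 - k'^2 = k (k - k') + (k - k') k'] and the factor one half make the iteration contract at
   rate [r] on the ball of radius [r]. *)
have k_step n : nrm (k n.+1 - k n) <= r ^+ n * r.
  elim: n => [|n ih].
    by rewrite expr0 mul1r subr0; exact: k_le.
  rewrite kS (kS n) /T -scalerBr nrm_half opprD addrACA subrr add0r sq_diff.
  rewrite ler_pdivrMr //; apply: le_trans (nrmD _ _) _.
  have h1 := nrm_cmul (k n.+1) (k n.+1 - k n).
  have h2 := nrm_cmul (k n.+1 - k n) (k n).
  have h3 : nrm (k n.+1) * nrm (k n.+1 - k n) <= r * (r ^+ n * r).
    by rewrite ler_pM ?nrm_ge0.
  have h4 : nrm (k n.+1 - k n) * nrm (k n) <= (r ^+ n * r) * r.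
    by rewrite ler_pM ?nrm_ge0.
  rewrite exprS; lra.
have k_diff n p : nrm (k (n + p)%N - k n) * (1 - r) <= r ^+ n.
  have : nrm (k (n + p)%N - k n) * (1 - r) <= r ^+ n * (1 - r ^+ p).
    elim: p => [|p ih]; first by rewrite addn0 subrr nrm0 mul0r expr0 subrr mulr0.
    have : nrm (k (n + p.+1)%N - k n) <=
        nrm (k (n + p).+1 - k (n + p)%N) + nrm (k (n + p)%N - k n).
      by rewrite addnS -{1}(subrK (k (n + p)%N) (k (n + p).+1)) -addrA; exact: nrmD.
    move=> h1; have r1' : 0 <= 1 - r by lra.
    have := ler_wpM2r r1' h1; rewrite mulrDl => h2; apply: le_trans h2 _.
    apply: (@le_trans _ _ (r ^+ (n + p) * 1 * (1 - r) + r ^+ n * (1 - r ^+ p))).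
      apply: lerD => //; rewrite ler_wpM2r //; apply: le_trans (k_step _) _.
      by rewrite ler_wpM2l ?exprn_ge0 // ltW.
    by rewrite exprD exprS le_eqVlt; apply/orP; left; apply/eqP; ring.
  move=> h1; apply: le_trans h1 _; rewrite ler_piMr ?exprn_ge0 //.
  by have : 0 <= r ^+ p by [rewrite exprn_ge0]; lra.
have rn0 e : 0 < e -> exists N, forall n, (N <= n)%N -> r ^+ n < e.
  move=> e0; have /cvgrPdist_lt/(_ _ e0)[N _ hN] : (fun n => r ^+ n) @ \oo --> 0.
    by apply: cvg_expr; rewrite ger0_norm.
  by exists N => n /hN /=; rewrite sub0r normrN ger0_norm ?exprn_ge0.
have r1' : 0 < 1 - r by lra.
have [l hl] : exists l : A, k @ \oo --> l.
  apply/cvg_ex/cauchy_cvgP/cauchy_exP => e; rewrite ltcE /= => /andP[/eqP Ime e0].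
  have [N hN] := rn0 _ (mulr_gt0 e0 r1'); exists (k N); exists N => // n /= Nn.
  rewrite -ball_normE /= nrmE nrmB; apply: (@lt_le_trans _ _ (complex.Re e)%:C).
    rewrite ltcR -(ltr_pM2r r1') -(subnKC Nn); apply: le_lt_trans (k_diff _ _) _.
    exact: hN.
  by rewrite lecE /= -Ime eqxx lexx.
move/cvg_seqP: hl => hl; exists l.
  apply/eqP; rewrite -subr_eq0; apply/eqP/nrm_le0_eq0 => e e0.
  have [N hN] := hl (e / 2) (divr_gt0 e0 (ltr0Sn _ 1)); have {}hN := hN N (leqnn _).
  rewrite -(subrK (cadj (k N)) (cadj l)) {2}k_adj -addrA.
  apply: le_trans (nrmD _ _) _; rewrite -cadjB nrm_cadj nrmB; lra.
apply/eqP; rewrite -subr_eq0; apply/eqP/nrm_le0_eq0 => e e0.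
(* The errors are [l - x] twice, [y (y - l)] of size [r d] and [(y - l) l] of size [d |l|]: together
   [d (2 + |l| + r)]. *)
have C0 : 0 < 2 + (nrm l + r) by have := nrm_ge0 l; lra.
have [N hN] := hl _ (divr_gt0 e0 C0).
have h1 := hN N (leqnn _); have h2 := hN N.+1 (leqnSn _).
have fix_k : k N.+1 + k N.+1 - k N ⋅ k N = h by rewrite kS /T halfE addrK.
rewrite -{1}fix_k.
set x := k N.+1 in h2 *; set y := k N in h1 *.
have -> : l + l - l ⋅ l - (x + x - y ⋅ y) =
    (l - x) + (l - x) + (y ⋅ y - l ⋅ l).
  rewrite opprB addrACA [(l - x) + (l - x)]addrACA [RHS]addrACA -[- x - x]opprD.
  by congr (_ + _); exact: addrC.
rewrite sq_diff; have h3 := nrmD (l - x + (l - x)) (y ⋅ (y - l) + (y - l) ⋅ l).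
have h4 := nrmD (l - x) (l - x); have h5 := nrmD (y ⋅ (y - l)) ((y - l) ⋅ l).
have h6 := nrm_cmul y (y - l); have h7 := nrm_cmul (y - l) l.
set d := e / _ in h1 h2; have d0 : 0 <= d.
  exact: le_trans (nrm_ge0 _) (ltW h1).
have h8 : nrm y * nrm (y - l) <= r * d by rewrite ler_pM ?nrm_ge0 ?k_le // ltW.
have h9 : nrm (y - l) * nrm l <= d * nrm l by rewrite ler_wpM2r ?nrm_ge0 // ltW.
have -> : e = d * (2 + (nrm l + r)) by rewrite /d divfK // gt_eqF.
rewrite (nrmB l x) in h4; lra.
Qed.

End CstarBasics.

Section PositiveFunctionals.
Variables (R : realType) (A : cstarAlgType R).
Implicit Types (a b h k : A) (c : R[i]).

Definition positive_functional (psi : A -> R[i]) : Prop :=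
  scalar psi /\ forall a, 0 <= psi (cadj a ⋅ a).

Variables (psi : A -> R[i]) (psi_pos : positive_functional psi).

Lemma pfunD a b : psi (a + b) = psi a + psi b.
Proof. by have := psi_pos.1 1 a b; rewrite scale1r mul1r. Qed.

Lemma pfun0 : psi 0 = 0.
Proof. by apply: (addrI (psi 0)); rewrite -pfunD !addr0. Qed.

Lemma pfunZ c a : psi (c *: a) = c * psi a.
Proof. by have := psi_pos.1 c a 0; rewrite pfun0 !addr0. Qed.

Lemma pfunN a : psi (- a) = - psi a.
Proof. by rewrite -scaleN1r pfunZ mulN1r. Qed.

Lemma pfunB a b : psi (a - b) = psi a - psi b.
Proof. by rewrite pfunD pfunN. Qed.

Lemma pfun_real a : psi (cadj a ⋅ a) = (complex.Re (psi (cadj a ⋅ a)))%:C.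
Proof.
have := psi_pos.2 a; rewrite ge0_complex => /andP[_ /eqP Im0].
exact: complex_ext.
Qed.

Lemma pfun_ge0 a : 0 <= complex.Re (psi (cadj a ⋅ a)).
Proof. by have := psi_pos.2 a; rewrite ge0_complex => /andP[]. Qed.

Lemma pfun_cauchy_schwarz a b :
  psi (cadj b ⋅ a) = (psi (cadj a ⋅ b))^*%C /\
  sqabs (psi (cadj a ⋅ b)) <=
    complex.Re (psi (cadj a ⋅ a)) * complex.Re (psi (cadj b ⋅ b)).
Proof.
have H c : 0 <= (complex.Re (psi (cadj b ⋅ b)))%:C + c^*%C * psi (cadj a ⋅ b)
    + c * psi (cadj b ⋅ a) + c * c^*%C * (complex.Re (psi (cadj a ⋅ a)))%:C.
  have := psi_pos.2 (b + c *: a); rewrite cadjD cadjZ cmulDl !cmulDr !cmulZl !cmulZr.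
  rewrite !pfunD !pfunZ -!pfun_real => h; apply: le_trans h _.
  by rewrite le_eqVlt; apply/orP; left; apply/eqP; ring.
by have [-> h] := cauchy_schwarz_scalar (pfun_ge0 a) H; split; rewrite // mulrC.
Qed.

Lemma pfun_null a b : psi (cadj a ⋅ a) = 0 -> psi (cadj b ⋅ a) = 0.
Proof.
move=> a0; have [-> ] := pfun_cauchy_schwarz a b; rewrite a0 mul0r => h.
have /eqP -> : psi (cadj a ⋅ b) == 0; last by rewrite conjc0.
apply/eqP/cabs_eq0; apply/eqP; rewrite /cabs.
by rewrite (_ : sqabs _ = 0) ?sqrtr0 //; apply/eqP; rewrite eq_le h sqabs_ge0.
Qed.

Lemma pfun_null' a b : psi (cadj a ⋅ a) = 0 -> psi (cadj a ⋅ b) = 0.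
Proof.
by move=> a0; have [-> _] := pfun_cauchy_schwarz b a; rewrite pfun_null // conjc0.
Qed.

(** The elements representing 0 in the GNS space of [psi], a space that is never constructed. *)
Definition null_vector a : Prop := psi (cadj a ⋅ a) = 0.

(** By Cauchy-Schwarz [psi (b^* x) = 0] for every [x], in particular for [x = a^* a b]. *)
Lemma null_vectorM a b : null_vector b -> null_vector (a ⋅ b).
Proof.
by move=> b0; rewrite /null_vector cadjM -cmulA pfun_null'.
Qed.

Lemma null_vectorD a b : null_vector a -> null_vector b -> null_vector (a + b).
Proof.
move=> a0 b0; rewrite /null_vector cadjD cmulDl !cmulDr !pfunD a0 b0.
by rewrite (pfun_null _ b0) (pfun_null _ a0) !addr0.
Qed.

Lemma null_vectorZ c a : null_vector a -> null_vector (c *: a).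
Proof. by move=> a0; rewrite /null_vector cmulZr pfunZ pfun_null // mulr0. Qed.

Lemma null_vectorB a b : null_vector a -> null_vector b -> null_vector (a - b).
Proof.
by move=> a0 b0; rewrite -scaleN1r; apply/null_vectorD => //; exact: null_vectorZ.
Qed.

Lemma null_vector_le0 a : psi (cadj a ⋅ a) <= 0 -> null_vector a.
Proof. by move=> h; apply/eqP; rewrite eq_le h psi_pos.2. Qed.

End PositiveFunctionals.

(** * Words in a Toeplitz family *)

Section ClosedSubspaces.
Variable R : realType.

Lemma closed_preimage (V W : normedModType R[i]) (f : V -> W) M (X : set W) :
  (forall a b, f (a - b) = f a - f b) -> (forall a, nrm (f a) <= M * nrm a) ->
  closed X -> closed [set a | X (f a)].
Proof.
move=> fB fM /closedP cX; apply/closedP => x hx; apply: cX => e e0.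
have M0 : 0 < `|M| + 1 by rewrite ltr_wpDl.
have [y Xy xy] := hx _ (divr_gt0 e0 M0); exists (f y) => //.
rewrite -fB; apply: le_lt_trans (fM _) _.
apply: (@le_lt_trans _ _ (nrm (x - y) * (`|M| + 1))).
  rewrite mulrC ler_wpM2l ?nrm_ge0 //; apply: le_trans (ler_norm _) _.
  by rewrite lerDl.
by rewrite -ltr_pdivlMr.
Qed.

(** The shape of the properties that [words_dense] extends from words to the whole algebra. *)
Definition closed_linear (V : normedModType R[i]) (X : set V) : Prop :=
  closed X /\ forall (c : R[i]) a b, X a -> X b -> X (c *: a + b).

Lemma closed_linear_preimage (V W : normedModType R[i]) (f : V -> W) M X :
  linear f -> (forall a, nrm (f a) <= M * nrm a) ->
  closed_linear X -> closed_linear [set a | X (f a)].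
Proof.
move=> lf fM [cX lX]; split; last by move=> c a b /=; rewrite lf; exact: lX.
apply: closed_preimage fM cX => a b.
by rewrite addrC -scaleN1r lf scaleN1r addrC.
Qed.

Lemma closed_linear_bigcap (V : normedModType R[i]) (P : set V -> Prop) :
  closed_linear [set a | forall X, closed_linear X -> P X -> X a].
Proof.
split.
  apply/closedP => x hx X cX PX; have /closedP := cX.1; apply => e /hx[y hy xy].
  by exists y => //; exact: hy.
by move=> c a b ha hb X cX PX; apply: cX.2; [exact: ha|exact: hb].
Qed.

Lemma closed_linear0 (V : normedModType R[i]) : closed_linear [set (0 : V)].
Proof.
split; last by move=> c a b -> ->; rewrite scaler0 addr0.
apply/closedP => x hx; apply/nrm_eq0/eqP; rewrite eq_le nrm_ge0 andbT.
by apply/ler_addgt0Pr => e /hx[y ->]; rewrite subr0 add0r => /ltW.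
Qed.

End ClosedSubspaces.

Section ToeplitzFamilies.
Variables (R : realType) (E : digraph) (A : cstarAlgType R).
Variables (p : vertex E -> A) (s : edge E -> A).
Hypothesis TCK : TCK_family p s.
Implicit Types (a b x y : A) (e f : edge E) (v w : vertex E) (k l : int).

(** The index is the gauge degree: [gamma z] multiplies a letter of degree [k] by [z^k]. *)
Inductive letter : int -> A -> Prop :=
| letter_p v : letter 0 (p v)
| letter_s e : letter 1 (s e)
| letter_adj e : letter (- 1) (cadj (s e)).

(** Arbitrary products instead of the [s_mu s_nu^*]: they are closed under products by construction,
    whereas reducing to the latter form requires [s_e^* s_f = 0], a consequence of the order
    relations. *)
Inductive word : int -> A -> Prop :=
| word_letter k a : letter k a -> word k a
| word_cons k l a b : letter k a -> word l b -> word (k + l) (a ⋅ b).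

Lemma p_adj v : cadj (p v) = p v.
Proof. by have [h _ _ _ _] := TCK; have [] := h v. Qed.

Lemma p_idem v : p v ⋅ p v = p v.
Proof. by have [h _ _ _ _] := TCK; have [] := h v. Qed.

Lemma p_orth v w : v != w -> p v ⋅ p w = 0.
Proof. by have [_ h _ _ _] := TCK; exact: h. Qed.

Lemma s_iso e : cadj (s e) ⋅ s e = p (src e).
Proof. by have [_ _ _ h _] := TCK. Qed.

Lemma s_src e : s e ⋅ p (src e) = s e.
Proof. by have [_ _ h _ _] := TCK; rewrite -s_iso cmulA; exact: h. Qed.

Lemma src_adj e : p (src e) ⋅ cadj (s e) = cadj (s e).
Proof. by rewrite -{2}(s_src e) cadjM p_adj. Qed.

Lemma word_mul k l a b : word k a -> word l b -> word (k + l) (a ⋅ b).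
Proof.
move=> wa wb; elim: wa => [{}k {}a la|{}k l' {}a a' la wa' ih].
  exact: word_cons.
by rewrite -cmulA -addrA; exact: word_cons.
Qed.

Lemma letter_cadj k a : letter k a -> letter (- k) (cadj a).
Proof.
case=> [v|e|e]; first by rewrite p_adj oppr0; exact: letter_p.
  exact: letter_adj.
by rewrite cadjK opprK; exact: letter_s.
Qed.

Lemma word_cadj k a : word k a -> word (- k) (cadj a).
Proof.
elim=> [{}k {}a /letter_cadj|{}k l {}a b la _ ih]; first exact: word_letter.
rewrite cadjM opprD addrC; apply: word_mul ih _.
exact/word_letter/letter_cadj.
Qed.

Lemma letter_factor k a : letter k a -> exists y, a = a ⋅ y.
Proof.
case=> [v|e|e]; first by exists (p v); rewrite p_idem.
  by exists (p (src e)); rewrite s_src.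
exists (s e ⋅ cadj (s e)); rewrite cmulA s_iso.
by rewrite src_adj.
Qed.

Lemma rmul_closed_linear x (X : set A) : closed_linear X ->
  closed_linear [set a | X (a ⋅ x)].
Proof.
apply: (@closed_linear_preimage R A A (fun a => a ⋅ x) (nrm x)).
  by move=> c a b; rewrite cmulDl cmulZl.
by move=> a; rewrite mulrC; exact: nrm_cmul.
Qed.

Lemma lmul_closed_linear x (X : set A) : closed_linear X ->
  closed_linear [set a | X (x ⋅ a)].
Proof.
apply: (@closed_linear_preimage R A A (fun a => x ⋅ a) (nrm x)).
  by move=> c a b; rewrite cmulDr cmulZr.
by move=> a; exact: nrm_cmul.
Qed.

Hypothesis gen : cstar_generated_by (range p `|` range s).

(** The closed span [W] of the words is a subalgebra, because multiplication by a fixed element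
    pulls closed subspaces back to closed subspaces; the two factors are released one after the
    other. *)
Lemma words_dense (X : set A) : closed_linear X ->
  (forall k a, word k a -> X a) -> forall a, X a.
Proof.
move=> cX wX.
pose P (Y : set A) := forall k a, word k a -> Y a.
pose W : set A := [set a | forall Y, closed_linear Y -> P Y -> Y a].
have cW : closed_linear W by exact: closed_linear_bigcap.
have wW k a : word k a -> W a by move=> wa Y _; apply; exact: wa.
suff WT : W = setT by move=> a; have : W a by [rewrite WT]; apply.
apply: gen.
- move=> _ [[v _ <-]|[e _ <-]]; apply: wW; apply: word_letter.
    exact: letter_p.
  exact: letter_s.
- exact: cW.1.
- exact: cW.2.
- move=> a b Wa; move: b.
  suff H k b : word k b -> W (a ⋅ b).
    move=> b Wb; apply: (Wb _ (lmul_closed_linear a cW)) => k c; exact: H.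
  move=> wb; apply: (Wa _ (rmul_closed_linear b cW)) => l c wc.
  by apply: wW; exact: word_mul wc wb.
(* The adjoint is only conjugate-linear, so [closed_linear_preimage] does not apply as it stands. *)
- move=> a Wa; have cadjW : closed_linear [set a | W (cadj a)].
    split; last by move=> c x y /=; rewrite cadjD cadjZ; exact: cW.2.
    apply: (@closed_preimage R A A _ 1) cW.1 => [x y|x]; first exact: cadjB.
    by rewrite nrm_cadj mul1r.
  by apply: (Wa _ cadjW) => k x wx; apply: wW; exact: word_cadj wx.
Qed.

Section Functional.
Variable psi : A -> R[i].
Hypothesis psi_pos : positive_functional psi.
Local Notation null := (null_vector psi).

(** With [q = p (rng e)], compressing [q - s_e s_e^* = c^* c] by the formal complement [1 - q]
    removes [q] and leaves the minus sign. Deducing that the defect is 0 would take order theory; a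
    positive functional only needs this identity. *)
Lemma projection_defect e : exists d,
  (s e - p (rng e) ⋅ s e) ⋅ cadj (s e - p (rng e) ⋅ s e) = - (cadj d ⋅ d).
Proof.
have [_ _ _ _ /(_ (rng e) [set e]%SET)] := TCK.
case=> [f /set1P -> //|c]; rewrite big_set1 => hc.
set q := p (rng e); exists (c - c ⋅ q).
have fac x y : (x - q ⋅ x) ⋅ (y - y ⋅ q) =
    (x ⋅ y - x ⋅ y ⋅ q) - q ⋅ (x ⋅ y - x ⋅ y ⋅ q).
  by rewrite cmulBl -cmulA cmulBr (cmulA x).
rewrite !cadjB !cadjM p_adj -/q !fac -hc; set u := s e ⋅ cadj (s e).
have -> : p (rng e) - u - (p (rng e) - u) ⋅ q = - (u - u ⋅ q).
  by rewrite cmulBl p_idem opprD addrACA subrr add0r -opprD.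
by rewrite cmulNr -opprD opprK.
Qed.

Lemma adj_defectE e y : cadj (s e) ⋅ y - cadj (s e) ⋅ (p (rng e) ⋅ y) =
  cadj (s e - p (rng e) ⋅ s e) ⋅ y.
Proof. by rewrite cadjB cadjM p_adj cmulBl -!cmulA. Qed.

(** For [x = s_e - p (rng e) s_e], [projection_defect] gives [psi (y^* x x^* y) = - psi ((d y)^* d
    y) <= 0]. *)
Lemma null_adj_defect e y :
  null (cadj (s e) ⋅ y - cadj (s e) ⋅ (p (rng e) ⋅ y)).
Proof.
have [d hd] := projection_defect e.
apply: null_vector_le0 => //; rewrite adj_defectE.
set x := s e - _; rewrite cadjM cadjK -cmulA (cmulA x) hd cmulNl cmulNr.
rewrite (pfunN psi_pos) oppr_le0 -cmulA cmulA -cadjM.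
exact: psi_pos.2.
Qed.

(** Apply the previous lemma to [x y]: [x^* x y] is null, hence so is [x y], because
    [psi (y^* x^* x y) = 0]. *)
Lemma null_defect e y : null (s e ⋅ y - p (rng e) ⋅ (s e ⋅ y)).
Proof.
rewrite (cmulA (p _)) -cmulBl.
have := null_adj_defect e ((s e - p (rng e) ⋅ s e) ⋅ y).
rewrite adj_defectE => h; rewrite /null_vector cadjM -cmulA.
exact: pfun_null h.
Qed.

Lemma null_p_s v e y : v != rng e -> null (p v ⋅ (s e ⋅ y)).
Proof.
move=> vr; have := null_vectorM psi_pos (p v) (null_defect e y).
by rewrite cmulBr [p v ⋅ (p _ ⋅ _)]cmulA p_orth // cmul0l subr0.
Qed.

(** If the ranges differ, [p (rng f)] annihilates [z = s_e y]. If they agree, the order relation for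
    the set of both edges, tested on [z], has [p z] and [s_e s_e^* z] cancelling, so
    [psi (z^* s_f s_f^* z) <= 0]. *)
Lemma null_orth e f y : e != f -> null (cadj (s f) ⋅ (s e ⋅ y)).
Proof.
move=> ef; have [rr|rr] := eqVneq (rng f) (rng e); last first.
  have := null_vectorD psi_pos (null_adj_defect f (s e ⋅ y))
    (null_vectorM psi_pos (cadj (s f)) (null_p_s y rr)).
  by rewrite subrK.
set z := s e ⋅ y; have [_ _ _ _ /(_ (rng e) [set e; f]%SET)] := TCK.
case=> [g|c]; first by rewrite !inE => /orP[] /eqP ->.
rewrite big_setU1 ?inE //= big_set1 => hc.
apply: null_vector_le0 => //; rewrite cadjM cadjK.
have pz : psi (cadj z ⋅ (p (rng e) ⋅ z)) = psi (cadj z ⋅ z).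
  apply/eqP; rewrite eq_sym -subr_eq0 -(pfunB psi_pos) -cmulBr.
  by rewrite (pfun_null psi_pos) //; exact: null_defect.
have ez : s e ⋅ (cadj (s e) ⋅ z) = z by rewrite /z (cmulA (cadj _)) s_iso cmulA s_src.
have := psi_pos.2 (c ⋅ z); rewrite cadjM -cmulA (cmulA (cadj c)) -hc.
rewrite cmulBl cmulDl -!cmulA cmulBr cmulDr ez (pfunB psi_pos) (pfunD psi_pos) pz.
by rewrite opprD addrA subrr sub0r oppr_ge0.
Qed.

End Functional.

End ToeplitzFamilies.

(** * Functionals whose GNS vector is killed by the adjoint edges *)

Section GroundFunctionals.
Variables (R : realType) (E : digraph) (A : cstarAlgType R).
Variables (p : vertex E -> A) (s : edge E -> A).
Hypothesis TCK : TCK_family p s.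
Hypothesis gen : cstar_generated_by (range p `|` range s).
Implicit Types (a b x y : A) (e f : edge E) (v w : vertex E) (k l : int).

(** Substitute for a unit: the identity in the path representation ([pi_vertex_sum]), and invisible
    on the left under a ground functional ([ground_vertex_sum]). *)
Definition vertex_sum : A := \sum_v p v.

Lemma vertex_sum_adj : cadj vertex_sum = vertex_sum.
Proof.
rewrite /vertex_sum (big_morph _ (@cadjD R A) (@cadj0 R A)).
by apply: eq_bigr => v _; exact: p_adj TCK v.
Qed.

Lemma cmul_suml (J : finType) (F : J -> A) y :
  (\sum_j F j) ⋅ y = \sum_j F j ⋅ y.
Proof.
by rewrite (big_morph (fun x => x ⋅ y) (fun a b => cmulDl a b y) (cmul0l y)).
Qed.

Lemma cmul_sumr (J : finType) (F : J -> A) y :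
  y ⋅ (\sum_j F j) = \sum_j y ⋅ F j.
Proof. by rewrite (big_morph (cmul y) (cmulDr y) (cmul0r y)). Qed.

Lemma vertex_sum_p v : vertex_sum ⋅ p v = p v.
Proof.
rewrite cmul_suml (bigD1 v) //= big1 ?addr0; first exact: (p_idem TCK).
by move=> w wv; exact: (p_orth TCK).
Qed.

Lemma vertex_sum_projection : projection vertex_sum.
Proof.
split; first exact: vertex_sum_adj.
by rewrite {2}/vertex_sum cmul_sumr; apply: eq_bigr => v _; exact: vertex_sum_p.
Qed.

Lemma vertex_sum_adj_s e : vertex_sum ⋅ cadj (s e) = cadj (s e).
Proof. by rewrite -(src_adj TCK) cmulA vertex_sum_p. Qed.

Definition bounded_functional (psi : A -> R[i]) : Prop :=
  exists M, forall a, cabs (psi a) <= M * nrm a.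

(* The GNS vector of [psi] is annihilated by every [pi (s e)^*]. *)
Definition ground_functional (psi : A -> R[i]) : Prop :=
  [/\ positive_functional psi, bounded_functional psi
    & forall e, psi (s e ⋅ cadj (s e)) = 0].

Lemma closed_linear_eq (f g : A -> R[i]) : scalar f -> scalar g ->
  bounded_functional f -> bounded_functional g ->
  closed_linear [set a | f a = g a].
Proof.
move=> lf lg [M fM] [N gN].
have := @closed_linear_preimage R A (R[i]^o) (fun a => f a - g a) (M + N) [set 0].
rewrite (_ : [set a | _] = [set a | f a = g a]); last first.
  apply/seteqP; split=> a /= => [/eqP|->]; last by rewrite subrr.
  by rewrite subr_eq0 => /eqP.
apply.
- by move=> c a b; rewrite lf lg scalerBr opprD addrACA.
- move=> a; rewrite nrm_complex; apply: le_trans (cabsB _ _) _.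
  by rewrite mulrDl lerD.
exact: closed_linear0.
Qed.

Section OneFunctional.
Variable psi : A -> R[i].
Hypothesis gpsi : ground_functional psi.
Let psi_pos : positive_functional psi. Proof. by have [] := gpsi. Qed.
Local Notation null := (null_vector psi).

Lemma null_adj e : null (cadj (s e)).
Proof. by rewrite /null_vector cadjK; have [_ _] := gpsi. Qed.

Lemma ground_s e a : psi (s e ⋅ a) = 0.
Proof. by rewrite -(cadjK (s e)) (pfun_null' psi_pos) //; exact: null_adj. Qed.

(** Null vectors form only a left ideal, so multiplying [s_e^*] by [p v] on the right needs an
    argument: for [v = rng e] the difference from [s_e^*] is the adjoint of the defect, null by
    [projection_defect]. *)
Lemma null_adj_p e v : null (cadj (s e) ⋅ p v).
Proof.
have h := null_adj_defect TCK psi_pos e (p v).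
have [vr|vr] := eqVneq (rng e) v; last first.
  by move: h; rewrite (p_orth TCK) // cmul0r subr0.
have [d hd] := projection_defect TCK e.
have nd : null (cadj (s e - p (rng e) ⋅ s e)).
  apply: null_vector_le0 => //; rewrite cadjK hd (pfunN psi_pos) oppr_le0.
  exact: psi_pos.2.
rewrite -vr (_ : _ ⋅ _ = cadj (s e) - cadj (s e - p (rng e) ⋅ s e)).
  by apply: null_vectorB => //; exact: null_adj.
by rewrite cadjB cadjM (p_adj TCK) opprB addrC subrK.
Qed.

Lemma null_adj_sum e : null (cadj (s e) ⋅ vertex_sum).
Proof.
rewrite cmul_sumr; elim/big_ind: _ => [|x y|v _]; last exact: null_adj_p.
  by rewrite /null_vector cmul0r (pfun0 psi_pos).
exact: null_vectorD.
Qed.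

Lemma pfun_scalar : scalar psi. Proof. exact: psi_pos.1. Qed.

(** On words, by the first letter: [p v] and [s_e^*] absorb the vertex sum on their left, and for
    [s_e] both sides vanish. *)
Lemma ground_vertex_sum a : psi a = psi (vertex_sum ⋅ a).
Proof.
have bpsi : bounded_functional psi by have [] := gpsi.
move: a; apply: (@words_dense _ _ _ _ _ TCK gen [set a | psi a = psi (vertex_sum ⋅ a)]).
  apply: closed_linear_eq; [exact: pfun_scalar| |exact: bpsi|].
    by move=> c a b; rewrite cmulDr cmulZr pfun_scalar.
  have [M hM] := bpsi; exists (`|M| * nrm vertex_sum) => a.
  apply: le_trans (hM _) _; apply: le_trans (ler_wpM2r (nrm_ge0 _) (ler_norm M)) _.
  by rewrite -mulrA ler_wpM2l // nrm_cmul.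
have H k a y : letter p s k a -> psi (a ⋅ y) = psi (vertex_sum ⋅ (a ⋅ y)).
  case=> [v|e|e]; rewrite cmulA.
  - by rewrite vertex_sum_p.
  - rewrite ground_s -(cadjK vertex_sum) -{1}(cadjK (s e)) -cadjM vertex_sum_adj.
    by rewrite (pfun_null' psi_pos) //; exact: null_adj_sum.
  - by rewrite vertex_sum_adj_s.
move=> k _ [{}k a la|{}k l a b la _]; last exact: H la.
by have [y ->] := letter_factor TCK la; exact: H la.
Qed.

Lemma ground_null a : null a -> psi a = 0.
Proof.
move=> na; rewrite ground_vertex_sum -vertex_sum_adj.
exact: (pfun_null psi_pos).
Qed.

End OneFunctional.

Inductive reduced : A -> Prop :=
| reduced_p v : reduced (p v)
| reduced_s e y : reduced y -> reduced (s e ⋅ y).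

Section TwoFunctionals.
Variables psi psi' : A -> R[i].
Hypotheses (gpsi : ground_functional psi) (gpsi' : ground_functional psi').
Let psi_pos : positive_functional psi. Proof. by have [] := gpsi. Qed.
Let psi_pos' : positive_functional psi'. Proof. by have [] := gpsi'. Qed.

Let null a := null_vector psi a /\ null_vector psi' a.

(* Modulo the common null vectors, the [s_mu p_v] span a left ideal. *)
Let cyclic : set A := [set a | forall X, closed_linear X ->
  (forall x, null x \/ reduced x -> X x) -> X a].

Let cyclic_closed : closed_linear cyclic.
Proof. exact: closed_linear_bigcap. Qed.

Let cyclic_null x : null x -> cyclic x.
Proof. by move=> nx X _; apply; left. Qed.

Let cyclic_reduced x : reduced x -> cyclic x.
Proof. by move=> nx X _; apply; right. Qed.

Let nullM a x : null x -> null (a ⋅ x).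
Proof. by move=> [h h']; split; exact: null_vectorM. Qed.

Let cyclic_mod a x : null (a - x) -> cyclic x -> cyclic a.
Proof.
move=> n cx; rewrite -(subrK x a) -(scale1r (a - x)).
by apply: cyclic_closed.2 => //; exact: cyclic_null.
Qed.

Let cyclic0 : cyclic 0.
Proof.
by apply: cyclic_null; split; rewrite /null_vector cmul0r pfun0.
Qed.

Let cyclic_p v x : reduced x -> cyclic (p v ⋅ x).
Proof.
case=> [w|e y ry].
  have [->|vw] := eqVneq v w; last first.
    by rewrite (p_orth TCK) //; exact: cyclic0.
  by rewrite (p_idem TCK); apply: cyclic_reduced; exact: reduced_p.
have [->|vr] := eqVneq v (rng e); last first.
  by apply: cyclic_null; split; exact: (null_p_s TCK).
apply: (@cyclic_mod _ (s e ⋅ y)); last by apply: cyclic_reduced; exact: reduced_s.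
by split; rewrite -opprB -scaleN1r; apply: null_vectorZ => //; exact: (null_defect TCK).
Qed.

(** Modulo null vectors [s_e^*] annihilates [p v] and every [s_f y] with [f != e], and it turns
    [s_e y] into [p (src e) y]. *)
Let cyclic_letter k a x : letter p s k a -> reduced x -> cyclic (a ⋅ x).
Proof.
case=> [v|e|e] rx; [exact: cyclic_p|by apply: cyclic_reduced; exact: reduced_s|].
case: rx => [v|f y ry].
  by apply: cyclic_null; split; exact: null_adj_p.
have [->|fe] := eqVneq f e; first by rewrite cmulA (s_iso TCK); exact: cyclic_p.
by apply: cyclic_null; split; exact: (null_orth TCK).
Qed.

Let cyclic_word k a x : word p s k a -> cyclic x -> cyclic (a ⋅ x).
Proof.
have H l b y : letter p s l b -> cyclic y -> cyclic (b ⋅ y).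
  move=> lb cy; apply: (cy _ (lmul_closed_linear b cyclic_closed)) => z [nz|rz].
    by apply: cyclic_null; exact: nullM.
  exact: cyclic_letter lb rz.
move=> wa; elim: wa x => [{}k {}a la|{}k l {}a b la _ ih] x cx.
  exact: H la cx.
by rewrite -cmulA; apply: H la _; exact: ih.
Qed.

Let cyclic_ideal a x : cyclic x -> cyclic (a ⋅ x).
Proof.
move=> cx; move: a; apply: (words_dense TCK gen (rmul_closed_linear x cyclic_closed)).
by move=> k b wb; exact: cyclic_word wb cx.
Qed.

Lemma ground_functional_unique :
  (forall v, psi (p v) = psi' (p v)) -> psi = psi'.
Proof.
move=> eqp.
have eqc a : cyclic a -> psi a = psi' a.
  move=> ca; apply: (ca [set a | psi a = psi' a]).
    have [_ b _] := gpsi; have [_ b' _] := gpsi'.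
    by apply: closed_linear_eq => //; exact: pfun_scalar.
  move=> x [[n n']|[v|e y _]] /=; first by rewrite !ground_null.
    exact: eqp.
  by rewrite !ground_s.
have eqP' a : psi (a ⋅ vertex_sum) = psi' (a ⋅ vertex_sum).
  apply: eqc; apply: cyclic_ideal; rewrite /vertex_sum; apply: (big_ind cyclic) => [|x y cx cy|v _].
  - exact: cyclic0.
  - by rewrite -(scale1r x); exact: cyclic_closed.2.
  - by apply: cyclic_reduced; exact: reduced_p.
apply/funext => a; rewrite (ground_vertex_sum gpsi) (ground_vertex_sum gpsi').
have [h _] := pfun_cauchy_schwarz psi_pos a vertex_sum.
have [h' _] := pfun_cauchy_schwarz psi_pos' a vertex_sum.
by rewrite vertex_sum_adj in h h'; rewrite h h' eqP'.
Qed.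

End TwoFunctionals.

End GroundFunctionals.

(** * The path representation *)

Section PartialInjections.
Variables (R : realType) (J : choiceType).

(** A partial injection is stored with its inverse, so that the adjoint of its shift is again a
    shift. *)
Record pinj := Pinj {
  fwd : J -> option J;
  bwd : J -> option J;
  pinjP : forall i j, fwd i = Some j <-> bwd j = Some i
}.

Definition pinv (t : pinj) : pinj :=
  @Pinj (bwd t) (fwd t) (fun i j => iff_sym (pinjP t j i)).

Definition pull (T : Type) (z : T) (g : J -> option J) (x : J -> T) (i : J) : T :=
  oapp x z (g i).

Lemma sum_pull (V : nmodType) (g : J -> option J) (x : J -> V) (s : seq J) :
  \sum_(i <- s) pull 0 g x i = \sum_(j <- pmap g s) x j.
Proof.
elim: s => [|i s ih]; first by rewrite !big_nil.
by rewrite big_cons ih /pull /=; case: (g i) => [j|] /=; rewrite ?big_cons ?add0r.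
Qed.

Lemma pmap_bwd_uniq (t : pinj) s : uniq s -> uniq (pmap (bwd t) s).
Proof.
elim: s => //= i s ih /andP[si us].
case e : (bwd t i) => [j|] /=; last exact: ih.
rewrite ih // andbT mem_pmap; apply/mapP => -[k ks /esym /pinjP h].
by move: e => /pinjP; rewrite h => -[ki]; rewrite -ki ks in si.
Qed.

Lemma has_sum_pull (t : pinj) (f : J -> R) l :
  (forall j, fwd t j = None -> f j = 0) -> has_sum f l ->
  has_sum (pull 0 (bwd t) f) l.
Proof.
move=> f0 h e /h[s0 hs]; exists (pmap (fwd t) s0) => s us sub.
rewrite sum_pull; set s1 := pmap _ s.
have us1 : uniq s1 by exact: pmap_bwd_uniq.
(* The part of [s0] not reached from [s] lies where [fwd] is undefined; it adds nothing to the sum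
   but makes the list contain [s0]. *)
pose s2 := [seq j <- undup s0 | j \notin s1].
have -> : \sum_(j <- s1) f j = \sum_(j <- s1 ++ s2) f j.
  rewrite big_cat /= [X in _ + X]big1_seq ?addr0 // => j /andP[_].
  rewrite mem_filter mem_undup => /andP[js1 js0]; apply: f0.
  case ej : (fwd t j) => [i|//]; case/negP: js1; rewrite mem_pmap.
  apply/mapP; exists i; last by apply/esym/pinjP.
  by apply: sub; rewrite mem_pmap; apply/mapP; exists j.
apply: hs => [|j js0].
  rewrite cat_uniq us1 filter_uniq ?undup_uniq // andbT /=.
  by apply/hasPn => j; rewrite mem_filter => /andP[].
by rewrite mem_cat mem_filter mem_undup js0 andbT orbN.
Qed.

Lemma shift_subproof (t : pinj) (u : hilb R J) :
  pull 0 (bwd t) u \in @sq_summable R J.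
Proof.
apply/asboolP; exists (sqnorm u) => s us.
rewrite (eq_bigr (pull 0 (bwd t) (fun j => sqabs (u j)))); last first.
  move=> i _; rewrite /pull; case: (bwd t i) => //=.
  by rewrite /sqabs /= expr0n addr0.
by rewrite sum_pull sum_le_sqnorm // pmap_bwd_uniq.
Qed.

Definition shift_fun (t : pinj) (u : hilb R J) : hilb R J :=
  Hilb (shift_subproof t u).

Lemma shift_fun_bound t : op_bound (shift_fun t) 1.
Proof.
move=> u; rewrite mul1r ler_wsqrtr //; apply: sqnorm_le => s us.
rewrite (eq_bigr (pull 0 (bwd t) (fun j => sqabs (u j)))); last first.
  move=> i _; rewrite /= /pull; case: (bwd t i) => //=.
  by rewrite /sqabs /= expr0n addr0.
by rewrite sum_pull sum_le_sqnorm // pmap_bwd_uniq.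
Qed.

Lemma shift_fun_adjoint t : adjoint (shift_fun t) (shift_fun (pinv t)).
Proof.
move=> u v; apply: dot_eq.
have [h1 h2] := dotP u (shift_fun (pinv t) v).
have step (g : R[i] -> R) l : g 0 = 0 ->
    has_sum (fun j => g (u j * (shift_fun (pinv t) v j)^*%C)) l ->
    has_sum (fun i => g (shift_fun t u i * (v i)^*%C)) l.
  move=> g0 h.
  have : has_sum (pull 0 (bwd t) (fun j => g (u j * (shift_fun (pinv t) v j)^*%C))) l.
    apply: has_sum_pull h => j ej; rewrite (_ : shift_fun _ v j = 0).
      by rewrite conjc0 mulr0.
    by rewrite /= /pull ej.
  congr has_sum; apply/funext => i; rewrite /= /pull.
  case e : (bwd t i) => [j|] /=; last by rewrite mul0r.
  by move/pinjP: e => ->.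
by split; apply: step.
Qed.

Lemma shift_adjointable t : shift_fun t \in @adjointable R J.
Proof.
apply/asboolP; exists (shift_fun (pinv t)), 1; split.
  exact: shift_fun_adjoint.
exact: shift_fun_bound.
Qed.

Definition shift t : bop R J := Bop (shift_adjointable t).

Lemma shiftE t u i : shift t u i = pull 0 (bwd t) u i.
Proof. by []. Qed.

Lemma shift_cadj t : cadj (shift t) = shift (pinv t).
Proof. by apply: bop_adj_eq; exact: shift_fun_adjoint. Qed.

Lemma ponly_subproof (P : pred J) i j :
  (if P i then Some i else None) = Some j <->
  (if P j then Some j else None) = Some i.
Proof. by split; case: ifP => // Pi [<-]; rewrite Pi. Qed.

Definition ponly (P : pred J) : pinj := Pinj (ponly_subproof P).

Lemma shift_only P u i : shift (ponly P) u i = if P i then u i else 0.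
Proof. by rewrite shiftE /pull /=; case: ifP. Qed.

Lemma only_projection P : projection (shift (ponly P)).
Proof.
split; first by rewrite shift_cadj; apply: bop_ext => u; apply: hilb_ext.
apply: bop_ext => u; apply: hilb_ext => i.
by rewrite [LHS](shift_only P (shift (ponly P) u)) !shift_only; case: (P i).
Qed.

Lemma shift_adj_mul t : cadj (shift t) ⋅ shift t = shift (ponly (fun j => fwd t j)).
Proof.
rewrite shift_cadj; apply: bop_ext => u; apply: hilb_ext => j.
rewrite shift_only [LHS](shiftE (pinv t) (shift t u)) /pull /=.
case e : (fwd t j) => [i|] //=; rewrite /pull.
by move/pinjP: e => ->.
Qed.

End PartialInjections.

Section PathRepresentation.
Variables (R : realType) (E : digraph).
Implicit Types (e f : edge E) (v w : vertex E).

(* [(l, v)] stands for the path with edges [l] and source [v]. Composability of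
   [l] is not required: the noncomposable lists span an invariant subspace on
   which the relations still hold. *)
Local Notation I := (seq (edge E) * vertex E)%type.
Local Notation J := (I * I)%type.
Local Notation H := (hilb R J).
Local Notation B := (bop R J).
Implicit Types (i k : I) (j : J) (u : H).

Definition lrng i : vertex E := if i.1 is e :: _ then rng e else i.2.

Definition lext e i : option I :=
  if src e == lrng i then Some (e :: i.1, i.2) else None.

(** Testing composability here keeps [ldel] inverse to [lext] on noncomposable lists too. *)
Definition ldel e i : option I :=
  if i.1 is f :: l then
    if (f == e) && (src e == lrng (l, i.2)) then Some (l, i.2) else None
  else None.

Lemma lext_del e i k : lext e i = Some k <-> ldel e k = Some i.
Proof.
case: i => l v; case: k => [[|f l'] w]; rewrite /lext /ldel /=.
  by split=> //; case: ifP.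
split; first by case: ifP => // h [<- <- <-]; rewrite eqxx h.
by case: ifP => // /andP[/eqP -> h] [<- <-]; rewrite h.
Qed.

Lemma ldel_src e i k : ldel e k = Some i -> lrng i == src e.
Proof. by move/lext_del; rewrite /lext eq_sym; case: ifP. Qed.

Lemma left_subproof e j j' :
  omap (fun i => (i, j.2)) (lext e j.1) = Some j' <->
  omap (fun i => (i, j'.2)) (ldel e j'.1) = Some j.
Proof.
case: j => i k; case: j' => i' k' /=; split.
  case h : (lext e i) => [i0|//] [<- <-].
  by move/lext_del: h => ->.
case h : (ldel e i') => [i0|//] [<- <-].
by move/lext_del: h => ->.
Qed.

Lemma right_subproof e j j' :
  omap (fun k => (j.1, k)) (lext e j.2) = Some j' <->
  omap (fun k => (j'.1, k)) (ldel e j'.2) = Some j.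
Proof.
case: j => i k; case: j' => i' k' /=; split.
  case h : (lext e k) => [k0|//] [<- <-].
  by move/lext_del: h => ->.
case h : (ldel e k') => [k0|//] [<- <-].
by move/lext_del: h => ->.
Qed.

Definition rep_s e : B := shift R (Pinj (left_subproof e)).
Definition rep_p v : B := shift R (ponly (fun j : J => lrng j.1 == v)).
(** The shifts of the second path commute with the representation; they carry letters from one side
    of a functional to the other. *)
Definition right_s e : B := shift R (Pinj (right_subproof e)).
Definition right_p v : B := shift R (ponly (fun j : J => lrng j.2 == v)).

Lemma rep_sE e u i k :
  rep_s e u (i, k) = oapp (fun i' => u (i', k)) 0 (ldel e i).
Proof. by rewrite /rep_s shiftE /pull /=; case: (ldel e i). Qed.

Lemma rep_s_adjE e u i k :
  cadj (rep_s e) u (i, k) = oapp (fun i' => u (i', k)) 0 (lext e i).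
Proof. by rewrite /rep_s shift_cadj shiftE /pull /=; case: (lext e i). Qed.

Lemma right_sE e u i k :
  right_s e u (i, k) = oapp (fun k' => u (i, k')) 0 (ldel e k).
Proof. by rewrite /right_s shiftE /pull /=; case: (ldel e k). Qed.

Lemma right_s_adjE e u i k :
  cadj (right_s e) u (i, k) = oapp (fun k' => u (i, k')) 0 (lext e k).
Proof. by rewrite /right_s shift_cadj shiftE /pull /=; case: (lext e k). Qed.

Lemma rep_pE v u i k : rep_p v u (i, k) = if lrng i == v then u (i, k) else 0.
Proof. exact: shift_only. Qed.

Lemma right_pE v u i k : right_p v u (i, k) = if lrng k == v then u (i, k) else 0.
Proof. exact: shift_only. Qed.

Lemma bop_mulE (S T : B) u : (S ⋅ T) u = S (T u).
Proof. by []. Qed.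

Lemma bop_sumE (K : finType) (P : pred K) (F : K -> B) u j :
  (\sum_(x | P x) F x) u j = \sum_(x | P x) F x u j.
Proof.
by elim/big_rec2: _ => // x y T _ <-.
Qed.

Lemma hilb_ext2 u (u' : H) : (forall i k, u (i, k) = u' (i, k)) -> u = u'.
Proof. by move=> h; apply: hilb_ext => -[i k]. Qed.

Lemma rep_s_iso e : cadj (rep_s e) ⋅ rep_s e = rep_p (src e).
Proof.
rewrite /rep_s shift_adj_mul; congr (shift R (ponly _)); apply/funext => -[i k] /=.
by rewrite /lext eq_sym; case: ifP.
Qed.

Lemma rep_TCK : TCK_family rep_p rep_s.
Proof.
split.
- by move=> v; exact: only_projection.
- move=> v w vw; apply: bop_ext => u; apply: hilb_ext2 => i k.
  rewrite bop_mulE !rep_pE hfun0; case: eqP => // ->.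
  by rewrite (negbTE vw).
- move=> e; rewrite /partial_isometry -cmulA rep_s_iso.
  apply: bop_ext => u; apply: hilb_ext2 => i k; rewrite bop_mulE !rep_sE.
  case h : (ldel e i) => [i'|//].
  have : rep_p (src e) u (i', k) = u (i', k) by rewrite rep_pE (ldel_src h).
  exact.
- exact: rep_s_iso.
move=> v F rF.
(* [Q] projects onto the pairs whose first path has range [v] and no removable leading edge in [F]:
   exactly what the ranges of the [s_e] leave of [p v]. *)
pose Q := shift R (ponly (fun j : J => (lrng j.1 == v) &&
  ~~ [exists e in F, isSome (ldel e j.1)])).
have [Qadj Qidem] : projection Q by exact: only_projection.
exists Q; rewrite Qadj Qidem; apply: bop_ext => u; apply: hilb_ext2 => i k.
rewrite bopDE bopNE hfunD hfunN rep_pE bop_sumE shift_only -[(i, k).1]/i.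
have ss e : (rep_s e ⋅ cadj (rep_s e)) u (i, k) =
    if isSome (ldel e i) then u (i, k) else 0.
  rewrite bop_mulE rep_sE; case h : (ldel e i) => [i'|] //=.
  by rewrite rep_s_adjE; move/lext_del: h => ->.
(* Only the leading edge of [i] can be removed, so at most one summand is nonzero, and then the
   range of [i] is [v]. *)
case: (boolP [exists e in F, isSome (ldel e i)]) => [/existsP[e /andP[eF ei]]|].
  rewrite andbF (bigD1 e) // ss ei big1 ?addr0 => [|f /andP[fF fe]].
    move: ei; rewrite /ldel /lrng; case: (i.1) => // f l.
    case: ifP => // /andP[/eqP -> _] _; rewrite rF // eqxx.
    by apply/eqP; rewrite subr_eq0 eq_sym; apply/eqP; exact: addr0.
  rewrite ss; move: ei fe; rewrite /ldel; case: (i.1) => // g l.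
  case: ifP => // /andP[/eqP -> _] _ fe; rewrite eq_sym.
  by rewrite (negbTE fe).
rewrite negb_exists => /forallP h; rewrite andbT big1 ?subr0 // => e eF.
by rewrite ss; have := h e; rewrite eF /= => /negbTE ->.
Qed.

Lemma commute_s_right e f : rep_s e ⋅ right_s f = right_s f ⋅ rep_s e.
Proof.
apply: bop_ext => u; apply: hilb_ext2 => i k.
rewrite !bop_mulE /rep_s /right_s !shiftE /pull /=.
by case hi : (ldel e i) => [i'|]; case hk : (ldel f k) => [k'|];
  rewrite /= /pull /= ?hi ?hk.
Qed.

Lemma commute_adj_right e f :
  cadj (rep_s e) ⋅ right_s f = right_s f ⋅ cadj (rep_s e).
Proof.
apply: bop_ext => u; apply: hilb_ext2 => i k.
rewrite !bop_mulE /rep_s /right_s shift_cadj !shiftE /pull /=.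
by case hi : (lext e i) => [i'|]; case hk : (ldel f k) => [k'|];
  rewrite /= /pull /= ?hi ?hk.
Qed.

Lemma commute_p_right v f : rep_p v ⋅ right_s f = right_s f ⋅ rep_p v.
Proof.
apply: bop_ext => u; apply: hilb_ext2 => i k.
rewrite !bop_mulE /rep_p /right_s !shiftE /pull /=.
by case hi : (lrng i == v); case hk : (ldel f k) => [k'|];
  rewrite /= /pull /= ?hi ?hk.
Qed.

Lemma commute_s_rightp e v : rep_s e ⋅ right_p v = right_p v ⋅ rep_s e.
Proof.
apply: bop_ext => u; apply: hilb_ext2 => i k.
rewrite !bop_mulE /rep_s /right_p !shiftE /pull /=.
by case hi : (ldel e i) => [i'|]; case hk : (lrng k == v);
  rewrite /= /pull /= ?hi ?hk.
Qed.

Lemma commute_p_rightp v w : rep_p v ⋅ right_p w = right_p w ⋅ rep_p v.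
Proof.
apply: bop_ext => u; apply: hilb_ext2 => i k.
rewrite !bop_mulE /rep_p /right_p !shiftE /pull /=.
by case hi : (lrng i == v); case hk : (lrng k == w);
  rewrite /= /pull /= ?hi ?hk.
Qed.

End PathRepresentation.

(** * Square roots of the Gibbs densities *)

Section DiagonalVectors.
Variables (R : realType) (E : digraph).
Local Notation I := (seq (edge E) * vertex E)%type.
Local Notation J := (I * I)%type.
Local Notation H := (hilb R J).
Implicit Types (e f : edge E) (v w : vertex E) (i k : I) (eps : {ffun vertex E -> R}).

Definition diag_fun (q : R) eps (j : J) : R[i] :=
  if j.1 == j.2 then (q ^+ size j.1.1 * Num.sqrt (eps j.1.2))%:C else 0.

(** Outside [#|edge E| * q ^+ 2 < 1] the family may fail to be square-summable, and the default [0]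
    keeps the definition total. *)
Definition diag_vec (q : R) eps : H := insubd 0 (diag_fun q eps).

Fixpoint lists_upto n : seq (seq (edge E)) :=
  if n is n'.+1 then
    [::] :: [seq e :: l | e <- enum (edge E), l <- lists_upto n']
  else [:: [::]].

Lemma mem_lists_upto n (l : seq (edge E)) : (size l <= n)%N -> l \in lists_upto n.
Proof.
elim: n l => [|n ih] [|e l] //= ln; rewrite inE /=.
by apply/allpairsP; exists (e, l); rewrite mem_enum ih.
Qed.

(** The sums satisfy [S_(n+1) = 1 + N r S_n] with [N] the number of edges, and the bound is the
    fixed point of this recursion. *)
Lemma sum_lists_upto (r : R) n : 0 <= r -> #|edge E|%:R * r < 1 ->
  \sum_(l <- lists_upto n) r ^+ size l <= (1 - #|edge E|%:R * r)^-1.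
Proof.
move=> r0 r1; set N : R := #|edge E|%:R in r1 *.
have d0 : 0 < 1 - N * r by lra.
elim: n => [|n ih] /=.
  rewrite big_seq1 expr0 invf_ge1 //; have : 0 <= N * r by rewrite mulr_ge0.
  lra.
rewrite big_cons expr0 big_allpairs_dep /=.
rewrite (eq_bigr (fun=> r * \sum_(l <- lists_upto n) r ^+ size l)); last first.
  by move=> e _; rewrite mulr_sumr; apply: eq_bigr => l _; rewrite exprS.
rewrite big_enum /= sumr_const -mulr_natl mulrA.
apply: (@le_trans _ _ (1 + N * r * (1 - N * r)^-1)).
  by rewrite lerD2l ler_wpM2l // mulr_ge0.
rewrite le_eqVlt; apply/orP; left; apply/eqP; field.
by rewrite gt_eqF.
Qed.

Variables (eps : {ffun vertex E -> R}) (heps : prob_simplex eps).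

Let eps0 v : 0 <= eps v. Proof. by have [h _] := heps. Qed.
Let eps1 : \sum_v eps v = 1. Proof. by have [_ h] := heps. Qed.

Section Weight.
Variable q : R.
Hypothesis q1 : #|edge E|%:R * q ^+ 2 < 1.

Lemma sqabs_diag_fun j : sqabs (diag_fun q eps j) =
  if j.1 == j.2 then (q ^+ 2) ^+ size j.1.1 * eps j.1.2 else 0.
Proof.
rewrite /diag_fun; case: ifP => _; rewrite /sqabs /= expr0n addr0.
  by rewrite exprMn sqr_sqrtr // -!exprM mulnC.
by [].
Qed.

Lemma diag_fun_bound (s : seq J) : uniq s ->
  \sum_(j <- s) sqabs (diag_fun q eps j) <= (1 - #|edge E|%:R * q ^+ 2)^-1.
Proof.
move=> us; pose n := \max_(j <- s) size j.1.1.
pose g (x : seq (edge E) * vertex E) : J := (x, x).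
pose s' := [seq g (l, v) | l <- lists_upto n, v <- enum (vertex E)].
have le : \sum_(j <- [seq j <- s | j.1 == j.2]) sqabs (diag_fun q eps j) <=
    \sum_(j <- s') sqabs (diag_fun q eps j).
  apply: ler_sum_uniq => [j||j]; first exact: sqabs_ge0.
    exact: filter_uniq.
  rewrite mem_filter => /andP[/eqP ej js]; apply/allpairsP; exists j.1 => /=.
  split; last by rewrite /g -surjective_pairing {2}ej -surjective_pairing.
    by apply: mem_lists_upto; rewrite /n; exact: (leq_bigmax_seq (F := fun j : J => size j.1.1) j).
  by rewrite mem_enum.
rewrite (bigID (fun j : J => j.1 == j.2)) /= [X in _ + X]big1 ?addr0; last first.
  by move=> j /negbTE jj; rewrite sqabs_diag_fun jj.
rewrite -big_filter; apply: le_trans le _; rewrite big_allpairs_dep.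
rewrite (eq_bigr (fun l => (q ^+ 2) ^+ size l)); last first.
  move=> l _; rewrite (eq_bigr (fun v => (q ^+ 2) ^+ size l * eps v)).
    by rewrite -mulr_sumr big_enum eps1 mulr1.
  by move=> v _; rewrite sqabs_diag_fun eqxx.
by apply: sum_lists_upto => //; exact: sqr_ge0.
Qed.

Lemma diag_fun_l2 : diag_fun q eps \in @sq_summable R J.
Proof. by apply/asboolP; eexists; exact: diag_fun_bound. Qed.

Lemma diag_vecE j : diag_vec q eps j = diag_fun q eps j.
Proof. by rewrite /diag_vec -[LHS]/(val _ j) insubdK // diag_fun_l2. Qed.

Lemma sqnorm_diag_le : sqnorm (diag_vec q eps) <= (1 - #|edge E|%:R * q ^+ 2)^-1.
Proof.
apply: sqnorm_le => s us; under eq_bigr do rewrite diag_vecE.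
exact: diag_fun_bound.
Qed.

Lemma diag_rep_p v : rep_p R v (diag_vec q eps) = right_p R v (diag_vec q eps).
Proof.
apply: hilb_ext2 => i k; rewrite rep_pE right_pE diag_vecE /diag_fun /=.
by case: (eqVneq i k) => [->//|_]; do 2 case: ifP.
Qed.

(** Both sides live on pairs [(e k, k)]. The left one reads the entry at [(e k, e k)], the right one
    that at [(k, k)], one power of [q] apart. *)
Lemma diag_right_s e :
  cadj (right_s R e) (diag_vec q eps) = q%:C *: rep_s R e (diag_vec q eps).
Proof.
apply: hilb_ext2 => i k; rewrite hfunZ right_s_adjE rep_sE.
case hk : (lext e k) => [k'|] /=; case hi : (ldel e i) => [i'|] /=; rewrite ?mulr0 //.
- rewrite !diag_vecE /diag_fun /=.
  have -> : (i == k') = (i' == k).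
    apply/eqP/eqP => [ik|ik]; last first.
      by move/lext_del: hi; rewrite ik hk => -[].
    by move: hi; rewrite ik; move/lext_del: hk => -> [].
  case: eqP => [ik|_]; rewrite ?mulr0 //.
  move/lext_del: hi; rewrite /lext; case: ifP => // _ [<-] /=.
  by rewrite exprS -rmorphM mulrA.
- rewrite diag_vecE /diag_fun /=; case: eqP => // ik.
  by move/lext_del: hk; rewrite -ik hi.
- rewrite diag_vecE /diag_fun /=; case: eqP => [ik|]; rewrite ?mulr0 //.
  by move/lext_del: hi; rewrite ik hk.
Qed.

(** The mirror image of [diag_right_s]: a diagonal vector is symmetric in the two paths. *)
Lemma diag_rep_s e :
  cadj (rep_s R e) (diag_vec q eps) = q%:C *: right_s R e (diag_vec q eps).
Proof.
have sym i k : diag_vec q eps (i, k) = diag_vec q eps (k, i).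
  by rewrite !diag_vecE /diag_fun /= eq_sym; case: eqP => // ->.
apply: hilb_ext2 => i k; have := congr1 (fun u : H => u (k, i)) (diag_right_s e).
rewrite !hfunZ right_s_adjE rep_sE rep_s_adjE right_sE.
have -> : (fun k' => diag_vec q eps (k, k')) = (fun i' => diag_vec q eps (i', k)).
  exact/funext.
have -> : (fun i' => diag_vec q eps (i', i)) = (fun k' => diag_vec q eps (i, k')).
  exact/funext.
by [].
Qed.

End Weight.

End DiagonalVectors.

Lemma star_hom_comp (R : realType) (A B C : cstarAlgType R) (f : A -> B)
  (g : B -> C) : star_hom f -> star_hom g -> star_hom (g \o f).
Proof.
move=> [l1 m1 a1] [l2 m2 a2]; split=> [c x y|x y|x] /=.
- by rewrite l1 l2.
- by rewrite m1 m2.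
- by rewrite a1 a2.
Qed.

(** * Contractivity of representations and vector functionals *)

Section VectorFunctionals.
Variables (R : realType) (J : choiceType) (A : cstarAlgType R).
Local Notation H := (hilb R J).
Local Notation B := (bop R J).
Variables (pi : A -> B) (hpi : star_hom pi).
Implicit Types (a b h k : A) (u v : H).

Lemma star_homD a b : pi (a + b) = pi a + pi b.
Proof. by have [h _ _] := hpi; have := h 1 a b; rewrite !scale1r. Qed.

Lemma star_hom0 : pi 0 = 0.
Proof. by apply: (addrI (pi 0)); rewrite -star_homD !addr0. Qed.

Lemma star_homZ c a : pi (c *: a) = c *: pi a.
Proof. by have [h _ _] := hpi; have := h c a 0; rewrite star_hom0 !addr0. Qed.

Lemma star_homB a b : pi (a - b) = pi a - pi b.
Proof. by rewrite star_homD -scaleN1r star_homZ scaleN1r. Qed.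

Lemma star_homM a b u : pi (a ⋅ b) u = pi a (pi b u).
Proof. by have [_ h _] := hpi; rewrite h. Qed.

Lemma star_hom_adj a u v : dot (pi a u) v = dot u (pi (cadj a) v).
Proof. by have [_ _ h] := hpi; rewrite h -bop_adjP. Qed.

(** With [h = 2k - k^2] the difference of the two sides is [|u - pi(k) u|^2]. *)
Lemma star_hom_le1 h u : cadj h = h -> nrm h < 1 ->
  complex.Re (dot (pi h u) u) <= sqnorm u.
Proof.
move=> hh /(cstar_sqrt hh)[k kk <-].
have := sqnorm_ge0 (u - pi k u); rewrite {1}/sqnorm.
rewrite dotDl !dotDr !dotNl !dotNr opprK dotvv star_homB star_homD.
have -> : dot u (pi k u) = dot (pi k u) u by rewrite star_hom_adj kk.
have -> : dot (pi k u) (pi k u) = dot (pi (k ⋅ k) u) u.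
  by rewrite star_homM [RHS]star_hom_adj kk.
rewrite bopDE bopNE bopDE !dotDl dotNl !raddfD !raddfN /= => h0.
by rewrite -subr_ge0; apply: le_trans h0 _; rewrite le_eqVlt; apply/orP; left;
  apply/eqP; ring.
Qed.

Lemma star_hom_contractive a u : hnorm (pi a u) <= nrm a * hnorm u.
Proof.
rewrite -(@ler_pXn2r _ 2) ?nnegrE ?mulr_ge0 ?hnorm_ge0 ?nrm_ge0 //.
rewrite exprMn !hnorm_sq; apply/ler_addgt0Pr => d d0.
have u1 : 0 < sqnorm u + 1 by rewrite ltr_wpDl ?sqnorm_ge0.
(* Dividing [a^* a] by slightly more than its norm meets the strict hypothesis of [star_hom_le1];
   the excess costs less than [d] after multiplication by [sqnorm u]. *)
set c := nrm a ^+ 2 + d / (sqnorm u + 1).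
have dp : 0 < d / (sqnorm u + 1) by exact: divr_gt0.
have c0 : 0 < c by rewrite ltr_wpDl ?exprn_ge0 ?nrm_ge0.
have hadj : cadj ((c^-1)%:C *: (cadj a ⋅ a)) = (c^-1)%:C *: (cadj a ⋅ a).
  rewrite cadjZ cadjM cadjK; congr (_ *: _).
  by apply: complex_ext => //=; rewrite oppr0.
have hlt : nrm ((c^-1)%:C *: (cadj a ⋅ a)) < 1.
  rewrite nrmZ cabs_real ger0_norm ?invr_ge0 ?ltW // nrm_cstar.
  by rewrite mulrC ltr_pdivrMr // mul1r /c ltrDl.
have := star_hom_le1 u hadj hlt; rewrite star_homZ bopZE dotZl.
rewrite star_homM star_hom_adj cadjK dotvv -rmorphM /= mulrC => hle.
rewrite ler_pdivrMr // in hle.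
have -> : nrm a ^+ 2 * sqnorm u + d = c * sqnorm u + d / (sqnorm u + 1).
  by rewrite /c; field; rewrite gt_eqF.
apply: le_trans (_ : c * sqnorm u <= _); last by rewrite lerDl ltW.
by rewrite mulrC.
Qed.

Lemma star_hom_opnorm a : opnorm (pi a) <= nrm a.
Proof. by apply: opnorm_le; [exact: nrm_ge0|exact: star_hom_contractive]. Qed.

Definition vector_functional u a : R[i] := dot (pi a u) u.

Lemma vector_functional_positive u : positive_functional (vector_functional u).
Proof.
split=> [c a b|a].
  by rewrite /vector_functional star_homD star_homZ bopDE bopZE dotDl dotZl.
by rewrite /vector_functional star_homM star_hom_adj cadjK dotvv lecR sqnorm_ge0.
Qed.

Lemma vector_functional_le u a : cabs (vector_functional u a) <= sqnorm u * nrm a.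
Proof.
apply: le_trans (dot_le _ _) _; rewrite -hnorm_sq expr2 mulrC -mulrA.
by rewrite ler_wpM2l ?hnorm_ge0 // mulrC star_hom_contractive.
Qed.

Lemma vector_functional_bounded u : bounded_functional (vector_functional u).
Proof. by exists (sqnorm u) => a; exact: vector_functional_le. Qed.

(** The element [a0] of the unit ball attains the value 1 and so certifies that the norm is not
    smaller. *)
Lemma vector_functional_state u a0 : sqnorm u = 1 -> nrm a0 <= 1 ->
  vector_functional u a0 = 1 -> is_state (vector_functional u).
Proof.
move=> u1 a01 ha0; have [lin pos] := vector_functional_positive u.
split=> // [a|M hM].
  by rewrite normc_sqabs nrmE lecR -[nrm a]mul1r -u1 vector_functional_le.
have := hM a0; rewrite ha0 normr1 nrmE -rmorphM /= -[1]/(1%:C) lecR => h1.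
have M0 : 0 <= M.
  rewrite leNgt; apply/negP => Mlt; have := nrm_ge0 a0 => n0.
  by have : M * nrm a0 <= 0 by [rewrite nmulr_rle0]; lra.
by apply: le_trans h1 _; rewrite ler_piMr.
Qed.

Lemma vector_functional_close u v a : hnorm u = 1 -> hnorm v = 1 ->
  cabs (vector_functional u a - vector_functional v a) <=
    2 * nrm a * hnorm (u - v).
Proof.
move=> u1 v1; rewrite /vector_functional.
have -> : dot (pi a u) u - dot (pi a v) v =
    dot (pi a (u - v)) u + dot (pi a v) (u - v).
  by rewrite bopD bopN dotDl dotNl dotDr dotNr; ring.
apply: le_trans (cabsD _ _) _; apply: le_trans (lerD (dot_le _ _) (dot_le _ _)) _.
rewrite u1 mulr1; have h1 := star_hom_contractive a (u - v).
have h2 := ler_wpM2r (hnorm_ge0 (u - v)) (star_hom_contractive a v).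
rewrite v1 mulr1 in h2; lra.
Qed.

End VectorFunctionals.

(** * KMS and ground states *)

Section EntireFunctions.
Variables (R : realType) (A : cstarAlgType R).
Implicit Types (a b : A) (t : R) (c d : R[i]).

Lemma cexpD c d : cexp (c + d) = cexp c * cexp d.
Proof.
case: c => a b; case: d => a' b'; rewrite /cexp /= expRD cosD sinD.
by apply: complex_ext => /=; ring.
Qed.

Lemma cexp_real t : cexp t%:C = (expR t)%:C.
Proof.
by rewrite /cexp /= cos0 sin0; apply: complex_ext => /=; ring.
Qed.

Lemma cexp_imag t : cexp ('i%C * t%:C) = cos t +i* sin t.
Proof.
rewrite /cexp (_ : 'i%C * t%:C = 0 +i* t) /=; last first.
  by apply: complex_ext => /=; ring.
by rewrite expR0 mul1r.
Qed.

Lemma cexpN c : cexp c * cexp (- c) = 1.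
Proof. by rewrite -cexpD subrr cexp_real expR0. Qed.

Lemma functional_cvg (psi : A -> R[i]) (u : nat -> A) x :
  (forall a b, psi (a - b) = psi a - psi b) -> bounded_functional psi ->
  u @ \oo --> x -> (fun n => psi (u n) : R[i]^o) @ \oo --> (psi x : R[i]^o).
Proof.
move=> psiB [M hM] /cvg_seqP h; apply/cvg_complexP => e e0.
have M0 : 0 < `|M| + 1 by rewrite ltr_wpDl.
have [N hN] := h _ (divr_gt0 e0 M0); exists N => n /hN.
rewrite ltr_pdivlMr // => hlt; rewrite -psiB; apply: le_lt_trans hlt.
apply: le_trans (hM _) _; rewrite mulrC ler_wpM2l ?nrm_ge0 //.
by apply: le_trans (ler_norm _) _; rewrite lerDl.
Qed.

Lemma cvg_exp_series c d z :
  (series (fun n => z ^+ n * ((n`!%:R)^-1 * c ^+ n * d)) : nat -> R[i]^o)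
    @ \oo --> (cexp (z * c) * d : R[i]^o).
Proof.
have -> : series (fun n => z ^+ n * ((n`!%:R)^-1 * c ^+ n * d)) =
    fun n => series (exp_term (z * c)) n * d.
  apply/funext => n; rewrite /series /= mulr_suml; apply: eq_bigr => k _.
  by rewrite /exp_term exprMn; ring.
by apply: cvgM; [exact: cvg_cexp|exact: cvg_cst].
Qed.

(* An entire extension is determined by its values on the real line. *)
Lemma entire_exp (psi : A -> R[i]) (f : R[i] -> A) c d :
  scalar psi -> bounded_functional psi -> entire f ->
  (forall t, psi (f t%:C) = cexp (t%:C * c) * d) ->
  forall z, psi (f z) = cexp (z * c) * d.
Proof.
move=> lpsi bpsi [cf hf] hR z.
have psi0 : psi 0 = 0.
  by have := lpsi (-1) 0 0; rewrite scaler0 addr0 mulN1r addNr.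
have psiD a b : psi (a + b) = psi a + psi b.
  by have := lpsi 1 a b; rewrite scale1r mul1r.
have psiZ x a : psi (x *: a) = x * psi a.
  by have := lpsi x a 0; rewrite psi0 !addr0.
have psiB a b : psi (a - b) = psi a - psi b.
  by rewrite -scaleN1r psiD psiZ mulN1r.
have hpsi x : (series (fun n => x ^+ n * psi (cf n)) : nat -> R[i]^o) @ \oo
    --> (psi (f x) : R[i]^o).
  rewrite (_ : series _ = fun n => psi (series (fun k => x ^+ k *: cf k) n)).
    exact: functional_cvg (hf x).
  apply/funext => n; rewrite /series /= (big_morph psi psiD psi0).
  by apply: eq_bigr => k _; rewrite psiZ.
have eqc : (fun n => psi (cf n)) = (fun n => (n`!%:R)^-1 * c ^+ n * d).
  apply: (@power_series_unique _ _ _ (fun t => psi (f t%:C))) => t.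
    exact: hpsi.
  by rewrite hR; exact: cvg_exp_series.
have := hpsi z; rewrite (_ : (fun n => z ^+ n * psi (cf n)) =
  fun n => z ^+ n * ((n`!%:R)^-1 * c ^+ n * d)); last first.
  by apply/funext => n; rewrite (congr1 (fun g => g n) eqc).
move=> h; apply: (@cvg_unique _ (@norm_hausdorff _ R[i]^o) _ _ _ _ h).
exact: cvg_exp_series.
Qed.

Lemma exp_extension (alpha : R -> A -> A) (b : A) c :
  (forall t, alpha t b = cexp (t%:C * c) *: b) ->
  analytic_extension alpha b (fun z => cexp (z * c) *: b).
Proof.
move=> hb; split; last by move=> t; rewrite hb.
exists (fun n => ((n`!%:R)^-1 * c ^+ n) *: b) => z.
have -> : series (fun n => z ^+ n *: (((n`!%:R)^-1 * c ^+ n) *: b)) =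
    fun n => series (exp_term (z * c)) n *: b.
  apply/funext => n; rewrite /series /= scaler_suml; apply: eq_bigr => k _.
  by rewrite scalerA /exp_term exprMn mulrCA.
apply/cvg_seqP => e e0; have b1 : 0 < nrm b + 1 by rewrite ltr_wpDl ?nrm_ge0.
have [N hN] := (cvg_complexP _ _).1 (@cvg_cexp _ (z * c)) _ (divr_gt0 e0 b1).
exists N => n /hN hlt; rewrite -scalerBl nrmZ.
rewrite ltr_pdivlMr // in hlt; apply: le_lt_trans hlt.
by rewrite ler_wpM2l ?cabs_ge0 // lerDl.
Qed.

End EntireFunctions.

Section GaugeDynamics.
Variables (R : realType) (E : digraph) (A : cstarAlgType R).
Variables (p : vertex E -> A) (s : edge E -> A) (gamma : R[i] -> A -> A).
Hypothesis TCK : TCK_family p s.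
Hypothesis gen : cstar_generated_by (range p `|` range s).
Hypothesis hgamma : is_gauge_action p s gamma.
Implicit Types (a b x y : A) (e f : edge E) (v w : vertex E) (k l : int) (t : R).
Local Notation alpha := (gauge_dynamics gamma).

Lemma circle_norm1 t : `|cos t +i* sin t| = 1 :> R[i].
Proof. by rewrite normc_sqabs /sqabs /= cos2Dsin2 sqrtr1. Qed.

Lemma dynamics_star_hom t : star_hom (alpha t).
Proof. by have [h _ _ _ _] := hgamma; exact/h/circle_norm1. Qed.

Lemma dynamicsM t a b : alpha t (a ⋅ b) = alpha t a ⋅ alpha t b.
Proof. by have [_ h _] := dynamics_star_hom t. Qed.

(** [cexp (z * freq k)] is the factor [e^(ikz)] by which the dynamics at time [z] scale a word of
    degree [k]. *)
Definition freq k : R[i] := 'i%C * k%:~R.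

Lemma freqD k l : freq (k + l) = freq k + freq l.
Proof. by rewrite /freq rmorphD mulrDr. Qed.

Lemma dynamics_letter t k a : letter p s k a ->
  alpha t a = cexp (t%:C * freq k) *: a.
Proof.
have [_ _ _ gp gs] := hgamma; have [_ _ hadj] := dynamics_star_hom t.
have e1 : cexp (t%:C * freq 1) = cos t +i* sin t.
  by rewrite /freq mulr1 mulrC cexp_imag.
case=> [v|e|e].
- by rewrite /freq mulr0 mulr0 cexp_real expR0 scale1r; exact/gp/circle_norm1.
- by rewrite e1; exact/gs/circle_norm1.
rewrite hadj /gauge_dynamics gs ?circle_norm1 // cadjZ; congr (_ *: _).
rewrite /freq rmorphN1 mulrN1 mulrN mulrC -mulrN -rmorphN cexp_imag cosN sinN.
by [].
Qed.

Lemma dynamics_word t k a : word p s k a -> alpha t a = cexp (t%:C * freq k) *: a.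
Proof.
elim=> [{}k {}a /dynamics_letter//|{}k l {}a b la _ ih].
rewrite dynamicsM ih (dynamics_letter t la) cmulZl cmulZr scalerA.
by rewrite freqD mulrDr cexpD.
Qed.

End GaugeDynamics.

(** * KMS condition from intertwining with the commutant *)

Section GibbsStates.
Variables (R : realType) (E : digraph) (A : cstarAlgType R).
Variables (p : vertex E -> A) (s : edge E -> A) (gamma : R[i] -> A -> A).
Hypothesis TCK : TCK_family p s.
Hypothesis gen : cstar_generated_by (range p `|` range s).
Hypothesis hgamma : is_gauge_action p s gamma.
Local Notation I := (seq (edge E) * vertex E)%type.
Local Notation J := (I * I)%type.
Local Notation H := (hilb R J).
Local Notation B := (bop R J).
Local Notation alpha := (gauge_dynamics gamma).
Variables (pi : A -> B) (hpi : star_hom pi).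
Hypotheses (pi_p : forall v, pi (p v) = rep_p R v).
Hypotheses (pi_s : forall e, pi (s e) = rep_s R e).
Implicit Types (a b x y : A) (e f : edge E) (v w : vertex E) (k l : int) (t : R).

Lemma dot_cadj (T : B) (u v : H) : dot (cadj T u) v = dot u (T v).
Proof. exact: bop_adjP'. Qed.

Lemma dot_cadjr (T : B) (u v : H) : dot (T u) v = dot u (cadj T v).
Proof. exact: bop_adjP. Qed.

(** The commutator with [T] is linear in [a] and bounded by [2 |T| |a|], so letters suffice; the
    adjoint letters are listed separately because [T] need not be self-adjoint. *)
Lemma commutant (T : B) :
  (forall v, rep_p R v ⋅ T = T ⋅ rep_p R v) ->
  (forall e, rep_s R e ⋅ T = T ⋅ rep_s R e) ->
  (forall e, cadj (rep_s R e) ⋅ T = T ⋅ cadj (rep_s R e)) ->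
  forall a, pi a ⋅ T = T ⋅ pi a.
Proof.
move=> hp hs hadj; have [_ piM piadj] := hpi.
suff H a : pi a ⋅ T - T ⋅ pi a = 0.
  by move=> a; apply/eqP; rewrite -subr_eq0 H.
apply: (@words_dense _ _ _ _ _ TCK gen [set a | pi a ⋅ T - T ⋅ pi a = 0]).
  apply: (@closed_linear_preimage R A B (fun a => pi a ⋅ T - T ⋅ pi a)
    (2 * nrm T)) (@closed_linear0 R B).
    move=> c x y; rewrite (star_homD hpi) (star_homZ hpi) cmulDl cmulDr cmulZl cmulZr.
    by rewrite scalerBr opprD addrACA.
  move=> x; apply: le_trans (nrmD _ _) _; rewrite nrmN.
  have h1 := nrm_cmul (pi x) T; have h2 := nrm_cmul T (pi x).
  have h3 := ler_wpM2r (nrm_ge0 T) (star_hom_opnorm hpi x).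
  apply: le_trans (lerD h1 h2) _; rewrite [X in _ + X]mulrC -mulr2n -[X in X <= _]mulr_natl.
  by rewrite -mulrA ler_wpM2l // [X in _ <= X]mulrC.
have hl k x : letter p s k x -> pi x ⋅ T = T ⋅ pi x.
  by case=> [v|e|e]; rewrite ?piadj ?pi_p ?pi_s.
move=> k x wx /=; apply/eqP; rewrite subr_eq0; apply/eqP.
elim: wx => [{}k {}x /hl//|{}k l {}x y /hl hx _ ih].
by rewrite piM -cmulA ih !cmulA hx.
Qed.

Lemma commute_right_s a e : pi a ⋅ right_s R e = right_s R e ⋅ pi a.
Proof.
apply: commutant => [v|f|f]; [exact: commute_p_right|exact: commute_s_right|].
exact: commute_adj_right.
Qed.

Lemma commute_right_s_adj a e :
  pi a ⋅ cadj (right_s R e) = cadj (right_s R e) ⋅ pi a.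
Proof.
have [_ _ piadj] := hpi; have := congr1 cadj (commute_right_s (cadj a) e).
by rewrite !cadjM piadj cadjK.
Qed.

Lemma right_p_adj v : cadj (right_p R v) = right_p R v :> B.
Proof. by have [] := @only_projection R J (fun j : J => lrng j.2 == v). Qed.

Lemma rep_p_adj v : cadj (rep_p R v) = rep_p R v :> B.
Proof. by have [] := @only_projection R J (fun j : J => lrng j.1 == v). Qed.

Lemma commute_right_p a v : pi a ⋅ right_p R v = right_p R v ⋅ pi a.
Proof.
apply: commutant => [w|f|f]; [exact: commute_p_rightp|exact: commute_s_rightp|].
have := congr1 cadj (@commute_s_rightp R E f v).
by rewrite !cadjM right_p_adj.
Qed.

Lemma pi_vertex_sum (u : H) : pi (vertex_sum p) u = u.
Proof.
rewrite /vertex_sum (big_morph pi (star_homD hpi) (star_hom0 hpi)).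
apply: hilb_ext2 => i k; rewrite bop_sumE (bigD1 (lrng i)) //= pi_p rep_pE eqxx.
rewrite big1 ?addr0 // => v vi.
by rewrite pi_p rep_pE eq_sym (negbTE vi).
Qed.

Variables (u : H) (q : R).
Hypothesis u_p : forall v, rep_p R v u = right_p R v u.
Hypothesis u_right : forall e, cadj (right_s R e) u = q%:C *: rep_s R e u.
Hypothesis u_rep : forall e, cadj (rep_s R e) u = q%:C *: right_s R e u.
Local Notation phi := (vector_functional pi u).

Lemma conjc_q : (q%:C)^*%C = q%:C.
Proof. by apply: complex_ext => //=; rewrite oppr0. Qed.

Lemma swap_p a v : phi (a ⋅ p v) = phi (p v ⋅ a).
Proof.
rewrite /vector_functional !(star_homM hpi) !pi_p u_p.
rewrite -[pi a (right_p R v u)]/((pi a ⋅ right_p R v) u) commute_right_p bop_mulE.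
by rewrite !dot_cadjr right_p_adj rep_p_adj u_p.
Qed.

(** [q s_e u] is exchanged for the adjoint right shift of [u], which passes [pi a] and crosses the
    inner product; there [q] times the right shift of [u] is exchanged for [s_e^* u]. *)
Lemma swap_s a e : (q ^+ 2)%:C * phi (a ⋅ s e) = phi (s e ⋅ a).
Proof.
rewrite /vector_functional !(star_homM hpi) !pi_s expr2 rmorphM -mulrA.
rewrite -[X in _ * X]dotZl -bopZ -u_right.
rewrite -[pi a (cadj (right_s R e) u)]/((pi a ⋅ cadj (right_s R e)) u) commute_right_s_adj.
rewrite bop_mulE dot_cadj [RHS]dot_cadjr u_rep dotZr.
by congr (_ * _); rewrite conjc_q.
Qed.

Lemma swap_adj a e : phi (a ⋅ cadj (s e)) = (q ^+ 2)%:C * phi (cadj (s e) ⋅ a).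
Proof.
have [_ _ piadj] := hpi.
rewrite /vector_functional !(star_homM hpi) !piadj !pi_s u_rep bopZ dotZl.
rewrite -[pi a (right_s R e u)]/((pi a ⋅ right_s R e) u) commute_right_s bop_mulE.
rewrite dot_cadjr u_right dotZr expr2 rmorphM -mulrA; congr (_ * _).
by rewrite dot_cadj; congr (_ * _); rewrite conjc_q.
Qed.

Lemma gibbs_ground : q = 0 -> ground_functional s phi.
Proof.
move=> q0; split.
- exact: vector_functional_positive.
- exact: vector_functional_bounded.
by move=> e; rewrite -swap_s q0 expr0n mul0r.
Qed.

Hypothesis u1 : sqnorm u = 1.

Lemma gibbs_vertex_sum : phi (vertex_sum p) = 1.
Proof. by rewrite /vector_functional pi_vertex_sum dotvv u1. Qed.

Lemma gibbs_state : is_state phi.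
Proof.
apply: (vector_functional_state hpi u1 _ gibbs_vertex_sum).
by apply: projection_nrm; exact: vertex_sum_projection TCK.
Qed.

Variable beta : R.
Hypothesis q_beta : q ^+ 2 = expR (- beta).
Hypothesis beta0 : beta != 0.

(** The value of [e^(-ikz)] at [z = i beta], kept in the form produced by [entire_exp]; it equals
    [e^(beta k)]. *)
Let weight k := cexp (('i%C * beta%:C) * - freq R k).

Let weightE k : weight k = (expR (beta * k%:~R))%:C.
Proof.
rewrite -cexp_real /weight /freq; congr cexp.
rewrite rmorphM /= rmorph_int mulrN mulrACA -expr2 sqr_i.
by rewrite mulN1r opprK.
Qed.

Let swap_letter a k x : letter p s k x -> phi (a ⋅ x) = weight k * phi (x ⋅ a).
Proof.
case=> [v|e|e]; rewrite weightE.
- by rewrite mulr0 expR0 mul1r swap_p.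
- rewrite -swap_s q_beta mulr1 mulrA -rmorphM /= -expRD subrr expR0.
  by rewrite mul1r.
- by rewrite swap_adj q_beta rmorphN1 mulrN1.
Qed.

Let swap_word a k x : word p s k x -> phi (a ⋅ x) = weight k * phi (x ⋅ a).
Proof.
move=> wx; elim: wx a => [{}k {}x lx|{}k l {}x y lx _ ih] a.
  exact: swap_letter.
rewrite cmulA ih cmulA (swap_letter _ lx) mulrA -cmulA; congr (_ * _).
by rewrite /weight freqD opprD mulrDr cexpD mulrC.
Qed.

(** Swapping [x] with the vertex sum, which acts as 1, gives [phi x = e^(beta k) phi x]. *)
Let gibbs_word k x : word p s k x -> k != 0 -> phi x = 0.
Proof.
move=> wx k0; have := swap_word (vertex_sum p) wx.
rewrite /vector_functional !(star_homM hpi) !pi_vertex_sum weightE => h.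
have h1 : (1 - (expR (beta * k%:~R))%:C) * dot (pi x u) u = 0.
  by rewrite mulrBl mul1r -h subrr.
move/eqP: h1; rewrite mulf_eq0 => /orP[|/eqP//].
rewrite subr_eq0 eq_sym => /eqP[hx].
have /expR_inj/eqP : expR (beta * k%:~R) = expR 0 by rewrite expR0.
by rewrite mulf_eq0 (negbTE beta0) intr_eq0 (negbTE k0).
Qed.

Let gibbs_invariant t a : phi (alpha t a) = phi a.
Proof.
have ha := dynamics_star_hom hgamma t.
have hpa := star_hom_comp ha hpi.
apply: (@words_dense _ _ _ _ _ TCK gen [set a | phi (alpha t a) = phi a]).
  apply: (@closed_linear_eq _ _ (vector_functional (pi \o alpha t) u)).
  - by have [] := vector_functional_positive hpa u.
  - by have [] := vector_functional_positive hpi u.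
  - exact: vector_functional_bounded.
  - exact: vector_functional_bounded.
move=> k x wx /=; rewrite (dynamics_word hgamma t wx).
have pos := vector_functional_positive hpi u.
rewrite (pfunZ pos); have [->|k0] := eqVneq k 0.
  by rewrite /freq mulr0 mulr0 cexp_real expR0 mul1r.
by rewrite (gibbs_word wx k0) mulr0.
Qed.

(** For a word [b] of degree [k], invariance gives [phi (b f(t)) = e^(-ikt) phi (b a)] at real [t].
    Both sides are entire, so at [i beta] the factor is [weight k], the one in [swap_word]. *)
Lemma gibbs_KMS : is_KMS alpha beta phi.
Proof.
have pos := vector_functional_positive hpi u.
have [M hM] := vector_functional_bounded hpi u.
split; [exact: gibbs_state|exact: beta0|].
move=> a b f [entf hf] _; move: b.
have bnd (F : A -> A) N : (forall b, nrm (F b) <= N * nrm b) ->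
    bounded_functional (fun b => phi (F b)).
  move=> hF; exists (`|M| * N) => b; apply: le_trans (hM _) _.
  apply: le_trans (ler_wpM2r (nrm_ge0 _) (ler_norm M)) _.
  by rewrite -mulrA ler_wpM2l.
apply: (@words_dense _ _ _ _ _ TCK gen
    [set b | phi (a ⋅ b) = phi (b ⋅ f (0 +i* beta))]).
  apply: closed_linear_eq.
  - by move=> c x y; rewrite cmulDr cmulZr pos.1.
  - by move=> c x y; rewrite cmulDl cmulZl pos.1.
  - by apply: (bnd _ (nrm a)) => b; exact: nrm_cmul.
  - by apply: (bnd _ (nrm (f (0 +i* beta)))) => b; rewrite mulrC; exact: nrm_cmul.
move=> k b wb /=; rewrite (swap_word a wb) /weight.
have ib : 0 +i* beta = 'i%C * beta%:C by apply: complex_ext => /=; ring.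
have := @entire_exp R A (fun x => phi (b ⋅ x)) f (- freq R k) (phi (b ⋅ a)).
move=> ->.
- by rewrite ib.
- by move=> c x y; rewrite cmulDr cmulZr pos.1.
- by apply: (bnd _ (nrm b)) => x; exact: nrm_cmul.
- exact: entf.
move=> t; rewrite hf mulrN -(gibbs_invariant t (b ⋅ a)).
rewrite (dynamicsM hgamma) (dynamics_word hgamma t wb) cmulZl (pfunZ pos) mulrA.
by rewrite [X in X * _]mulrC cexpN mul1r.
Qed.

End GibbsStates.

(** * Ground states among states *)

Section GroundStates.
Variables (R : realType) (E : digraph) (A : cstarAlgType R).
Variables (p : vertex E -> A) (s : edge E -> A) (gamma : R[i] -> A -> A).
Hypothesis TCK : TCK_family p s.
Hypothesis gen : cstar_generated_by (range p `|` range s).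
Hypothesis hgamma : is_gauge_action p s gamma.
Local Notation alpha := (gauge_dynamics gamma).
Implicit Types (a b x y : A) (e f : edge E) (v w : vertex E) (t : R).
Implicit Types (mu nu : gpath E) (psi : A -> R[i]).

Lemma spath_word mu : word p s (plength mu) (spath p s mu).
Proof.
case: mu => [v|e l _] /=; first exact/word_letter/letter_p.
have H (k : nat) a : word p s k a ->
    word p s (k + size l)%N (foldl (fun a e' => a ⋅ s e') a l).
  elim: l k a => [|e' l ih] k a wa /=; first by rewrite addn0.
  rewrite addnS -addSn; apply: ih; rewrite -addn1 PoszD.
  by apply: word_mul wa _; exact/word_letter/letter_s.
by rewrite -add1n; apply: H; exact/word_letter/letter_s.
Qed.

Lemma spath_factor e l (h : path (fun e1 e2 => src e1 == rng e2) e l) :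
  exists y, spath p s (PEdges h) = s e ⋅ y.
Proof.
(* The accumulator of the fold must keep the form [s e] times something; initially that is
   [p (src e)]. *)
suff H y0 : exists y, foldl (fun a e' => a ⋅ s e') (s e ⋅ y0) l = s e ⋅ y.
  by have := H (p (src e)); rewrite (s_src TCK).
elim: l {h} y0 => [|e' l ih] y0 /=; first by exists y0.
by rewrite -cmulA; exact: ih.
Qed.

Lemma state_positive psi : is_state psi -> positive_functional psi.
Proof. by case. Qed.

Lemma state_bounded psi : is_state psi -> bounded_functional psi.
Proof.
case=> _ _ h _; exists 1 => a; rewrite mul1r.
by have := h a; rewrite normc_sqabs nrmE lecR.
Qed.

Lemma ground_adj psi a e : ground_functional s psi -> psi (a ⋅ cadj (s e)) = 0.
Proof.
move=> g; have [pos _ _] := g.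
by rewrite -(cadjK a) (pfun_null pos) //; exact: null_adj g _.
Qed.

Lemma ground_functional_spath psi mu nu : ground_functional s psi ->
  ~ [/\ plength mu = 0%N, plength nu = 0%N & mu = nu] ->
  psi (spath p s mu ⋅ cadj (spath p s nu)) = 0.
Proof.
move=> g; case: mu => [v|e l h]; last first.
  by move=> _; have [y ->] := spath_factor h; rewrite -cmulA (ground_s g).
case: nu => [w hvw|e l h _]; last first.
  by have [y ->] := spath_factor h; rewrite cadjM cmulA (ground_adj _ _ g).
rewrite /= (p_adj TCK) (p_orth TCK) ?(pfun0 (let: And3 h _ _ := g in h)) //.
by apply/eqP => vw; apply: hvw; split=> //; rewrite vw.
Qed.

(** If [nu] has positive length the functional vanishes on the product; otherwise the factor
    [e^(iz|mu|)] has modulus at most 1 on the upper half-plane. *)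
Lemma ground_functional_ground psi : is_state psi -> ground_functional s psi ->
  is_ground alpha (spanning_set p s) psi.
Proof.
move=> st g; split=> // a b [ka [la ->]] [mu [nu ->]].
have pos := state_positive st.
set c := spath p s ka ⋅ _; set b' := spath p s mu ⋅ _.
have wb : word p s (Posz (plength mu) + - Posz (plength nu)) b'.
  by apply: word_mul; [exact: spath_word|apply: (word_cadj TCK); exact: spath_word].
exists (fun z => cexp (z * freq R (Posz (plength mu) + - Posz (plength nu))) *: b').
  by apply: exp_extension => t; exact: dynamics_word wb.
exists (cabs (psi (c ⋅ b'))) => z z0.
rewrite cmulZr (pfunZ pos) normc_sqabs lecR -/(cabs _) cabsM cabs_cexp.
case: nu @b' wb => [w|e l h] b' wb; last first.
  have [y hy] := spath_factor h.
  rewrite /b' hy cadjM 2!cmulA (ground_adj _ _ g).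
  by rewrite cabs_real normr0 mulr0.
rewrite ler_piMl ?cabs_ge0 // -expR0 ler_expR /= subr0 /freq.
case: z z0 => x y /= y0; rewrite -pmulrn natC /=.
rewrite (_ : x * _ - y * _ = - (y * (plength mu)%:R)); last by ring.
by rewrite oppr_le0 mulr_ge0.
Qed.

Lemma ground_ground_functional psi :
  is_ground alpha (spanning_set p s) psi -> ground_functional s psi.
Proof.
move=> [st hg]; have pos := state_positive st; have bnd := state_bounded st.
split=> // e; have nilp : path (fun e1 e2 : edge E => src e1 == rng e2) e [::] by [].
have pe : spanning_set p s (s e).
  by exists (PEdges nilp), (PVertex (src e)); rewrite /= (p_adj TCK) (s_src TCK).
have pa : spanning_set p s (cadj (s e)).
  by exists (PVertex (src e)), (PEdges nilp); rewrite /= (src_adj TCK).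
have [f [entf hf] [M hM]] := hg _ _ pe pa.
have [K hK] := bnd.
have hz z : psi (s e ⋅ f z) = cexp (z * freq R (-1)) * psi (s e ⋅ cadj (s e)).
  apply: (@entire_exp R A (fun x => psi (s e ⋅ x))) => //.
  - by move=> c x y; rewrite cmulDr cmulZr pos.1.
  - exists (`|K| * nrm (s e)) => x; apply: le_trans (hK _) _.
    apply: le_trans (ler_wpM2r (nrm_ge0 _) (ler_norm K)) _.
    by rewrite -mulrA ler_wpM2l // nrm_cmul.
  move=> t; rewrite hf (dynamics_letter hgamma t (letter_adj p s e)).
  by rewrite cmulZr (pfunZ pos).
apply/cabs_eq0/eqP; rewrite eq_le cabs_ge0 andbT leNgt; apply/negP => C0.
set C := cabs _ in C0.
have hy (y : R) : 0 <= y -> (1 + y) * C <= M.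
  move=> y0; have := hM (0 +i* y) y0; rewrite hz normc_sqabs lecR -/(cabs _).
  rewrite cabsM cabs_cexp -/C => h; apply: le_trans h; rewrite (ler_wpM2r (ltW C0)) //.
  rewrite (_ : complex.Re _ = y); first exact: expR_ge1Dx.
  by rewrite /freq rmorphN1 /=; ring.
have M0 : 0 <= M by apply: le_trans (hy 0 (lexx _)); rewrite addr0 mul1r ltW.
(* At this [y] the bound [(1 + y) C <= M] reads [C + M <= M]. *)
have := hy (M / C) (divr_ge0 M0 (ltW C0)).
by rewrite mulrDl mul1r divfK ?gt_eqF // => h; lra.
Qed.

(** With [P] the vertex sum, [|psi a|^2 = |psi (P a)|^2 <= psi P |a|^2], so the norm of [psi] is at
    most the square root of [psi P]; norm 1 then gives [psi P >= 1]. *)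
Lemma ground_state_vertex_sum psi : is_state psi -> ground_functional s psi ->
  psi (vertex_sum p) = 1.
Proof.
move=> st g; have pos := state_positive st; have [_ _ hle hnorm] := st.
have [Padj Pidem] := vertex_sum_projection TCK.
have PP := pfun_real pos (vertex_sum p); rewrite Padj Pidem in PP.
have P0 := pfun_ge0 pos (vertex_sum p); rewrite Padj Pidem in P0.
set r := complex.Re _ in PP P0; rewrite PP; congr _%:C.
apply/eqP; rewrite eq_le; apply/andP; split.
  have := hle (vertex_sum p); rewrite PP normc_sqabs nrmE lecR -/(cabs _) cabs_real.
  rewrite ger0_norm // => h; apply: le_trans h _.
  exact/projection_nrm/(vertex_sum_projection TCK).
rewrite -(sqr_sqrtr P0) exprn_ege1 //; apply: hnorm => a.
rewrite normc_sqabs nrmE -rmorphM lecR (ground_vertex_sum TCK gen g) -{1}Padj.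
rewrite -(@ler_pXn2r _ 2) ?nnegrE ?mulr_ge0 ?sqrtr_ge0 ?nrm_ge0 //.
rewrite exprMn !sqr_sqrtr ?sqabs_ge0 //.
have [_ h] := pfun_cauchy_schwarz pos (vertex_sum p) a.
rewrite Padj Pidem in h; rewrite Padj; apply: le_trans h _; rewrite ler_wpM2l //.
have := hle (cadj a ⋅ a); rewrite (pfun_real pos a) normc_sqabs nrmE lecR.
rewrite -/(cabs _) cabs_real nrm_cstar ger0_norm //; exact: pfun_ge0.
Qed.

End GroundStates.

(** * The limit of zero temperature *)

Section VacuumVectors.
Variables (R : realType) (E : digraph).
Local Notation J :=
  ((seq (edge E) * vertex E) * (seq (edge E) * vertex E))%type.
Local Notation H := (hilb R J).
Variables (eps : {ffun vertex E -> R}) (heps : prob_simplex eps).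
Implicit Types (u : H) (v w : vertex E) (q : R).

Lemma weight0 : #|edge E|%:R * 0 ^+ 2 < 1 :> R.
Proof. by rewrite expr0n mulr0 ltr01. Qed.

Let nil_pair w : J := (([::], w), ([::], w)).

Lemma diag_vec_nil q w : #|edge E|%:R * q ^+ 2 < 1 ->
  diag_vec q eps (nil_pair w) = (Num.sqrt (eps w))%:C.
Proof. by move=> hq; rewrite diag_vecE // /diag_fun eqxx /= expr0 mul1r. Qed.

(** Since [0 ^+ 0 = 1], at [q = 0] exactly the entries at empty lists survive. *)
Lemma dot_vacuum u : dot u (diag_vec 0 eps) =
  \sum_w u (nil_pair w) * (Num.sqrt (eps w))%:C.
Proof.
pose l := [seq nil_pair w | w <- enum (vertex E)].
have ul : uniq l by rewrite map_inj_uniq ?enum_uniq // => v w [].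
apply: dot_eq; have := @has_csum_fin R J
  (fun j => u j * (diag_vec 0 eps j)^*%C) l ul.
rewrite /l big_map big_enum /= => h.
have -> : \sum_w u (nil_pair w) * (Num.sqrt (eps w))%:C =
    \sum_w u (nil_pair w) * (diag_vec 0 eps (nil_pair w))^*%C.
  apply: eq_bigr => w _; rewrite diag_vec_nil ?weight0 //; congr (_ * _).
  by apply: complex_ext => //=; rewrite oppr0.
apply: h => -[[m v] [m' v']] hj; rewrite diag_vecE ?weight0 // /diag_fun /=.
case: eqP => [[em ev]|_]; last by rewrite conjc0 mulr0.
case: m em hj => [|e m] em hj; last first.
  by rewrite /= expr0n mul0r oppr0; exact: mulr0.
case/negP: hj; apply/mapP; exists v; first by rewrite mem_enum.
by rewrite /nil_pair -em -ev.
Qed.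

Lemma dot_diag_vacuum q : #|edge E|%:R * q ^+ 2 < 1 ->
  dot (diag_vec q eps) (diag_vec 0 eps) = 1.
Proof.
move=> hq; have [e0 e1] := heps.
rewrite dot_vacuum -[RHS]/(1%:C) -e1 rmorph_sum; apply: eq_bigr => w _.
by rewrite diag_vec_nil // -rmorphM /= -expr2 sqr_sqrtr.
Qed.

Lemma sqnorm_vacuum : sqnorm (diag_vec 0 eps : H) = 1.
Proof. by rewrite /sqnorm dot_diag_vacuum ?weight0. Qed.

Lemma vacuum_p v :
  dot (rep_p R v (diag_vec 0 eps)) (diag_vec 0 eps) = (eps v)%:C.
Proof.
have [e0 _] := heps.
have hv w : rep_p R v (diag_vec 0 eps) (nil_pair w) =
    if w == v then (Num.sqrt (eps w))%:C else 0.
  by rewrite /nil_pair rep_pE -/(nil_pair w) diag_vec_nil ?weight0.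
rewrite dot_vacuum (bigD1 v) // hv eqxx -rmorphM -expr2 sqr_sqrtr // big1.
  exact: addr0.
by move=> w wv; rewrite hv (negbTE wv) mul0r.
Qed.

(* Normalizing [diag_vec q eps] moves it to the vacuum vector as [q -> 0]. *)
Lemma normalized_diag q : #|edge E|%:R * q ^+ 2 < 1 ->
  exists c : R, sqnorm (c%:C *: diag_vec q eps : H) = 1 /\
    sqnorm (c%:C *: diag_vec q eps - diag_vec 0 eps : H)
      <= 2 * (#|edge E|%:R * q ^+ 2).
Proof.
move=> hq; set Z := sqnorm (diag_vec q eps : H).
have Z1 : 1 <= Z.
  have := dot_cauchy_schwarz (diag_vec q eps) (diag_vec 0 eps).
  rewrite dot_diag_vacuum // sqnorm_vacuum mulr1.
  by rewrite /sqabs /= expr0n expr1n addr0.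
have Z0 : 0 < Z by exact: lt_le_trans Z1.
have sZ0 : 0 < Num.sqrt Z by rewrite sqrtr_gt0.
have ZN := sqnorm_diag_le heps hq; rewrite -/Z in ZN.
set N := _ * _ in hq ZN *.
have hN : 1 - N <= Z^-1.
  by rewrite -[1 - N]invrK lef_pV2 ?posrE ?invr_gt0 ?subr_gt0.
(* The inner product with the vacuum is 1 before scaling, so the squared distance is [2 - 2c]; with
   [c >= 1/Z >= 1 - N] it is at most [2N]. *)
pose c := (Num.sqrt Z)^-1; exists c.
have cZ : Z^-1 <= c.
  rewrite /c lef_pV2 ?posrE //.
  have s1 : 1 <= Num.sqrt Z by rewrite -sqrtr1 ler_wsqrtr.
  have ZE : Z = Num.sqrt Z * Num.sqrt Z by rewrite -expr2 sqr_sqrtr // ltW.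
  by rewrite [X in _ <= X]ZE ler_peMl // ltW.
have unit : sqnorm (c%:C *: diag_vec q eps : H) = 1.
  rewrite /sqnorm dotZl dotZr dotvv -/Z conjc_q -!rmorphM /=.
  by rewrite /c mulrA -expr2 exprVn sqr_sqrtr ?(ltW Z0) // mulVf ?gt_eqF.
split; first exact: unit.
rewrite {1}/sqnorm dotDl !dotDr !dotNl !dotNr opprK !dotvv unit sqnorm_vacuum.
rewrite (dotC (diag_vec 0 eps)) !dotZl !dot_diag_vacuum //.
rewrite (_ : complex.Re _ = 2 - 2 * c); first lra.
by rewrite /=; ring.
Qed.

End VacuumVectors.

Lemma cabs_combination (R : realType) (t t' M M' : R) (c c' : R[i]) :
  0 <= t -> 0 <= t' -> cabs c <= M -> cabs c' <= M' ->
  cabs (t%:C * c + t'%:C * c') <= t * M + t' * M'.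
Proof.
move=> t0 t1 h h'; apply: le_trans (cabsD _ _) _.
by rewrite !cabsM !cabs_real !ger0_norm // lerD // ler_wpM2l.
Qed.

Section VacuumStates.
Variables (R : realType) (E : digraph) (A : cstarAlgType R).
Variables (p : vertex E -> A) (s : edge E -> A) (gamma : R[i] -> A -> A).
Hypothesis TCK : TCK_family p s.
Hypothesis gen : cstar_generated_by (range p `|` range s).
Hypothesis hgamma : is_gauge_action p s gamma.
Local Notation J :=
  ((seq (edge E) * vertex E) * (seq (edge E) * vertex E))%type.
Local Notation alpha := (gauge_dynamics gamma).
Variables (pi : A -> bop R J) (hpi : star_hom pi).
Hypotheses (pi_p : forall v, pi (p v) = rep_p R v).
Hypotheses (pi_s : forall e, pi (s e) = rep_s R e).
Implicit Types (eps : {ffun vertex E -> R}).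

Definition vacuum_state eps : A -> R[i] :=
  vector_functional pi (diag_vec 0 eps).

Lemma vacuum_ground_functional eps : prob_simplex eps ->
  ground_functional s (vacuum_state eps).
Proof.
move=> heps; apply: (@gibbs_ground _ _ _ _ _ TCK gen pi hpi pi_p pi_s _ 0) => //.
- by move=> e; apply: diag_right_s => //; exact: weight0.
- by move=> e; apply: diag_rep_s => //; exact: weight0.
Qed.

Lemma vacuum_state_p eps v : prob_simplex eps ->
  vacuum_state eps (p v) = (eps v)%:C.
Proof.
by move=> heps; rewrite /vacuum_state /vector_functional pi_p vacuum_p.
Qed.

Lemma vacuum_is_state eps : prob_simplex eps -> is_state (vacuum_state eps).
Proof.
move=> heps; apply: (gibbs_state TCK hpi pi_p); exact: sqnorm_vacuum.
Qed.

Lemma edge_weight_bound (n : nat) :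
  #|edge E|%:R * expR (- (n + #|edge E|).+1%:R) <= #|edge E|%:R / n.+1%:R :> R.
Proof.
rewrite ler_wpM2l // expRN lef_pV2 ?posrE ?expR_gt0 //.
apply: le_trans (expR_ge1Dx _); apply: le_trans (_ : (n + #|edge E|).+1%:R <= _).
  by rewrite ler_nat ltnS leq_addr.
by rewrite lerDr.
Qed.

Lemma edge_weight_lt1 (n : nat) :
  #|edge E|%:R * expR (- (n + #|edge E|).+1%:R) < 1 :> R.
Proof.
rewrite expRN ltr_pdivrMr ?expR_gt0 // mul1r.
apply: lt_le_trans (expR_ge1Dx _); rewrite nat1r ltr_nat ltnS.
by apply: leqW; exact: leq_addl.
Qed.

Lemma vacuum_KMS_infty eps : prob_simplex eps ->
  is_KMS_infty alpha (vacuum_state eps).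
Proof.
move=> heps; split; first exact: vacuum_is_state.
(* From [e^beta >= 1 + beta], the summand [#|edge E|] makes [#|edge E| e^(-beta) < 1] for every [n],
   and the summand [n] yields the rate [#|edge E| / (n + 1)]. *)
pose beta n : R := (n + #|edge E|).+1%:R.
pose q n : R := Num.sqrt (expR (- beta n)).
have q2 n : q n ^+ 2 = expR (- beta n) by rewrite sqr_sqrtr ?expR_ge0.
have hq n : #|edge E|%:R * q n ^+ 2 < 1 by rewrite q2; exact: edge_weight_lt1.
have [c hc] := choice (fun n => normalized_diag heps (hq n)).
pose u n : hilb R J := (c n)%:C *: diag_vec (q n) eps.
exists beta, (fun n => vector_functional pi (u n)); split.
- move=> n; apply: (@gibbs_KMS _ _ _ _ _ _ TCK gen hgamma pi hpi pi_p pi_s _ (q n)).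
  + by move=> v; rewrite !bopZ diag_rep_p.
  + by move=> e; rewrite !bopZ diag_right_s // !scalerA mulrC.
  + by move=> e; rewrite !bopZ diag_rep_s // !scalerA mulrC.
  + exact: (hc n).1.
  + exact: q2.
  + by rewrite pnatr_eq0.
- apply/cvgryPge => M; exists (Num.truncn M) => // n /= Mn.
  apply: le_trans (ltW (truncnS_gt M)) _; rewrite ler_nat ltnS.
  by apply: leq_trans Mn _; exact: leq_addr.
move=> a; apply/cvg_complexP => e e0.
have K0 : 0 < 2 * nrm a + 1 by have := nrm_ge0 a; lra.
set d := e / (2 * nrm a + 1); have d0 : 0 < d by exact: divr_gt0.
(* From here on [2 #|edge E| / (n + 1) <= d^2], the bound on the squared distance to the vacuum
   vector. *)
exists (Num.truncn (2 * #|edge E|%:R / d ^+ 2)) => n Nn.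
have u1 : hnorm (u n) = 1 by rewrite /hnorm (hc n).1 sqrtr1.
have v1 : hnorm (diag_vec 0 eps : hilb R J) = 1.
  by rewrite /hnorm sqnorm_vacuum // sqrtr1.
apply: le_lt_trans (vector_functional_close hpi a u1 v1) _.
have small : hnorm (u n - diag_vec 0 eps) <= d.
  rewrite -(@ler_pXn2r _ 2) ?nnegrE ?hnorm_ge0 ?(ltW d0) // hnorm_sq.
  apply: le_trans (hc n).2 _; rewrite q2.
  apply: (@le_trans _ _ (2 * (#|edge E|%:R / n.+1%:R))).
    by rewrite ler_pM2l //; exact: edge_weight_bound.
  rewrite mulrA ler_pdivrMr // [leRHS]mulrC -ler_pdivrMr ?exprn_gt0 //.
  by apply: le_trans (ltW (truncnS_gt _)) _; rewrite ler_nat ltnS.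
apply: le_lt_trans (ler_wpM2l (mulr_ge0 _ (nrm_ge0 a)) small) _ => //.
by rewrite /d mulrCA -[ltRHS]mulr1 ltr_pM2l // ltr_pdivrMr // mul1r ltrDl.
Qed.

Lemma ground_is_vacuum psi : is_ground alpha (spanning_set p s) psi ->
  exists2 eps, prob_simplex eps & vacuum_state eps = psi.
Proof.
move=> hg; have st := hg.1; have g := ground_ground_functional TCK hgamma hg.
have pos := state_positive st.
have psi_p v : psi (p v) = (complex.Re (psi (p v)))%:C.
  by have := pfun_real pos (p v); rewrite (p_adj TCK) (p_idem TCK).
pose eps : {ffun vertex E -> R} := [ffun v => complex.Re (psi (p v))].
have heps : prob_simplex eps.
  split=> [v|].
    by rewrite ffunE; have := pfun_ge0 pos (p v); rewrite (p_adj TCK) (p_idem TCK).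
  apply/(@complexI R); rewrite -[RHS](ground_state_vertex_sum TCK gen st g).
  rewrite rmorph_sum (big_morph psi (pfunD pos) (pfun0 pos)).
  by apply: eq_bigr => v _; rewrite ffunE [RHS]psi_p.
exists eps => //.
apply: (ground_functional_unique TCK gen (vacuum_ground_functional heps) g) => v.
by rewrite vacuum_state_p // ffunE -psi_p.
Qed.

(** The vector depends on [eps] through square roots, so affinity is not visible in the formula; but
    both sides are ground functionals that agree on the [p v]. *)
Lemma vacuum_affine (t : R) eps eps' : 0 <= t <= 1 ->
  prob_simplex eps -> prob_simplex eps' ->
  vacuum_state [ffun v => t * eps v + (1 - t) * eps' v] =
  fun a => t%:C * vacuum_state eps a + (1 - t)%:C * vacuum_state eps' a.
Proof.
move=> /andP[t0 t1] h h'; have [e0 e1] := h; have [e0' e1'] := h'.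
have t1' : 0 <= 1 - t by lra.
have hmix : prob_simplex [ffun v => t * eps v + (1 - t) * eps' v].
  split=> [v|]; first by rewrite ffunE addr_ge0 // mulr_ge0.
  under eq_bigr do rewrite ffunE.
  by rewrite big_split /= -!mulr_sumr e1 e1'; lra.
have [pos [M hM] z] := vacuum_ground_functional h.
have [pos' [M' hM'] z'] := vacuum_ground_functional h'.
apply: (ground_functional_unique TCK gen (vacuum_ground_functional hmix)).
  split; last by move=> e; rewrite z z' !mulr0 addr0.
    split=> [c a b|a].
      rewrite (pos.1 c a b) (pos'.1 c a b) !mulrDr !(mulrCA _ c).
      by rewrite addrACA.
    have c0 : 0 <= t%:C :> R[i] by rewrite lecR.
    have c1 : 0 <= (1 - t)%:C :> R[i] by rewrite lecR.
    exact: addr_ge0 (mulr_ge0 c0 (pos.2 a)) (mulr_ge0 c1 (pos'.2 a)).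
  exists (t * M + (1 - t) * M') => a; rewrite mulrDl -!mulrA.
  exact: cabs_combination t0 t1' (hM a) (hM' a).
by move=> v; rewrite !vacuum_state_p // ffunE rmorphD !rmorphM.
Qed.

End VacuumStates.

Theorem proposition5p1 (R : realType) (E : digraph) (A : cstarAlgType R)
    (p : vertex E -> A) (s : edge E -> A) (gamma : R[i] -> A -> A)
    (hA : is_toeplitz_algebra p s) (hgamma : is_gauge_action p s gamma) :
  let alpha := gauge_dynamics gamma in
  let ground := [set phi | is_ground alpha (spanning_set p s) phi] in
  exists phi : {ffun vertex E -> R} -> A -> R[i],
    [/\ forall eps, prob_simplex eps ->
          [/\ is_KMS_infty alpha (phi eps),
              forall v : vertex E,
                phi eps (spath p s (PVertex v) ⋅ cadj (spath p s (PVertex v)))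
                  = (eps v)%:C
            & forall mu nu : gpath E,
                ~ [/\ plength mu = 0%N, plength nu = 0%N & mu = nu] ->
                phi eps (spath p s mu ⋅ cadj (spath p s nu)) = 0],
        forall psi, ground psi -> is_KMS_infty alpha psi
      & affine_iso (@prob_simplex R (vertex E)) ground phi].
Proof.
have [TCK gen univ] := hA; move=> alpha ground.
have [pi [hpi pi_p pi_s]] := univ _ _ _ (rep_TCK R E).
have gf := vacuum_ground_functional TCK gen hpi pi_p pi_s.
exists (vacuum_state pi); split.
- move=> eps heps; split.
  + exact: (vacuum_KMS_infty TCK gen hgamma hpi pi_p pi_s).
  + by move=> v; rewrite /= (p_adj TCK) (p_idem TCK) vacuum_state_p.
  + by move=> mu nu; exact: ground_functional_spath TCK _ _ _ (gf _ heps).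
- move=> psi hpsi.
  have [eps heps <-] := ground_is_vacuum TCK gen hgamma hpi pi_p pi_s hpsi.
  exact: (vacuum_KMS_infty TCK gen hgamma hpi pi_p pi_s).
split; last exact: (vacuum_affine TCK gen hpi pi_p pi_s).
split.
- move=> eps heps; apply: (ground_functional_ground TCK hgamma); last exact: gf.
  exact: (vacuum_is_state TCK hpi pi_p).
- move=> eps eps' /set_mem h /set_mem h' eqphi; apply/ffunP => v.
  have := vacuum_state_p pi_p v h; rewrite eqphi (vacuum_state_p pi_p v h').
  by move/(@complexI R).
- move=> psi hpsi.
  by have [eps] := ground_is_vacuum TCK gen hgamma hpi pi_p pi_s hpsi; exists eps.
Qed.
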